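(* Let $\Gamma$ be a finite connected graph and let $A_\Gamma$ be the associated right-angled Artin group. Then for every $n \geq 1$ and all strongly quasiconvex subgroups $H_1, \dots, H_n$ of $A_\Gamma$, the setwise product $H_1 \cdots H_n = \{h_1 \cdots h_n : h_i \in H_i\}$ is separable in $A_\Gamma$.
   Context: For a finite simplicial graph $\Gamma$, the right-angled Artin group $A_\Gamma$ is the group generated by the vertices of $\Gamma$ subject to the relations $vw = wv$ for each pair of adjacent vertices $v,w$. Profinite topology: the topology on a group $G$ whose basic open sets are the cosets of finite index subgroups of $G$. A subset of $G$ is separable if it is closed in this topology. Cayley graph: for a finite generating set $S$ of a group $G$, $\mathrm{Cay}(G,S)$ has vertex set $G$, with $g,h$ joined by an edge if $g^{-1}h \in S$ or $h^{-1}g \in S$. It is regarded as a geodesic metric space by giving each edge length one. Quasigeodesics: a map $f\colon X \to Y$ of metric spaces is a $(\lambda,c)$-quasi-isometric embedding ($\lambda \geq 1$, $c \geq 0$) if $\frac{1}{\lambda} d_Y(f(x),f(y)) - c \leq d_X(x,y) \leq \lambda d_Y(f(x),f(y)) + c$ for all $x,y \in X$. A $(\lambda,c)$-quasigeodesic is a $(\lambda,c)$-quasi-isometric embedding of an interval $I \subseteq \mathbb{R}$. Strongly quasiconvex (also called Morse) subgroups: a subgroup $H$ of a finitely generated group $G$ with finite generating set $S$ is strongly quasiconvex if for all $\lambda \geq 1$ and $c \geq 0$ there is $m = m(\lambda,c) \geq 0$ such that every $(\lambda,c)$-quasigeodesic in $\mathrm{Cay}(G,S)$ with endpoints in $H$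 lies in the $m$-neighbourhood of $H$. This does not depend on the choice of $S$. *)

(* Defs.v *)
From HB Require Import structures.
From mathcomp Require Import all_boot all_order all_algebra.
From mathcomp Require Import all_classical all_reals all_analysis.
From mathcomp Require Import ring.
Import Order.TTheory GRing.Theory Num.Theory.
Import numFieldNormedType.Exports.

Set Implicit Arguments.
Unset Strict Implicit.
Unset Printing Implicit Defensive.

Local Open Scope classical_set_scope.
Local Open Scope ring_scope.
Local Open Scope quotient_scope.

(* The letter [(x, true)] stands for the generator [x], and [(x, false)] for
   its formal inverse. *)
Definition word (T : Type) := seq (T * bool).

Definition winv (T : Type) (w : word T) : word T :=
  rev [seq (l.1, ~~ l.2) | l <- w].

Section Presentation.
Context (T : choiceType) (rel : word T -> word T -> Prop).

Inductive pres_eq : word T -> word T -> Prop :=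
| pres_refl u : pres_eq u u
| pres_sym u v : pres_eq u v -> pres_eq v u
| pres_trans u v w : pres_eq u v -> pres_eq v w -> pres_eq u w
| pres_cat u u' v v' : pres_eq u u' -> pres_eq v v' ->
    pres_eq (u ++ v) (u' ++ v')
| pres_cancel x b : pres_eq [:: (x, b); (x, ~~ b)] [::]
| pres_rel u v : rel u v -> pres_eq u v.

Definition pres_eqb (u v : word T) : bool := `[< pres_eq u v >].

Lemma pres_eqb_refl : reflexive pres_eqb.
Proof. by move=> u; apply/asboolP; exact: pres_refl. Qed.

Lemma pres_eqb_sym : symmetric pres_eqb.
Proof. by move=> u v; apply/asboolP/asboolP; exact: pres_sym. Qed.

Lemma pres_eqb_trans : transitive pres_eqb.
Proof.
by move=> v u w /asboolP uv /asboolP vw; apply/asboolP; exact: pres_trans uv vw.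
Qed.

Canonical pres_equiv :=
  EquivRel pres_eqb pres_eqb_refl pres_eqb_sym pres_eqb_trans.

Definition presented : Type := {eq_quot pres_equiv}.

HB.instance Definition _ := Choice.on presented.
HB.instance Definition _ := EqQuotient.on presented.

Lemma presP u v : reflect (pres_eq u v) (\pi_presented u == \pi_presented v).
Proof. by rewrite (sameP eqP (eqmodP _ _ _)); exact: asboolP. Qed.

Lemma pres_reprK (g : presented) : \pi_presented (repr g) = g.
Proof. exact: reprK. Qed.

Lemma pres_repr u : pres_eq (repr (\pi_presented u)) u.
Proof. by apply/presP; rewrite reprK. Qed.

Lemma pres_winv_l u : pres_eq (winv u ++ u) [::].
Proof.
elim: u => [|[x b] u IH]; first exact: pres_refl.
rewrite /winv /= rev_cons -cats1 -catA /=.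
apply: pres_trans IH; apply: pres_cat; first exact: pres_refl.
rewrite -[u in X in pres_eq _ X]cat0s -[_ :: _ :: u]/([:: _; _] ++ u).
apply: pres_cat; last exact: pres_refl.
by have := pres_cancel x (~~ b); rewrite negbK.
Qed.

Lemma winvK : involutive (@winv T).
Proof.
move=> u; rewrite /winv map_rev revK -map_comp -[RHS]map_id.
by apply: eq_map => -[x b] /=; rewrite negbK.
Qed.

Lemma pres_winv_r u : pres_eq (u ++ winv u) [::].
Proof. by have := pres_winv_l (winv u); rewrite winvK. Qed.

Lemma pres_winv u v : pres_eq u v -> pres_eq (winv u) (winv v).
Proof.
move=> uv.
have h1 : pres_eq (winv u ++ (v ++ winv v)) (winv u).
  rewrite -[X in pres_eq _ X]cats0.
  by apply: pres_cat; [exact: pres_refl | exact: pres_winv_r].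
apply: pres_trans (pres_sym h1) _; rewrite catA -[X in pres_eq _ X]cat0s.
apply: pres_cat; last exact: pres_refl.
apply: pres_trans (pres_winv_l u).
by apply: pres_cat; [exact: pres_refl | exact: pres_sym].
Qed.

Definition pres_one : presented := \pi_presented [::].
Definition pres_mul (g h : presented) : presented := \pi_presented (repr g ++ repr h).
Definition pres_inv (g : presented) : presented := \pi_presented (winv (repr g)).

Lemma pi_mul u v :
  pres_mul (\pi_presented u) (\pi_presented v) = \pi_presented (u ++ v).
Proof. by apply/eqP/presP/pres_cat; exact: pres_repr. Qed.

Lemma pi_inv u : pres_inv (\pi_presented u) = \pi_presented (winv u).
Proof. by apply/eqP/presP/pres_winv; exact: pres_repr. Qed.

Lemma pres_mulA : associative pres_mul.
Proof.
move=> g h k; rewrite -(pres_reprK g) -(pres_reprK h) -(pres_reprK k).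
by rewrite !pi_mul catA.
Qed.

Lemma pres_mul1 : left_id pres_one pres_mul.
Proof. by move=> g; rewrite -(pres_reprK g) pi_mul. Qed.

Lemma pres_mulr1 : right_id pres_one pres_mul.
Proof. by move=> g; rewrite -(pres_reprK g) pi_mul cats0. Qed.

Lemma pres_mulV : left_inverse pres_one pres_inv pres_mul.
Proof.
by move=> g; rewrite -(pres_reprK g) pi_inv pi_mul; apply/eqP/presP/pres_winv_l.
Qed.

Lemma pres_mulrV : right_inverse pres_one pres_inv pres_mul.
Proof.
by move=> g; rewrite -(pres_reprK g) pi_inv pi_mul; apply/eqP/presP/pres_winv_r.
Qed.

HB.instance Definition _ := isGroup.Build presented
  pres_mulA pres_mul1 pres_mulr1 pres_mulV pres_mulrV.

Definition pres_gen (x : T) : presented := \pi_presented [:: (x, true)].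

End Presentation.

(* A finite simplicial graph is a symmetric irreflexive relation [e] on a
   [finType]. *)
Definition connected_graph (V : finType) (e : rel V) := forall x y, connect e x y.

Inductive raag_rel (V : finType) (e : rel V) : word V -> word V -> Prop :=
| raag_comm v w : e v w ->
    raag_rel e [:: (v, true); (w, true)] [:: (w, true); (v, true)].

Definition raag (V : finType) (e : rel V) : groupType := presented (raag_rel e).

Section Subgroups.
Context (G : groupType).
Local Open Scope group_scope.

Definition is_subgroup (H : set G) := group_closed [in H].

Lemma is_subgroupP (H : set G) :
  is_subgroup H <-> H 1 /\ forall x y, H x -> H y -> H (x / y).
Proof.
split=> [[/set_mem H1 Hd]|[H1 Hd]]; split=> //.
- by move=> x y Hx Hy; apply/set_mem/Hd; apply/mem_set.
- exact/mem_set.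
- by move=> x y /set_mem Hx /set_mem Hy; apply/mem_set/Hd.
Qed.

Definition left_coset (g : G) (H : set G) : set G := [set g * h | h in H].

Definition finite_index (H : set G) :=
  finite_set [set left_coset g H | g in [set: G]].

Definition set_prod (n : nat) (H : 'I_n -> set G) : set G :=
  [set \prod_(i < n) h i | h in [set h : 'I_n -> G | forall i, H i (h i)]].

Lemma cosetE (g : G) (H : set G) x : left_coset g H x <-> H (g^-1 * x).
Proof.
split=> [[h Hh <-]|Hx]; first by rewrite mulKg.
by exists (g^-1 * x) => //; rewrite mulVKg.
Qed.

Lemma coset_id (H : set G) g : is_subgroup H -> left_coset g H g.
Proof. by move=> /is_subgroupP[H1 _]; apply/cosetE; rewrite mulVg. Qed.

Lemma subgroupV (H : set G) x : is_subgroup H -> H x -> H x^-1.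
Proof. by move=> /is_subgroupP[H1 Hd] Hx; rewrite -div1g; exact: Hd. Qed.

Lemma subgroupM (H : set G) x y : is_subgroup H -> H x -> H y -> H (x * y).
Proof.
move=> sH Hx Hy; rewrite -[y]invgK; have /is_subgroupP[_ Hd] := sH.
by apply: Hd => //; exact: subgroupV.
Qed.

Lemma coset_eq (H : set G) g x : is_subgroup H -> left_coset g H x ->
  left_coset x H = left_coset g H.
Proof.
move=> sH /cosetE gx; apply/seteqP; split=> y /cosetE hy; apply/cosetE.
  have -> : g^-1 * y = (g^-1 * x) * (x^-1 * y) by rewrite -mulgA mulVKg.
  exact: subgroupM.
have -> : x^-1 * y = (g^-1 * x)^-1 * (g^-1 * y).
  by rewrite invgM invgK -mulgA mulVKg.
by apply: subgroupM => //; exact: subgroupV.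
Qed.

Lemma is_subgroupT : is_subgroup [set: G].
Proof. exact/is_subgroupP. Qed.

Lemma is_subgroupI (H K : set G) :
  is_subgroup H -> is_subgroup K -> is_subgroup (H `&` K).
Proof.
move=> /is_subgroupP[H1 Hd] /is_subgroupP[K1 Kd].
by apply/is_subgroupP; split=> // x y [? ?] [? ?]; split; auto.
Qed.

Lemma cosetI (H K : set G) g :
  left_coset g (H `&` K) = left_coset g H `&` left_coset g K.
Proof.
apply/seteqP; split=> x /=; first by move=> /cosetE[? ?]; split; apply/cosetE.
by move=> [/cosetE ? /cosetE ?]; apply/cosetE.
Qed.

Lemma finite_indexT : finite_index [set: G].
Proof.
apply: (@sub_finite_set _ _ [set [set: G]]); last exact: finite_set1.
by move=> _ [g _ <-]; apply/seteqP; split=> // x _; apply/cosetE.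
Qed.

Lemma finite_indexI (H K : set G) :
  finite_index H -> finite_index K -> finite_index (H `&` K).
Proof.
move=> fH fK; apply: sub_finite_set (finite_image2 (@setI G) fH fK).
move=> _ [g _ <-] /=.
exists (left_coset g H); first by exists g.
by exists (left_coset g K); [exists g|rewrite cosetI].
Qed.

End Subgroups.

Definition profinite (G : groupType) : Type := G.

HB.instance Definition _ (G : groupType) := Group.on (profinite G).
HB.instance Definition _ (G : groupType) := isPointed.Build (profinite G) 1%g.

Section ProfiniteTopology.
Context (G : groupType).
Local Open Scope group_scope.

Let I : pointedType := (profinite G * set (profinite G))%type.
Let D : set I := [set i | is_subgroup i.2 /\ finite_index i.2].
Let b (i : I) : set (profinite G) := left_coset i.1 i.2.

Let b_cover : \bigcup_(i in D) b i = setT.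
Proof.
apply/seteqP; split=> // x _; exists (x, setT).
  by split; [exact: is_subgroupT|exact: finite_indexT].
by apply: coset_id; exact: is_subgroupT.
Qed.

Let b_join i j t : D i -> D j -> b i t -> b j t ->
  exists k, [/\ D k, b k t & b k `<=` b i `&` b j].
Proof.
move=> [si fi] [sj fj] bi bj; exists (t, i.2 `&` j.2); split.
- by split; [exact: is_subgroupI|exact: finite_indexI].
- by apply: coset_id; exact: is_subgroupI.
- by rewrite /b /= cosetI (coset_eq si bi) (coset_eq sj bj).
Qed.

HB.instance Definition _ :=
  isBaseTopological.Build (profinite G) b_cover b_join.

End ProfiniteTopology.

Definition separable (G : groupType) (A : set G) :=
  closed (A : set (profinite G)).

Record fin_gen_set (G : groupType) := FinGenSet {
  gens : set G ;
  gens_finite : finite_set gens ;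
  gens_spec : smallest (@is_subgroup G) gens = [set: G] }.

Section RaagGenerators.
Context (V : finType) (e : rel V).

Definition raag_gens : set (raag e) := range (pres_gen (raag_rel e)).

Lemma raag_gens_finite : finite_set raag_gens.
Proof. exact/finite_image/finite_finset. Qed.

Lemma raag_gens_spec : smallest (@is_subgroup (raag e)) raag_gens = setT.
Proof.
apply/seteqP; split=> // g _ M [/= sM gM]; rewrite -(pres_reprK g).
elim: (repr g) => [|[v b] u IH]; first by have /is_subgroupP[] := sM.
rewrite -[_ :: _]/([:: (v, b)] ++ u) -pi_mul.
apply: (@subgroupM (raag e) M _ _ sM) => //.
have Mv : M (pres_gen (raag_rel e) v) by apply: gM; exists v.
by case: b => //; have := subgroupV sM Mv; rewrite [_^-1%g]pi_inv.
Qed.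

Definition raag_gen_set : fin_gen_set (raag e) :=
  FinGenSet raag_gens_finite raag_gens_spec.

End RaagGenerators.

Section CayleyGraph.
Context (R : realType) (G : groupType) (S : fin_gen_set G).

Definition cayley_adj (g h : G) := gens S (g^-1 * h)%g \/ gens S (h^-1 * g)%g.

(* The geometric realization in barycentric coordinates: the point at distance
   [t] from [g] on the edge joining [g] to [h] is the function
   [(1 - t) 1_g + t 1_h]. *)
Definition edge_point (g h : G) (t : R) : G -> R :=
  fun k => (1 - t) * (k == g)%:R + t * (k == h)%:R.

Definition closed_edge (g h : G) : set (G -> R) :=
  [set edge_point g h t | t in `[0, 1]].

(* The case [g = h] accounts for the vertices. *)
Record cayley := CayleyPoint {
  bary :> G -> R ;
  baryP : exists g h, (g = h \/ cayley_adj g h) /\ closed_edge g h bary }.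

HB.instance Definition _ := gen_eqMixin cayley.
HB.instance Definition _ := gen_choiceMixin cayley.

Lemma vertex_subproof (g : G) : exists k h : G,
  (k = h \/ cayley_adj k h) /\ closed_edge k h (edge_point g g 0).
Proof.
exists g, g; split; first by left.
by exists 0 => //=; rewrite in_itv /= lexx ler01.
Qed.

Definition vertex (g : G) : cayley := CayleyPoint (vertex_subproof g).

(* [chain_length x y l]: [l] is the length of a concatenation of segments from
   [x] to [y], each of them contained in a closed edge.  On the edge joining [g]
   to [h], the coordinate at [g] is an isometry onto [0, 1]. *)
Inductive chain_length : cayley -> cayley -> R -> Prop :=
| chain_nil x : chain_length x x 0
| chain_cons (x y z : cayley) (g h : G) (l : R) : cayley_adj g h ->
    closed_edge g h x -> closed_edge g h y ->
    chain_length y z l -> chain_length x z (`|x g - y g| + l).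

Definition cayley_dist (x y : cayley) : R := inf [set l | chain_length x y l].

Lemma cayleyP (x y : cayley) : bary x =1 bary y -> x = y.
Proof.
case: x y => [x px] [y py] /= /funext xy; subst y.
by congr CayleyPoint; exact: Prop_irrelevance.
Qed.

Lemma edge_pointC g h t : edge_point g h t = edge_point h g (1 - t).
Proof. by apply/funext => k; rewrite /edge_point subKr addrC. Qed.

Lemma closed_edgeC g h : closed_edge g h = closed_edge h g.
Proof.
suff sub g' h' : closed_edge g' h' `<=` closed_edge h' g'.
  by apply/seteqP; split; exact: sub.
move=> x [t /=]; rewrite in_itv /= => /andP[t0 t1] tx; subst x.
exists (1 - t); last by rewrite -edge_pointC.
by rewrite /= in_itv /= subr_ge0 t1 lerBlDr lerDl t0.
Qed.

Lemma cayley_adj_sym g h : cayley_adj g h -> cayley_adj h g.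
Proof. by move=> []; [right|left]. Qed.

Lemma segment_lip (x y : G -> R) g h k : closed_edge g h x -> closed_edge g h y ->
  `|x k - y k| <= `|x g - y g|.
Proof.
have E (a b c d : R) : ((1 - a) * c + a * d) - ((1 - b) * c + b * d)
    = (b - a) * (c - d).
  by ring.
move=> [s _ <-] [t _ <-]; rewrite /edge_point !E !normrM.
apply: ler_wpM2l => //; have [->|gh] := eqVneq g h; first by rewrite eqxx !subrr.
by rewrite eqxx; case: (k == g); case: (k == h) => /=;
  rewrite ?subrr ?subr0 ?sub0r ?normrN ?normr0 ?normr1.
Qed.

Lemma segment_sym (x y : G -> R) g h : closed_edge g h x -> closed_edge g h y ->
  `|x g - y g| = `|y h - x h|.
Proof.
move=> xe ye; rewrite [RHS]distrC; apply/le_anti/andP; split.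
  by apply: (@segment_lip _ _ h g); rewrite closed_edgeC.
exact: segment_lip xe ye.
Qed.

Lemma chain_ge0 x y l : chain_length x y l -> 0 <= l.
Proof. by elim=> // *; rewrite addr_ge0. Qed.

Lemma chain_lip x y l : chain_length x y l -> forall k, `|x k - y k| <= l.
Proof.
elim=> [{}x k|{}x {}y z g h {}l _ xe ye _ IH k]; first by rewrite subrr normr0.
rewrite -(subrK (y k) (x k)) -addrA (le_trans (ler_normD _ _)) // lerD //.
exact: segment_lip xe ye.
Qed.

Lemma chain_trans x y z l m : chain_length x y l -> chain_length y z m ->
  chain_length x z (l + m).
Proof.
elim=> [{}x|{}x {}y z' g h {}l gh xe ye _ IH] zm; first by rewrite add0r.
by rewrite -addrA; apply: chain_cons gh xe ye _; exact: IH.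
Qed.

Lemma chain_sym x y l : chain_length x y l -> chain_length y x l.
Proof.
elim=> [{}x|{}x {}y z g h {}l gh xe ye _ IH]; first exact: chain_nil.
rewrite addrC; apply: chain_trans IH _.
rewrite (segment_sym xe ye) -[X in chain_length _ _ X]addr0.
by apply: chain_cons (cayley_adj_sym gh) _ _ (chain_nil _);
  rewrite closed_edgeC.
Qed.

Lemma vertex_edgel g h : closed_edge g h (vertex g).
Proof.
exists 0; first by rewrite /= in_itv /= lexx ler01.
by apply/funext => k; rewrite /= /edge_point !mul0r !addr0.
Qed.

Lemma vertex_edger g h : closed_edge g h (vertex h).
Proof. by rewrite closed_edgeC; exact: vertex_edgel. Qed.

Lemma chain_vertices k g : exists l, chain_length (vertex g) (vertex (g * k)%g) l.
Proof.
pose M := [set k | forall g, exists l,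
  chain_length (vertex g) (vertex (g * k)%g) l].
suff : [set: G] `<=` M by move=> /(_ k I) /(_ g).
rewrite -(gens_spec S) => x; apply; split.
  apply/is_subgroupP; split=> [h|a c Ma Mc h].
    by exists 0; rewrite mulg1; exact: chain_nil.
  have [l hl] := Ma h; have [m hm] := Mc (h * (a / c))%g; exists (l + m).
  apply: chain_trans hl _; rewrite mulgA mulgVK in hm.
  by apply: chain_sym; rewrite mulgA.
move=> s Ss h; eexists.
apply: (@chain_cons _ (vertex (h * s)%g) _ h (h * s)%g); last exact: chain_nil.
- by left; rewrite mulKg.
- exact: vertex_edgel.
- exact: vertex_edger.
Qed.

Lemma chain_to_vertex (x : cayley) : exists g l, chain_length x (vertex g) l.
Proof.
have [g [h [[<-|gh] xe]]] := baryP x; exists g; last first.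
  by eexists; exact: chain_cons gh xe (vertex_edgel g h) (chain_nil _).
exists 0; suff -> : x = vertex g by exact: chain_nil.
apply: cayleyP => k; case: xe => t _ <-.
by rewrite /= /edge_point -!mulrDl subrK subr0 addr0.
Qed.

Lemma chain_exists x y : exists l, chain_length x y l.
Proof.
have [g [l xg]] := chain_to_vertex x; have [h [m yh]] := chain_to_vertex y.
have [k] := chain_vertices (g^-1 * h)%g g; rewrite mulVKg => gh.
by exists (l + (k + m)); apply: chain_trans xg (chain_trans gh (chain_sym yh)).
Qed.

Lemma cayley_dist_le x y l : chain_length x y l -> cayley_dist x y <= l.
Proof. by move=> xy; apply: ge_inf => //; exists 0 => m; exact: chain_ge0. Qed.

Lemma cayley_dist_ge x y m :
  (forall l, chain_length x y l -> m <= l) -> m <= cayley_dist x y.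
Proof.
by move=> xy; apply: lb_le_inf; [exact: chain_exists|move=> l; exact: xy].
Qed.

Lemma cayley_distxx x : cayley_dist x x = 0.
Proof.
apply/eqP; rewrite eq_le cayley_dist_le; last exact: chain_nil.
by apply: cayley_dist_ge => l; exact: chain_ge0.
Qed.

Lemma cayley_dist_eq0 x y : cayley_dist x y = 0 -> x = y.
Proof.
move=> xy; apply: cayleyP => k; apply/eqP; rewrite -subr_eq0 -normr_le0 -xy.
by apply: cayley_dist_ge => l /chain_lip.
Qed.

Lemma cayley_dist_sym x y : cayley_dist x y = cayley_dist y x.
Proof.
by congr inf; apply/seteqP; split=> l; exact: chain_sym.
Qed.

Lemma cayley_dist_triangle y x z :
  cayley_dist x z <= cayley_dist x y + cayley_dist y z.
Proof.
rewrite -lerBlDr; apply: cayley_dist_ge => l xy.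
rewrite lerBlDr addrC -lerBlDr; apply: cayley_dist_ge => m yz.
by rewrite lerBlDr addrC; apply: cayley_dist_le; exact: chain_trans xy yz.
Qed.

HB.instance Definition _ := isMetric.Build R cayley
  cayley_distxx cayley_dist_eq0 cayley_dist_sym cayley_dist_triangle.

End CayleyGraph.

Section Quasiconvexity.
Context (R : realType).

(* Only the restriction of [f] to [A] matters. *)
Definition quasi_isometric_embedding (X Y : metricType R) (lambda c : R)
    (A : set X) (f : X -> Y) :=
  forall x y, A x -> A y ->
    lambda^-1 * mdist (f x) (f y) - c <= mdist x y
      <= lambda * mdist (f x) (f y) + c.

Definition quasigeodesic (Y : metricType R) (lambda c : R) (i : interval R)
    (f : R^o -> Y) :=
  @quasi_isometric_embedding R^o Y lambda c [set` i] f.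

Definition strongly_quasiconvex (G : groupType) (S : fin_gen_set G)
    (H : set G) :=
  forall lambda c : R, 1 <= lambda -> 0 <= c ->
  exists2 m : R, 0 <= m &
    forall (a b : R) (f : R^o -> cayley R S), a <= b ->
      quasigeodesic lambda c `[a, b] f ->
      [set vertex R S h | h in H] (f a) ->
      [set vertex R S h | h in H] (f b) ->
      forall t, t \in `[a, b] -> exists2 h, H h & mdist (f t) (vertex R S h) <= m.

End Quasiconvexity.

(* Main.v *)
Require Import Defs.
From mathcomp Require Import all_boot all_order all_algebra.
From mathcomp Require Import all_classical all_reals all_analysis.
From mathcomp Require Import zify lra.

(** Call an element of the group [D]-thin if, in its reduced expressions, every
    subword all of whose letters commute with a common vertex [v] and differ
    from it has length at most [D].  Long detours in the direction of [v] are
    uniform quasigeodesics, so a strongly quasiconvex subgroup either contains a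
    power of a conjugate of some generator, or is "good": quasiconvex for the
    word metric, with uniformly thin elements.  In the first case further
    detours along the connected graph produce a power of every conjugate of
    every generator, then put every element uniformly close to the subgroup,
    which therefore has finite index; a product with a finite index factor is
    clopen.

    A good subgroup [H] is separable because the convex hull of [H] and [H g]
    is [H]-cofinite, and the partial action of the generators on its quotient
    extends to an action on the same finite set by closing up segments into
    cycles.

    For products [H1 H2 ... Hn] of good subgroups one argues by induction on
    [n].  Deep finite index subgroups of [H1] and [H2] containing their
    intersection generate a good subgroup [K]: in products of long elements
    with bounded cancellation, thinness makes local reducedness global.  If [g]
    lies outside [H1 H2 ... Hn], it also lies outside [H1 K H2 H3 ... Hn] for
    suitable [K], since otherwise a side of a polygon would meet a long thin
    side, which allows one to shorten the expression of [g].  The larger set is a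
    finite union of translates of products of [n - 1] good subgroups. *)

(** Shortening [g] at the crossing is the delicate point, and it dictates the induction. Let [M] be
    the finite index subgroup such that [K] is generated by its intersections with [H1] and [H2].
    When a side in [Hi] crosses the long thin side, the crossing only shows that [x^-1 * y0] lies in
    [H2 ... Hi] for some [x] in [M] and some element [y0] of bounded length. The product [H2 ... Hi]
    has fewer than [n] factors, hence is separable by induction, so [M] can be chosen beforehand to
    force [y0] itself into [H2 ... Hi]; this puts [g] back into [H1 ... Hn]. The bound on [y0] must
    therefore be fixed before [M], from [g], the length of the product and the goodness constant
    alone.

    This is possible because cancellation is controlled independently of [M]. In a factorization of
    least total length, a long cancellation between neighbours would repeat a pair of errors from a
    fixed ball, which exhibits an element of [H1] and [H2] that can be shifted across to shorten
    both. Choosing [M] deep then makes the inner factors long compared with a cancellation bound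
    that is already known. *)

Set Implicit Arguments.
Unset Strict Implicit.
Unset Printing Implicit Defensive.

Local Open Scope classical_set_scope.
Local Open Scope quotient_scope.
Local Open Scope group_scope.

Local Notation "x * y" := (@monoid.mul (monoid_Group__to__monoid_Magma _) x y) : group_scope.
Local Notation "x ^-1" := (@monoid.inv (monoid_Group__to__monoid_BaseGroup _) x) : group_scope.
Local Notation "1" := (@monoid.one (monoid_Group__to__monoid_BaseUMagma _)) : group_scope.

(** * Normal forms *)

(* The library lemmas on groups, restated so that rewriting with them always
   yields the same instance path; [lia] identifies atoms syntactically. *)
Section GroupLemmas.
Context (G : groupType).
Implicit Types x y z : G.

Lemma gmulA x y z : x * (y * z) = x * y * z. Proof. exact: mulgA. Qed.
Lemma gmul1g x : 1 * x = x. Proof. exact: mul1g. Qed.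
Lemma gmulg1 x : x * 1 = x. Proof. exact: mulg1. Qed.
Lemma gmulVg x : x^-1 * x = 1. Proof. exact: mulVg. Qed.
Lemma gmulgV x : x * x^-1 = 1. Proof. exact: mulgV. Qed.
Lemma gmulKg x y : x^-1 * (x * y) = y. Proof. exact: mulKg. Qed.
Lemma gmulVKg x y : x * (x^-1 * y) = y. Proof. exact: mulVKg. Qed.
Lemma gmulgK x y : y * x * x^-1 = y. Proof. exact: mulgK. Qed.
Lemma gmulgVK x y : y * x^-1 * x = y. Proof. exact: mulgVK. Qed.
Lemma ginvK x : x^-1^-1 = x. Proof. exact: invgK. Qed.
Lemma ginvM x y : (x * y)^-1 = y^-1 * x^-1. Proof. exact: invgM. Qed.
Lemma ginv1 : 1^-1 = 1 :> G. Proof. exact: invg1. Qed.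
Lemma gmulI x y z : x * y = x * z -> y = z. Proof. exact: mulgI. Qed.

Definition gcomm x y := x * y = y * x.

Lemma gcommV x y : gcomm x y -> gcomm x y^-1.
Proof. exact: commuteV. Qed.

Lemma gcommM x y z : gcomm x y -> gcomm x z -> gcomm x (y * z).
Proof. exact: commuteM. Qed.

End GroupLemmas.

Record sgraph := SGraph {
  vert : finType ; edge : rel vert ;
  e_sym : symmetric edge ; e_irrefl : irreflexive edge }.

Arguments edge : clear implicits.
Arguments e_sym {s}.
Arguments e_irrefl {s}.

Section Words.
Context (Gr : sgraph).
Local Notation V := (vert Gr).
Local Notation e := (edge Gr).
Implicit Types (a b c : V * bool) (u v w : word V).

Definition neg c : V * bool := (c.1, ~~ c.2).

Lemma negK : involutive neg.
Proof. by case=> x b; rewrite /neg /= negbK. Qed.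

Lemma neg_neq c : (neg c == c) = false.
Proof. by case: c => x [] /=; apply/eqP => -[]. Qed.

Lemma e_neq x y : e x y -> x != y.
Proof. by move=> h; apply/eqP => E; rewrite E e_irrefl in h. Qed.

(* [cut c w] removes from [w] an occurrence of [c] that can be moved to the
   front by swapping adjacent commuting letters. *)
Fixpoint cut c w : option (word V) :=
  match w with
  | [::] => None
  | d :: w' => if d == c then Some w'
               else if e d.1 c.1 then omap (cons d) (cut c w') else None
  end.

(** Equality in the partially commutative monoid: letters may be shuffled but never cancelled, so
    length and multiset of letters are invariants. *)
Inductive teq : word V -> word V -> Prop :=
| teq_refl w : teq w w
| teq_cons a u v : teq u v -> teq (a :: u) (a :: v)
| teq_swap a b w : e a.1 b.1 -> teq [:: a, b & w] [:: b, a & w]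
| teq_trans u v w : teq u v -> teq v w -> teq u w.

Lemma teq_sym u v : teq u v -> teq v u.
Proof.
elim=> {u v} [w|a u v _ IH|a b w ab|u v w _ IH1 _ IH2].
- exact: teq_refl.
- exact: teq_cons.
- by apply: teq_swap; rewrite e_sym.
- exact: teq_trans IH2 IH1.
Qed.

Lemma teq_perm u v : teq u v -> perm_eq u v.
Proof.
elim=> {u v} [w|a u v _ IH|a b w ab|u v w _ IH1 _ IH2] //.
- by rewrite perm_cons.
- rewrite -(cat1s a) -(cat1s b) -[in X in perm_eq _ X](cat1s b).
  by rewrite -[in X in perm_eq _ X](cat1s a) perm_catCA.
- exact: perm_trans IH1 IH2.
Qed.

Lemma teq_size u v : teq u v -> size u = size v.
Proof. by move=> /teq_perm/perm_size. Qed.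

Definition oteq (x y : option (word V)) : Prop :=
  match x, y with
  | Some u, Some v => teq u v
  | None, None => True
  | _, _ => False
  end.

(** Extraction of a letter is insensitive to shuffles, so [red] and [push] make sense on words up to
    [teq]. *)
Lemma cut_teq c u v : teq u v -> oteq (cut c u) (cut c v).
Proof.
elim=> {u v} [w|a u v uv IH|a b w ab|u v w _ IH1 _ IH2] /=.
- by case: (cut c w) => //= x; exact: teq_refl.
- case: eqP => // _; case: (e a.1 c.1) => //.
  case: (cut c u) (cut c v) IH => [x|] [y|] //=; exact: teq_cons.
- have [ac|ac] := eqVneq a c.
    subst c; have [ba|ba] := eqVneq b a; first by rewrite ba e_irrefl in ab.
    by rewrite e_sym ab /=; exact: teq_refl.
  have [bc|bc] := eqVneq b c; first by subst c; rewrite ab /=; exact: teq_refl.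
  case: (e a.1 c.1); case: (e b.1 c.1) => //=.
  by case: (cut c w) => //= x; exact: teq_swap.
- case: (cut c u) (cut c v) (cut c w) IH1 IH2 => [x|] [y|] [z|] //=.
  exact: teq_trans.
Qed.

Lemma cutK c w w' : cut c w = Some w' -> teq w (c :: w').
Proof.
elim: w w' => //= d w IH w'; case: eqP => [-> [->]|_]; first exact: teq_refl.
case ed: (e d.1 c.1) => //; case E: (cut c w) => [x|] //= -[<-].
apply: teq_trans (teq_cons d (IH _ E)) _; exact: teq_swap.
Qed.

Lemma cut_cons c w : cut c (c :: w) = Some w.
Proof. by rewrite /= eqxx. Qed.

Definition push a w := if cut (neg a) w is Some w' then w' else a :: w.

Fixpoint red w : bool :=
  if w is a :: w' then ~~ cut (neg a) w' && red w' else true.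

Lemma oteq_bool x y : oteq x y -> (x : bool) = y.
Proof. by case: x y => [x|] [y|]. Qed.

Lemma red_teq u v : teq u v -> red u = red v.
Proof.
elim=> {u v} [w|a u v uv IH|a b w ab|u v w _ IH1 _ IH2] //=.
- by rewrite IH (oteq_bool (cut_teq _ uv)).
- have := e_neq ab => neq.
  have h1 : (b == neg a) = false.
    by apply/eqP => E; move: neq; rewrite E eqxx.
  have h2 : (a == neg b) = false.
    by apply/eqP => E; move: neq; rewrite E eqxx.
  rewrite h1 h2 /= ab [e b.1 a.1]e_sym ab.
  by case: (cut (neg a) w); case: (cut (neg b) w); rewrite //= ?andbF.
- by rewrite IH1.
Qed.

Lemma push_teq a u v : teq u v -> teq (push a u) (push a v).
Proof.
move=> uv; rewrite /push; move: (cut_teq (neg a) uv).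
case: (cut _ u) (cut _ v) => [x|] [y|] //= _; exact: teq_cons.
Qed.

Lemma push_red a w : red w -> red (push a w).
Proof.
rewrite /push; case E: (cut _ w) => [x|] /=; last by rewrite E => ->.
by rewrite (red_teq (cutK E)) /= => /andP[].
Qed.

Lemma pushK a w : red w -> teq (push (neg a) (push a w)) w.
Proof.
rewrite /push negK; case E: (cut (neg a) w) => [x|] rw.
  move: rw; rewrite (red_teq (cutK E)) /= negK => /andP[].
  by case: (cut a x) => // _ _; apply: teq_sym; exact: cutK.
by rewrite cut_cons; exact: teq_refl.
Qed.

Lemma pushC a b w : e a.1 b.1 -> teq (push a (push b w)) (push b (push a w)).
Proof.
move=> ab; have ba : e b.1 a.1 by rewrite e_sym.
have neq := e_neq ab.
have h1 : (b == neg a) = false.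
  by apply/eqP => E; move: neq; rewrite E eqxx.
have h2 : (a == neg b) = false.
  by apply/eqP => E; move: neq; rewrite E eqxx.
have h3 : (neg b == neg a) = false.
  by apply/eqP => E; move: neq; rewrite -[b]negK E negK eqxx.
have h4 : (neg a == neg b) = false by rewrite eq_sym.
rewrite /push; case Eb: (cut (neg b) w) => [wb|]; case Ea: (cut (neg a) w) => [wa|].
- have := cut_teq (neg a) (cutK Eb); rewrite Ea /= h3 /= ba.
  case E1: (cut (neg a) wb) => [x|] //= t1.
  have := cut_teq (neg b) t1; rewrite cut_cons.
  case E2: (cut (neg b) wa) => [y|] //= t2; exact: teq_sym.
- have := cut_teq (neg a) (cutK Eb); rewrite Ea /= h3 /= ba.
  case E1: (cut (neg a) wb) => [x|] //= _.
  by rewrite h2 ab Eb /=; exact: teq_refl.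
- have := cut_teq (neg b) (cutK Ea); rewrite Eb /= h4 /= ab.
  case E1: (cut (neg b) wa) => [x|] //= _.
  by rewrite h1 ba Ea /=; exact: teq_refl.
- by rewrite /= h1 h2 ab ba Ea Eb /=; exact: teq_swap.
Qed.

Definition pushs u w := foldr push w u.

Lemma pushs_red u w : red w -> red (pushs u w).
Proof. by move=> rw; elim: u => //= a u IH; exact: push_red. Qed.

Lemma pushs_teq u w w' : teq w w' -> teq (pushs u w) (pushs u w').
Proof. by move=> ww; elim: u => //= a u IH; exact: push_teq. Qed.

Local Notation pe := (pres_eq (raag_rel e)).

(** Van der Waerden's trick: words act on reduced words by [push], and up to shuffles the action
    respects the defining relations. Evaluated at the empty word, it gives uniqueness of normal
    forms. *)
Lemma pushs_pres u v : pe u v -> forall w w', red w -> teq w w' ->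
  teq (pushs u w) (pushs v w').
Proof.
elim=> {u v} [u|u v _ IH|u v w _ IH1 _ IH2|u u' v v' _ IH1 _ IH2|x b|u v].
- by move=> w w' _ ww; exact: pushs_teq.
- move=> w w' rw ww; apply: teq_sym; apply: IH; last exact: teq_sym.
  by rewrite -(red_teq ww).
- move=> z z' rz zz; apply: teq_trans (IH2 _ _ rz zz).
  apply: IH1 => //; exact: teq_refl.
- move=> w w' rw ww; rewrite /pushs !foldr_cat; apply: IH1; last exact: IH2.
  exact: pushs_red.
- move=> w w' rw ww /=; apply: teq_trans ww.
  by have := pushK (x, ~~ b) rw; rewrite /neg /= negbK.
- case=> {}u {}v uv w w' rw ww /=.
  apply: teq_trans (pushC _ _) _ => //; apply: push_teq; exact: push_teq.
Qed.

Definition nf u := pushs u [::].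

Lemma nf_red u : red (nf u). Proof. exact: pushs_red. Qed.

Lemma nf_pres u v : pe u v -> teq (nf u) (nf v).
Proof. by move=> uv; apply: pushs_pres => //; exact: teq_refl. Qed.

Lemma red_nf w : red w -> nf w = w.
Proof.
elim: w => //= a w IH /andP[h /IH]; rewrite /nf /= => ->.
by rewrite /push; case: (cut _ _) h.
Qed.

Lemma size_push a w : size (push a w) <= (size w).+1.
Proof.
by rewrite /push; case E: (cut _ w) => [x|] //; rewrite (teq_size (cutK E)) /=; lia.
Qed.

Lemma size_nf w : size (nf w) <= size w.
Proof.
elim: w => //= a w IH; apply: leq_trans (size_push _ _) _; exact: IH.
Qed.

Lemma size_nf_eq w : size (nf w) = size w -> nf w = w.
Proof.
elim: w => //= a w IH; rewrite /nf /=; have := size_nf w; rewrite -/(nf w).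
rewrite {1 2}/push; case E: (cut _ _) => [x|] /=.
  by have := teq_size (cutK E); rewrite /= => ->; lia.
by move=> _ [/IH] ->.
Qed.

End Words.

(** * Word length, initial letters and support of group elements *)

Section RaagLength.
Context (Gr : sgraph).
Local Notation V := (vert Gr).
Local Notation e := (edge Gr).
Local Notation A := (raag e).
Implicit Types (a b c d : V * bool) (g h x y z : A) (u v w : word V).

Definition ev w : A := \pi_(presented (raag_rel e)) w.

Lemma evM u v : ev u * ev v = ev (u ++ v).
Proof. exact: Defs.pi_mul. Qed.

Lemma ev_nil : ev [::] = 1. Proof. by []. Qed.

Lemma evV u : (ev u)^-1 = ev (winv u).
Proof. exact: Defs.pi_inv. Qed.

Lemma ev_eq u v : pres_eq (raag_rel e) u v <-> ev u = ev v.
Proof. by split=> [uv|/eqP/presP]; first apply/eqP/presP. Qed.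

Definition letter c : A := ev [:: c].

Lemma ev_cons c w : ev (c :: w) = letter c * ev w.
Proof. by rewrite evM. Qed.

Lemma letterN c : letter (neg c) = (letter c)^-1.
Proof. by rewrite evV. Qed.

Lemma letterC a b : e a.1 b.1 -> gcomm (letter a) (letter b).
Proof.
have main (x y : V) : e x y -> gcomm (letter (x, true)) (letter (y, true)).
  move=> xy; rewrite /gcomm !evM; apply/ev_eq; apply: pres_rel; exact: raag_comm.
have sgn x c : gcomm x (letter (c.1, true)) -> gcomm x (letter c).
  case: c => v [] //= xc; rewrite -[(v, false)]/(neg (v, true)) letterN.
  exact: gcommV.
move=> ab; apply: (sgn _ b); apply: commute_sym; apply: (sgn _ a).
by apply: commute_sym; exact: main.
Qed.

Lemma ev_teq u v : teq u v -> ev u = ev v.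
Proof.
elim=> {u v} [w|a u v _ IH|a b w ab|u v w _ IH1 _ IH2] //.
- by rewrite !ev_cons IH.
- by rewrite !ev_cons !gmulA (letterC ab).
- by rewrite IH1.
Qed.

Lemma ev_push a w : ev (push a w) = letter a * ev w.
Proof.
rewrite /push; case E: (cut _ _) => [x|]; last by rewrite ev_cons.
by rewrite (ev_teq (cutK E)) ev_cons letterN gmulVKg.
Qed.

Lemma ev_nf w : ev (nf w) = ev w.
Proof. by elim: w => // a w IH; rewrite ev_cons -IH -ev_push. Qed.

Definition rep g : word V := nf (repr (g : presented (raag_rel e))).

Lemma ev_rep g : ev (rep g) = g.
Proof. by rewrite ev_nf; exact: pres_reprK. Qed.

Lemma rep_red g : red (rep g).
Proof. exact: nf_red. Qed.

Lemma rep_ev w : teq (rep (ev w)) (nf w).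
Proof. by apply: nf_pres => //; exact: pres_repr. Qed.

Definition len g := size (rep g).

Lemma len_ev w : len (ev w) = size (nf w).
Proof. exact: (teq_size (rep_ev w)). Qed.

Lemma len_ev_le w : len (ev w) <= size w.
Proof. by rewrite len_ev; exact: size_nf. Qed.

Lemma len_ev_red w : red w -> len (ev w) = size w.
Proof. by move=> rw; rewrite len_ev red_nf. Qed.

Lemma red_len w : len (ev w) = size w -> red w.
Proof. by rewrite len_ev => /size_nf_eq <-; exact: nf_red. Qed.

Lemma rep_ev_red w : red w -> teq (rep (ev w)) w.
Proof. by move=> rw; have := rep_ev w; rewrite red_nf. Qed.

Definition starts c g : bool := cut c (rep g).

Lemma rep_letter c g : teq (rep (letter c * g)) (push c (rep g)).
Proof.
rewrite -{1}(ev_rep g) -ev_cons; apply: teq_trans (rep_ev _) _.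
by rewrite /nf /= -/(nf _) red_nf; [exact: teq_refl|exact: rep_red].
Qed.

Lemma len_starts c g : starts c g -> len g = (len ((letter c)^-1 * g)).+1.
Proof.
rewrite /starts /len -letterN (teq_size (rep_letter _ _)) /push negK.
by case E: (cut _ _) => [x|] // _; rewrite (teq_size (cutK E)).
Qed.

Lemma len_nstarts c g : ~~ starts c g -> len ((letter c)^-1 * g) = (len g).+1.
Proof.
rewrite /starts /len -letterN (teq_size (rep_letter _ _)) /push negK.
by case E: (cut _ _) => [x|].
Qed.

Lemma startsE c g : starts c g = (len ((letter c)^-1 * g) < len g).
Proof.
have [/len_starts|/len_nstarts] := boolP (starts c g) => ->; first by rewrite ltnSn.
by apply/esym/negbTE; rewrite -leqNgt; lia.
Qed.

Lemma starts_mul_letter c g : starts c (letter c * g) = (len (letter c * g) == (len g).+1).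
Proof.
rewrite startsE gmulKg; have := @len_starts (neg c) g; have := @len_nstarts (neg c) g.
rewrite letterN ginvK; case: (starts _ g) => /=; last by move=> ->; rewrite // eqxx ltnSn.
by move=> _ /(_ isT) ->; rewrite ltnNge leqnSn -addn2 -[X in X == _]addn0 eqn_add2l.
Qed.

Lemma starts_both a b g : starts a g -> starts b g -> a != b ->
  e a.1 b.1 /\ starts b ((letter a)^-1 * g).
Proof.
rewrite /starts => sa sb ab; case Ea: (cut a (rep g)) sa => [x|] // _.
have := cut_teq b (cutK Ea); case: (cut _ _) sb => [y|] //.
rewrite /= (negbTE ab); case: (e a.1 b.1) => //.
case Eb: (cut b x) => [z|] //= _ _; split=> //.
rewrite (oteq_bool (cut_teq b (_ : teq _ x))) ?Eb //.
by rewrite -letterN; apply: teq_trans (rep_letter _ _) _; rewrite /push negK Ea; exact: teq_refl.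
Qed.

Lemma len1 : len 1 = 0.
Proof. by rewrite -ev_nil len_ev. Qed.

Lemma len_eq0 g : len g = 0 -> g = 1.
Proof. by rewrite /len => /size0nil E; rewrite -(ev_rep g) E. Qed.

Lemma starts_ex g : 0 < len g -> exists c, starts c g.
Proof.
rewrite /len /starts; case E: (rep g) => [|c w] // _.
by exists c; rewrite cut_cons.
Qed.

Lemma winv_size w : size (winv w) = size w.
Proof. by rewrite size_rev size_map. Qed.

Lemma lenV g : len g^-1 = len g.
Proof.
have main h : len h^-1 <= len h.
  by rewrite -{1}(ev_rep h) evV (leq_trans (len_ev_le _)) // winv_size.
by apply/eqP; rewrite eqn_leq main -{1}(ginvK g) main.
Qed.

Lemma len_mul g h : len (g * h) <= len g + len h.
Proof.
by rewrite -{1}(ev_rep g) -{1}(ev_rep h) evM (leq_trans (len_ev_le _)) // size_cat.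
Qed.

Lemma len_letter c : len (letter c) = 1%N.
Proof. by rewrite len_ev_red. Qed.

Definition supp g : seq V := [seq c.1 | c <- rep g].

Lemma supp_red w : red w -> perm_eq (supp (ev w)) [seq c.1 | c <- w].
Proof. by move=> rw; apply/perm_map/teq_perm/rep_ev_red. Qed.

Lemma supp_mul g h : len (g * h) = len g + len h ->
  supp (g * h) =i supp g ++ supp h.
Proof.
move=> E; have F : g * h = ev (rep g ++ rep h) by rewrite -evM !ev_rep.
have rw : red (rep g ++ rep h) by apply: red_len; rewrite -F size_cat E.
by apply: perm_mem; rewrite F (permPl (supp_red rw)) map_cat.
Qed.

Lemma supp1 : supp 1 = [::].
Proof. by rewrite /supp (size0nil len1). Qed.

Lemma supp_letter c : supp (letter c) =i [:: c.1].
Proof. by apply: perm_mem; exact: (@supp_red [:: c] isT). Qed.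

Lemma supp_ex g : 0 < len g -> exists s : V, s \in supp g.
Proof.
rewrite /len /supp; case E: (rep g) => [|c w] // _.
by exists c.1; rewrite /= inE eqxx.
Qed.

Lemma suppV g : supp g^-1 =i supp g.
Proof.
have main h (s : V) : s \in supp h^-1 -> s \in supp h.
  have E : len (ev (winv (rep h))) = size (winv (rep h)).
    by rewrite -evV ev_rep lenV winv_size.
  rewrite -{1}(ev_rep h) evV (perm_mem (supp_red (red_len E))).
  by rewrite /winv map_rev mem_rev -map_comp.
by move=> s; apply/idP/idP; [exact: main|rewrite -{1}(ginvK g); exact: main].
Qed.

End RaagLength.

(** * Cancellation *)

Section Cancellation.
Context (Gr : sgraph).
Local Notation V := (vert Gr).
Local Notation e := (edge Gr).
Local Notation A := (raag e).
Local Notation len := (@len Gr).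
Local Notation letter := (@letter Gr).
Local Notation supp := (@supp Gr).
Local Notation starts := (@starts Gr).
Implicit Types (a b c d : V * bool) (g h k p q r x y z : A) (s t : V).


(* [rdc g h]: no cancellation occurs in the product of [g] and [h]. *)
Definition rdc g h := len (g * h) = len g + len h.

Definition orth g h := forall s t, s \in supp g -> t \in supp h -> e s t.

Lemma orth_sym g h : orth g h -> orth h g.
Proof. by move=> gh s t sh tg; rewrite e_sym gh. Qed.

Lemma len_ind (P : A -> Prop) :
  (forall g, (forall h, len h < len g -> P h) -> P g) -> forall g, P g.
Proof.
move=> IH g; have [n] := ubnP (len g); elim: n g => // n IHn g lgn.
by apply: IH => h hg; apply: IHn; lia.
Qed.

Lemma rdc1g g : rdc 1 g. Proof. by rewrite /rdc gmul1g len1. Qed.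

Lemma rdcg1 g : rdc g 1. Proof. by rewrite /rdc gmulg1 len1 addn0. Qed.

Lemma rdcV g h : rdc g h -> rdc h^-1 g^-1.
Proof. by rewrite /rdc -ginvM !lenV addnC. Qed.

Lemma rdc3 g h k : len (g * h * k) = len g + len h + len k ->
  [/\ rdc g h, rdc h k, rdc (g * h) k & rdc g (h * k)].
Proof.
move=> E; have := len_mul g h; have := len_mul h k; have := len_mul (g * h) k.
by have := len_mul g (h * k); rewrite /rdc gmulA E; split; lia.
Qed.

Lemma rdc3l g h k : rdc g h -> rdc (g * h) k -> [/\ rdc h k & rdc g (h * k)].
Proof. by move=> E F; case: (@rdc3 g h k) => //; rewrite F E. Qed.

Lemma rdc3r g h k : rdc h k -> rdc g (h * k) -> [/\ rdc g h & rdc (g * h) k].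
Proof. by move=> E F; case: (@rdc3 g h k) => //; rewrite -gmulA F E addnA. Qed.

Lemma supp_rdc g h s : rdc g h -> (s \in supp (g * h)) = (s \in supp g) || (s \in supp h).
Proof. by move=> /supp_mul ->; rewrite mem_cat. Qed.

Lemma starts_split c g : starts c g -> exists2 g', g = letter c * g' & rdc (letter c) g'.
Proof.
move=> sc; exists ((letter c)^-1 * g); first by rewrite gmulVKg.
by rewrite /rdc gmulVKg len_letter // (len_starts sc).
Qed.

Lemma rdc_starts c g : rdc (letter c) g -> starts c (letter c * g).
Proof. by rewrite /rdc len_letter // => E; rewrite starts_mul_letter // E. Qed.

Lemma starts_mul c g h : rdc g h -> starts c g -> starts c (g * h).
Proof.
rewrite /rdc !startsE // => E; have := len_mul ((letter c)^-1 * g) h; rewrite gmulA => F G; lia.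
Qed.

Lemma starts_letter c d : starts c (letter d) -> c = d.
Proof.
rewrite /starts; have := cut_teq c (@rep_ev_red Gr [:: d] isT).
case: (cut _ _) => [x|] //=; case: eqP => //= _; by case: (e _ _).
Qed.

Lemma commute_supp c p : (forall s, s \in supp p -> e s c.1) -> gcomm p (letter c).
Proof.
elim/len_ind: p => p IH h; have [/len_eq0 ->|] := posnP (len p).
  by rewrite /gcomm gmul1g gmulg1.
case/starts_ex => d /starts_split[p' E r]; rewrite E.
have hs s : s \in supp p = (s == d.1) || (s \in supp p').
  by rewrite E supp_rdc // supp_letter // inE.
apply/esym/gcommM; apply/esym.
  by apply: letterC => //; apply: h; rewrite hs eqxx.
apply: IH; first by rewrite E r len_letter // ltnS.
by move=> s sp; apply: h; rewrite hs sp orbT.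
Qed.

Lemma commute_orth g h : orth g h -> gcomm g h.
Proof.
elim/len_ind: h => h IH gh; have [/len_eq0 ->|] := posnP (len h).
  exact: commute1.
case/starts_ex => d /starts_split[h' E r]; rewrite E.
apply: gcommM.
  by apply: commute_supp => s sg; apply: gh; rewrite // E supp_rdc // supp_letter // inE eqxx.
apply: IH; first by rewrite E r len_letter // ltnS.
by move=> s t sg th; apply: gh; rewrite // E supp_rdc // th orbT.
Qed.

Lemma rdc_swap a b g : e a.1 b.1 -> rdc (letter b) g -> rdc (letter a) (letter b * g) ->
  letter a * (letter b * g) = letter b * (letter a * g) /\ rdc (letter b) (letter a * g).
Proof.
move=> ab r1 r2; have E : letter a * (letter b * g) = letter b * (letter a * g).
  by rewrite !gmulA (letterC ab).
split=> //; have l1 := len_mul (letter a) g; have l2 := len_mul (letter b) (letter a * g).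
by move: r1 r2 l1 l2; rewrite /rdc E !len_letter //; lia.
Qed.

Lemma starts_pass c p r : rdc p r -> starts c (p * r) -> ~~ starts c p ->
  starts c r /\ (forall s, s \in supp p -> e s c.1).
Proof.
elim/len_ind: p => p IH pr sc nsc.
have [/len_eq0 E|] := posnP (len p).
  by move: sc; rewrite E gmul1g => ->; split=> // s; rewrite supp1.
case/starts_ex => d sd; have [p' E rp] := starts_split sd.
have dc : d != c by apply/eqP => F; rewrite F (negbTE nsc) in sd.
have [edc] := starts_both (starts_mul pr sd) sc dc.
rewrite {1}E -gmulA gmulKg => sc'.
have [pr' _] : [/\ rdc p' r & rdc (letter d) (p' * r)].
  by apply: rdc3l => //; rewrite -E.
have nsc' : ~~ starts c p'.
  apply/negP => /starts_split[p2 E2 r2]; case/negP: nsc.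
  have [|F r3] := rdc_swap edc r2; first by rewrite -E2.
  by rewrite E E2 F; exact: rdc_starts.
have [] := IH p' _ pr' sc' nsc'; first by rewrite E rp len_letter.
move=> sr sp; split=> // s; rewrite E supp_rdc // supp_letter // inE => /orP[/eqP ->|] //.
exact: sp.
Qed.

(** The exchange condition. Geometrically, the edge from [z] to [z * letter b] crosses the wall of
    the edge from 1 to [letter c], and crossing it is left multiplication by [letter c]. *)
Lemma starts_exchange b c z : ~~ starts c z -> starts c (z * letter b) ->
  z * letter b = letter c * z.
Proof.
move=> nz sz; have zb : rdc z (letter b).
  have F : len (z * letter b) = len ((letter b)^-1 * z^-1) by rewrite -ginvM lenV.
  rewrite /rdc len_letter //; have [sn|/(len_nstarts)] := boolP (starts b z^-1).
    case/negP: nz; rewrite -[z](gmulgK (letter b)) -letterN; apply: starts_mul sz.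
    rewrite /rdc letterN gmulgK -letterN len_letter // F.
    by rewrite -lenV (len_starts sn) addn1.
  by rewrite F lenV addn1.
have [/starts_letter -> h] := starts_pass zb sz nz; exact: commute_supp.
Qed.

(** Remove an initial letter [c] of [g]. A new common initial letter [d] would occur next to the
    initial letter [neg c] of [(letter c)^-1 * h], hence commute with [c] and be initial in both [g]
    and [h] already. *)
Lemma rdc_crit g h : (forall c, starts c g -> starts c h -> False) ->
  len (g^-1 * h) = len g + len h.
Proof.
elim/len_ind: g h => g IH h no; have [/len_eq0 ->|] := posnP (len g).
  by rewrite ginv1 gmul1g len1.
case/starts_ex => c sc; have [g' E r] := starts_split sc.
have nh : ~~ starts c h by apply/negP; exact: no sc.
rewrite E ginvM -gmulA IH; first by rewrite r (len_nstarts nh) len_letter //; lia.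
  by rewrite E r len_letter.
move=> d sd sdh.
have scn : starts (neg c) ((letter c)^-1 * h).
  by rewrite -letterN starts_mul_letter // letterN (len_nstarts nh).
have ncd : neg c != d.
  apply/eqP => F; move: sd; rewrite -F startsE // letterN ginvK.
  by rewrite r len_letter //; lia.
have [ecd] := starts_both scn sdh ncd; rewrite letterN ginvK gmulVKg => sh.
apply: (no d) => //; have [g2 E2 r2] := starts_split sd.
have [|F r3] := @rdc_swap c d g2 ecd r2; first by rewrite -E2.
by rewrite E E2 F; exact: rdc_starts.
Qed.

(** [p] is the meet of [g] and [h] in the prefix order, that is, the median of 1, [g] and [h]. *)
Lemma meet_ex g h : exists p g' h',
  [/\ g = p * g', h = p * h', rdc p g', rdc p h' & len (g'^-1 * h') = len g' + len h'].
Proof.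
elim/len_ind: g h => g IH h.
case: (pselect (exists c, starts c g /\ starts c h)) => [[c [sg sh]]|no]; last first.
  exists 1, g, h; rewrite !gmul1g; split=> //; try exact: rdc1g.
  by apply: rdc_crit => c sg sh; apply: no; exists c.
have [g1 Eg rg] := starts_split sg; have [h1 Eh rh] := starts_split sh.
have [|p [g' [h' [E1 E2 r1 r2 E]]]] := IH g1 _ h1.
  by rewrite Eg rg len_letter.
subst g1 h1; exists (letter c * p), g', h'; rewrite -!gmulA; split=> //.
  by case: (rdc3r r1 rg).
by case: (rdc3r r2 rh).
Qed.

Lemma cancel_ex g h : exists g' r h',
  [/\ g = g' * r, h = r^-1 * h', rdc g' r, rdc r^-1 h' & rdc g' h'].
Proof.
have [p [x [y [E1 E2 r1 r2 E]]]] := meet_ex g^-1 h.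
exists x^-1, p^-1, y; rewrite -ginvM -E1 !ginvK; split=> //; first exact: rdcV.
by rewrite /rdc E lenV.
Qed.

(** Levi's lemma for partially commutative words: the two factorizations have a common refinement,
    and the pieces [x2] and [y1] that appear in opposite orders commute letter by letter. *)
Lemma levi x y p r : rdc x y -> rdc p r -> x * y = p * r ->
  exists x1 x2 y1 y2, [/\ x = x1 * x2, y = y1 * y2, p = x1 * y1 & r = x2 * y2] /\
    [/\ rdc x1 x2, rdc y1 y2, rdc x1 y1, rdc x2 y2 & orth x2 y1].
Proof.
elim/len_ind: x p r => x IH p r xy pr E.
have [/len_eq0 x0|] := posnP (len x).
  exists 1, 1, p, r; rewrite -E x0 !gmul1g; split; split=> //; try exact: rdc1g.
  by move=> s t; rewrite supp1.
case/starts_ex => c sc; have [x' Ex rx] := starts_split sc.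
have x'x : len x' < len x by rewrite Ex rx len_letter.
have [x'y _] : [/\ rdc x' y & rdc (letter c) (x' * y)] by apply: rdc3l; rewrite -?Ex.
have [sp|nsp] := boolP (starts c p).
  have [p' Ep rp] := starts_split sp.
  have [p'r _] : [/\ rdc p' r & rdc (letter c) (p' * r)] by apply: rdc3l; rewrite -?Ep.
  have E' : x' * y = p' * r by apply: (@gmulI _ (letter c)); rewrite !gmulA -Ex -Ep.
  have [x1 [x2 [y1 [y2 [[F1 F2 F3 F4] [R1 R2 R3 R4 O]]]]]] := IH _ x'x p' r x'y p'r E'.
  exists (letter c * x1), x2, y1, y2; rewrite -!gmulA -F1 -F3; split; split=> //.
    by case: (@rdc3r (letter c) x1 x2); rewrite -?F1.
  by case: (@rdc3r (letter c) x1 y1); rewrite -?F3.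
have scpr : starts c (p * r) by rewrite -E; exact: starts_mul.
have [sr orthp] := starts_pass pr scpr nsp.
have [r' Er rr] := starts_split sr.
have C := commute_supp orthp.
have E' : x' * y = p * r'.
  by apply: (@gmulI _ (letter c)); rewrite !gmulA -Ex -C -gmulA -Er.
have pr' : rdc p r'.
  by move: xy rx x'y rr pr; rewrite /rdc E -E' -Ex -Er => -> -> -> -> ; lia.
have [x1 [x2 [y1 [y2 [[F1 F2 F3 F4] [R1 R2 R3 R4 O]]]]]] := IH _ x'x p r' x'y pr' E'.
have C1 : gcomm x1 (letter c).
  by apply: commute_supp => s sx; apply: orthp; rewrite F3 supp_rdc // sx.
have [rc rcy] : [/\ rdc (letter c) x2 & rdc (letter c * x2) y2].
  by apply: rdc3r => //; rewrite -F4.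
exists x1, (letter c * x2), y1, y2; rewrite Ex F1 !gmulA C1 -!gmulA -F4; split; split=> //.
- rewrite /rdc gmulA C1 -gmulA -F1 rx F1 R1 rc; lia.
- move=> s t; rewrite supp_rdc // supp_letter // inE => /orP[/eqP -> ty|]; last exact: O.
  by rewrite e_sym; apply: orthp; rewrite F3 supp_rdc // ty orbT.
Qed.

Lemma levi3 x y p u q : rdc x y -> rdc p u -> rdc (p * u) q -> x * y = p * u * q ->
  exists p1 u1 q1 p2 u2 q2,
  [/\ x = p1 * u1 * q1, y = p2 * u2 * q2, p = p1 * p2, u = u1 * u2 & q = q1 * q2] /\
  [/\ rdc p1 u1, rdc (p1 * u1) q1, rdc p2 u2, rdc (p2 * u2) q2 & 
      [/\ rdc p1 p2, rdc u1 u2, rdc q1 q2 &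
          [/\ orth u1 p2, orth q1 p2 & orth q1 u2]]].
Proof.
move=> xy pu puq E.
have [x1 [q1 [y1 [q2 [[E1 E2 E3 E4] [R1 R2 R3 R4 O]]]]]] := levi xy puq E.
have [p1 [u1 [p2 [u2 [[F1 F2 F3 F4] [S1 S2 S3 S4 P]]]]]] := levi R3 pu (esym E3).
exists p1, u1, q1, p2, u2, q2; rewrite -F1 -F2; split; split=> //; split=> //; split=> //.
  by move=> s t sq tp; apply: O; rewrite // F2 supp_rdc // tp.
by move=> s t sq tp; apply: O; rewrite // F2 supp_rdc // tp orbT.
Qed.

End Cancellation.

(** * The profinite topology *)

Section FiniteIndex.
Context (G : groupType).
Implicit Types (M N X : set G) (x y g : G).

Definition separated_by N X g := forall x, N (g^-1 * x) -> ~ X x.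

Lemma subg1 M : is_subgroup M -> M 1.
Proof. by case/is_subgroupP. Qed.

Lemma subgV M x : is_subgroup M -> M x -> M x^-1.
Proof. exact: subgroupV. Qed.

Lemma subgM M x y : is_subgroup M -> M x -> M y -> M (x * y).
Proof. exact: subgroupM. Qed.

Lemma mk_subgroup M : M 1 -> (forall x y, M x -> M y -> M (x * y)) ->
  (forall x, M x -> M x^-1) -> is_subgroup M.
Proof.
by move=> M1 MM MV; apply/is_subgroupP; split=> // x y Mx My; apply: MM => //; exact: MV.
Qed.

Lemma finite_indexP M : is_subgroup M ->
  finite_index M <-> exists l : seq G, forall g, exists2 f, f \in l & M (f^-1 * g).
Proof.
move=> sM; split=> [/finite_seqP[s Es]|[l hl]].
  exists [seq xget 1 C | C <- s] => g.
  have : [set left_coset g0 M | g0 in [set: G]] (left_coset g M) by exists g.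
  rewrite Es => gs; exists (xget 1 (left_coset g M)).
    by apply/mapP; exists (left_coset g M).
  case: xgetP => [y _ /cosetE Mgy|/(_ g)]; last by case; exact: coset_id.
  by rewrite -[g]ginvK -ginvM; apply: subgV.
apply: (@sub_finite_set _ _ [set left_coset f M | f in [set` l]]); last first.
  by apply: finite_image; exact: finite_seq.
move=> _ [g _ <-]; have [f fl Mfg] := hl g; exists f => //.
by apply/esym/coset_eq => //; apply/cosetE.
Qed.

Definition core M := [set x | forall g, M (g^-1 * x * g)].

Lemma core_subgroup M : is_subgroup M -> is_subgroup (core M).
Proof.
move=> sM; apply: mk_subgroup => [g|x y Mx My g|x Mx g].
- by rewrite gmulg1 gmulVg; exact: subg1.
- have -> : g^-1 * (x * y) * g = (g^-1 * x * g) * (g^-1 * y * g).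
    by rewrite !gmulA gmulgK.
  exact: subgM.
- have -> : g^-1 * x^-1 * g = (g^-1 * x * g)^-1 by rewrite !ginvM ginvK !gmulA.
  exact: subgV.
Qed.

Lemma core_sub M x : core M x -> M x.
Proof. by move/(_ 1); rewrite ginv1 gmul1g gmulg1. Qed.

Lemma core_conj M x g : core M x -> core M (g^-1 * x * g).
Proof. by move=> Mx h; have := Mx (g * h); rewrite ginvM !gmulA. Qed.

(** A conjugate of [M] depends only on the coset of the conjugating element, so the core is a finite
    intersection of conjugates. *)
Lemma core_finite M : is_subgroup M -> finite_index M -> finite_index (core M).
Proof.
move=> sM fM; have [l hl] := (finite_indexP sM).1 fM.
pose Mf f := [set x | M (f^-1 * x * f)].
have sMf f : is_subgroup (Mf f).
  apply: mk_subgroup => [|x y Mx My|x Mx]; rewrite /Mf /=.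
  - by rewrite gmulg1 gmulVg; exact: subg1.
  - have -> : f^-1 * (x * y) * f = (f^-1 * x * f) * (f^-1 * y * f).
      by rewrite !gmulA gmulgK.
    exact: subgM.
  - have -> : f^-1 * x^-1 * f = (f^-1 * x * f)^-1 by rewrite !ginvM ginvK !gmulA.
    exact: subgV.
have fMf f : finite_index (Mf f).
  apply/finite_indexP => //; exists [seq f * k * f^-1 | k <- l] => g.
  have [k kl Mk] := hl (f^-1 * g * f); exists (f * k * f^-1).
    by apply/mapP; exists k.
  by rewrite /Mf /= !ginvM ginvK !gmulA gmulVg gmul1g -!gmulA; rewrite !gmulA in Mk *.
have -> : core M = [set x | forall f, f \in l -> Mf f x].
  apply/seteqP; split=> x /= hx; first by move=> f _; exact: hx.
  move=> g; have [f fl Mfg] := hl g.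
  have -> : g^-1 * x * g = (f^-1 * g)^-1 * (f^-1 * x * f) * (f^-1 * g).
    by rewrite ginvM ginvK !gmulA gmulgK gmulgK.
  apply: subgM => //; apply: subgM => //; [exact: subgV|exact: hx].
elim: l {hl} => [|f l IH].
  have -> : [set x | forall f, f \in [::] -> Mf f x] = [set: G] by apply/seteqP; split.
  exact: finite_indexT.
have -> : [set x | forall k, k \in f :: l -> Mf k x] =
    Mf f `&` [set x | forall k, k \in l -> Mf k x].
  apply/seteqP; split=> x /= => [hx|[h1 h2] k].
    by split=> [|k kl]; apply: hx; rewrite inE ?eqxx // kl orbT.
  by rewrite inE => /orP[/eqP ->|/h2].
exact: finite_indexI.
Qed.

Definition normal_finite N :=
  [/\ is_subgroup N, finite_index N & forall x g, N x -> N (g^-1 * x * g)].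

(** Passing to the core makes the separating subgroup normal, which later allows its elements to be
    moved across the factors of a product. *)
Lemma separableP X : separable X <->
  forall g, ~ X g -> exists2 N, normal_finite N & separated_by N X g.
Proof.
split=> [cX g nX|h].
  have [D' sD E] : open (~` X : set (profinite G)) by exact: closed_openC.
  have : (~` X) g by [].
  rewrite -E => -[[a M] /[dup] Di /sD[/= sM fM] gM].
  exists (core M).
    by split; [exact: core_subgroup|exact: core_finite|move=> *; exact: core_conj].
  move=> x /core_sub Mx.
  suff : (~` X) x by [].
  rewrite -E; exists (a, M) => //=; apply/cosetE.
  move/cosetE: gM => gM; have -> : a^-1 * x = (a^-1 * g) * (g^-1 * x) by rewrite -gmulA gmulVKg.
  exact: subgM.
rewrite /separable -openC.
exists [set i : profinite G * set (profinite G) | [/\ is_subgroup i.2, finite_index i.2 &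
    left_coset i.1 i.2 `<=` ~` X]].
  by move=> i [].
apply/seteqP; split=> [x [i [_ _ sub] /sub]|g /h[N [sN fN _] sep]] //.
exists (g, N); last by apply: coset_id.
by split=> //= x /cosetE; exact: sep.
Qed.

End FiniteIndex.

(** * Thin elements *)

Section Pigeonhole.

Lemma pigeonhole (T : eqType) (f : nat -> T) (l : seq T) :
  (forall i, i <= size l -> f i \in l) -> exists i j, [/\ i < j, j <= size l & f i = f j].
Proof.
move=> fl; case: (pselect (exists i j, [/\ i < j, j <= size l & f i = f j])) => // no.
have : uniq [seq f i | i <- iota 0 (size l).+1].
  rewrite map_inj_in_uniq ?iota_uniq // => i j; rewrite !mem_iota !add0n /= => il jl E.
  case: (ltngtP i j) => // ij; case: no; first by exists i, j.
  by exists j, i.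
move/(@uniq_leq_size _ _ l); rewrite size_map size_iota ltnn => F.
suff /F : {subset [seq f i | i <- iota 0 (size l).+1] <= l} by [].
by move=> x /mapP[i]; rewrite mem_iota add0n ltnS => /andP[_ il] ->; exact: fl.
Qed.

End Pigeonhole.

Section Thin.
Context (Gr : sgraph).
Local Notation V := (vert Gr).
Local Notation e := (edge Gr).
Local Notation A := (raag e).
Local Notation len := (@len Gr).
Local Notation letter := (@letter Gr).
Local Notation supp := (@supp Gr).
Local Notation starts := (@starts Gr).
Local Notation rdc := (@rdc Gr).
Local Notation orth := (@orth Gr).
Implicit Types (a b c d : V * bool) (g h k p q r u x y z : A) (s t : V).


Fixpoint word_ball n : seq A :=
  if n is m.+1 then
    word_ball m ++ [seq letter c * g | c <- enum [set: V * bool]%SET, g <- word_ball m]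
  else [:: 1].

Lemma word_ball_mem n g : len g <= n -> g \in word_ball n.
Proof.
elim: n g => [|n IH] g lg.
  by rewrite (@len_eq0 Gr g) ?inE //; apply/eqP; rewrite -leqn0.
have [/len_eq0 ->|] := posnP (len g); first by rewrite mem_cat IH // len1.
case/starts_ex => c /(starts_split)[g' E r].
rewrite mem_cat; apply/orP; right; apply/allpairsP; exists (c, g'); split=> //=.
  by rewrite mem_enum inE.
by apply: IH; move: lg; rewrite E r len_letter.
Qed.

Definition pref g i : A := ev (take i (rep g)).
Definition suf g i : A := ev (drop i (rep g)).

Lemma prefK g i : pref g i * suf g i = g.
Proof. by rewrite /pref /suf evM cat_take_drop ev_rep. Qed.

Lemma len_pref_suf g i : i <= len g -> len (pref g i) = i /\ len (suf g i) = len g - i.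
Proof.
move=> ig; have := len_mul (pref g i) (suf g i); rewrite prefK.
have := len_ev_le (take i (rep g)); have := len_ev_le (drop i (rep g)).
rewrite -/(pref g i) -/(suf g i) size_take_min size_drop -/(len g) (minn_idPl ig).
by move=> h1 h2 h3; split; lia.
Qed.

Lemma pref_rdc g i : rdc (pref g i) (suf g i).
Proof.
have [ig|ig] := leqP i (len g).
  by have [l1 l2] := len_pref_suf ig; rewrite /rdc prefK l1 l2 subnKC.
rewrite /suf drop_oversize; last exact: ltnW.
exact: rdcg1.
Qed.

Lemma pref_shorten g i j : i <= j -> j <= len g ->
  len (pref g i * (pref g j)^-1 * g) <= i + (len g - j).
Proof.
move=> ij jg; have [li _] := len_pref_suf (leq_trans ij jg).
have [_ lj] := len_pref_suf jg.
rewrite -{3}(prefK g j) -gmulA gmulKg; apply: leq_trans (len_mul _ _) _.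
by rewrite li lj.
Qed.

Lemma pref_factor g h i : rdc g h -> exists2 r, pref g i * r = g * h & rdc (pref g i) r.
Proof.
move=> gh; exists (suf g i * h); first by rewrite gmulA prefK.
have E := pref_rdc g i.
by case: (@rdc3l Gr (pref g i) (suf g i) h); rewrite ?prefK.
Qed.

Definition thin D g := forall p u q s, g = p * u * q -> rdc p u -> rdc (p * u) q ->
  (forall t, t \in supp u -> e s t) -> len u <= D.

Lemma thin_le D D' g : D <= D' -> thin D g -> thin D' g.
Proof. by move=> DD tg p u q s *; apply: leq_trans DD; apply: (tg p u q s). Qed.

Lemma thin_factor D x y z : rdc x y -> rdc (x * y) z -> thin D (x * y * z) -> thin D y.
Proof.
move=> xy xyz T p u q s E pu puq su.
have F : x * y * z = x * p * u * (q * z) by rewrite E !gmulA.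
have l1 := len_mul (x * p * u) (q * z); have l2 := len_mul (x * p) u.
have l3 := len_mul x p; have l4 := len_mul q z.
move: (xyz) xy puq pu; rewrite /rdc F -E => h1 h2 h3 h4.
by apply: (T (x * p) u (q * z) s); rewrite // /rdc; lia.
Qed.

Lemma thin_l D x y : rdc x y -> thin D (x * y) -> thin D x.
Proof.
move=> xy T; apply: (@thin_factor D 1 x y); rewrite ?gmul1g //; exact: rdc1g.
Qed.

Lemma thin_r D x y : rdc x y -> thin D (x * y) -> thin D y.
Proof.
move=> xy T; apply: (@thin_factor D x y 1); rewrite ?gmulg1 //; exact: rdcg1.
Qed.

Lemma thinV D g : thin D g -> thin D g^-1.
Proof.
move=> T p u q s E pu puq su; rewrite -lenV; apply: (T q^-1 u^-1 p^-1 s).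
- by rewrite -[g]ginvK E !ginvM gmulA.
- by apply: rdcV => //; case: (rdc3l pu puq).
- by rewrite -ginvM; apply: rdcV => //; case: (rdc3l pu puq).
- by move=> t; rewrite suppV //; exact: su.
Qed.

Lemma thin_orth D g h : thin D g -> orth h g -> h <> 1 -> len g <= D.
Proof.
move=> T O h1; have [/len_eq0|] := posnP (len h); first by [].
case/supp_ex => s sh; apply: (T 1 g 1 s); rewrite ?gmul1g ?gmulg1 //.
- exact: rdc1g.
- exact: rdcg1.
- by move=> t; exact: O.
Qed.

(* A cancellation between [x] and [z] would have to pass through [y]. *)
Lemma thin_glue D x y z : thin D y -> D < len y -> rdc x y -> rdc y z -> rdc x (y * z).
Proof.
move=> T ly xy yz.
have [g' [r [h' [E1 E2 r1 r2 r3]]]] := cancel_ex x (y * z).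
have [/len_eq0 r0|] := posnP (len r^-1).
  have r10 : r = 1 by rewrite -[r]ginvK r0 ginv1.
  by rewrite E1 E2 r10 ginv1 gmulg1 gmul1g.
case/starts_ex => c sc; have syz : starts c (y * z) by rewrite E2; exact: starts_mul.
(* [x] ends with the inverse of [c], so an initial [c] in [y] would already cancel in [x * y]. *)
have nsy : ~~ starts c y.
  apply/negP => sy; have [y' Ey ry] := starts_split sy.
  have [r' Er rr] := starts_split sc.
  have Ex : x = g' * r'^-1 * (letter c)^-1 by rewrite -gmulA -ginvM -Er ginvK.
  have lx : len x = len (g' * r'^-1) + 1%N.
    apply/eqP; rewrite eqn_leq; have := len_mul (g' * r'^-1) (letter c)^-1.
    rewrite -Ex lenV len_letter // => -> /=.
    have := len_mul g' r'^-1; move: r1 rr; rewrite /rdc -E1 -Er !lenV len_letter //.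
    by move=> -> ->; lia.
  have := len_mul (g' * r'^-1) y'; move: xy ry; rewrite /rdc {1}Ex {1}Ey -!gmulA gmulKg gmulA.
  by rewrite lx -Ey len_letter //; lia.
have [_ h] := starts_pass yz syz nsy.
have : len y <= D.
  apply: (T 1 y 1 c.1); rewrite ?gmul1g ?gmulg1 //; [exact: rdc1g|exact: rdcg1|].
  by move=> t ty; rewrite e_sym; exact: h.
lia.
Qed.

Definition near D (H : set A) g := exists2 k, H k & len (k^-1 * g) <= D.

Lemma near_le D D' H g : D <= D' -> near D H g -> near D' H g.
Proof. by move=> DD [k Hk l]; exists k => //; apply: leq_trans DD. Qed.

Definition good_with D (H : set A) := forall h, H h ->
  thin D h /\ forall p q, h = p * q -> rdc p q -> near D H p.

Definition good (H : set A) := is_subgroup H /\ exists D, good_with D H.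

Lemma good_with_le D D' H : D <= D' -> good_with D H -> good_with D' H.
Proof.
move=> DD gH h /gH[T N]; split; first exact: thin_le T.
by move=> p q E pq; apply: near_le DD _; exact: N E pq.
Qed.

End Thin.

(** * Completing partial actions *)

Section Completion.
Context (Gr : sgraph).
Local Notation V := (vert Gr).
Local Notation e := (edge Gr).
Local Notation A := (raag e).
Local Notation letter := (@letter Gr).
Implicit Types (a b c d : V * bool) (g h : A).
Context (T : eqType) (tr : T -> A -> T) (X : seq T).
Hypothesis tr1 : forall x, tr x 1 = x.
Hypothesis trM : forall x g h, tr (tr x g) h = tr x (g * h).
Hypothesis square : forall x a b, x \in X -> e a.1 b.1 ->
  tr x (letter a) \in X -> tr x (letter b) \in X -> tr (tr x (letter a)) (letter b) \in X.

Let sh c x := tr x (letter c).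

Let shK c x : sh (neg c) (sh c x) = x.
Proof. by rewrite /sh trM letterN gmulgV tr1. Qed.

Let shNK c x : sh c (sh (neg c) x) = x.
Proof. by rewrite /sh trM letterN gmulVg tr1. Qed.

Let shC a b x : e a.1 b.1 -> sh a (sh b x) = sh b (sh a x).
Proof. by move=> ab; rewrite /sh !trM (letterC ab). Qed.

Let step c x := if sh c x \in X then sh c x else x.

(* Where [x * c] leaves [X], go back to the other end of the [c]-segment of
   [X] through [x], so that each segment becomes a cycle. *)
Let perm c x := if sh c x \in X then sh c x else iter (size X) (step (neg c)) x.

Let step_in c x : x \in X -> step c x \in X.
Proof. by rewrite /step; case: ifP. Qed.

Let iter_in c n x : x \in X -> iter n (step c) x \in X.
Proof. by move=> xX; elim: n => //= n IH; exact: step_in. Qed.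

Let perm_in c x : x \in X -> perm c x \in X.
Proof. by rewrite /perm => xX; case: ifP => // _; exact: iter_in. Qed.

Let iter_back c x n : x \in X -> sh c x \notin X ->
  iter n (step c) (iter n (step (neg c)) x) = x.
Proof.
move=> xX nx; elim: n => // n IH; rewrite [in X in iter _ _ X]iterS.
set y := iter n _ x in IH *; rewrite {2}/step; case: ifP => [h|_].
  by rewrite iterSr {2}/step shNK iter_in.
by rewrite iterS IH /step (negbTE nx).
Qed.

(** [size X] backward steps reach the other end of the segment. Otherwise the orbit repeats; by
    injectivity it returns to [x], and then the point preceding this return is [sh c x], inside
    [X]. *)
Let back_stop c x : x \in X -> sh c x \notin X ->
  sh (neg c) (iter (size X) (step (neg c)) x) \notin X.
Proof.
move=> xX nx; apply/negP => inX; pose h n := iter n (step (neg c)) x.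
have hin n : n <= size X -> sh (neg c) (h n) \in X.
  move=> nX; apply/negPn/negP => out; case/negP: (out); move: inX.
  suff -> : iter (size X) (step (neg c)) x = h n by [].
  rewrite -(subnK nX); elim: (size X - n) => //= k ->.
  by rewrite /step (negbTE out).
have hS n : n <= size X -> h n.+1 = sh (neg c) (h n).
  by move=> nX; rewrite /h iterS {1}/step hin.
have [i [j [ij jX E]]] := pigeonhole (fun i (_ : i <= size X) => iter_in (neg c) i xX).
rewrite -/(h i) -/(h j) in E; elim: i j ij jX E => [|i IH] [|j] // ij jX.
  rewrite hS; last exact: ltnW.
  by move=> E; move: nx; rewrite -[x]/(h 0) E shNK iter_in.
rewrite !hS; try lia; move=> E; apply: (IH j) => //; first exact: ltnW.
by rewrite -[h i](shNK c) E shNK.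
Qed.

Let permK c x : x \in X -> perm (neg c) (perm c x) = x.
Proof.
move=> xX; rewrite {2}/perm; case: ifP => [h|/negbT h].
  by rewrite /perm shK xX.
rewrite /perm (negbTE (back_stop xX h)) negK.
exact: iter_back.
Qed.

Let sh_sq a b x : x \in X -> e a.1 b.1 -> sh a x \in X ->
  (sh b (sh a x) \in X) = (sh b x \in X).
Proof.
move=> xX ab ax; apply/idP/idP => h; last exact: square.
by rewrite -(shK a x) -shC //; apply: square; rewrite // -/(sh _ _) ?shK // e_sym.
Qed.

Let step_sh a b x : x \in X -> e a.1 b.1 -> sh a x \in X ->
  sh a (step b x) \in X /\ step b (sh a x) = sh a (step b x).
Proof.
move=> xX ab ax; rewrite /step sh_sq //; case: ifP => // bx.
by rewrite shC // sh_sq.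
Qed.

Let iter_sh a b x n : x \in X -> e a.1 b.1 -> sh a x \in X ->
  sh a (iter n (step b) x) \in X /\ iter n (step b) (sh a x) = sh a (iter n (step b) x).
Proof.
move=> xX ab ax; elim: n => //= n [IH1 IH2]; rewrite IH2.
by apply: step_sh => //; exact: iter_in.
Qed.

Let perm_sh a b x : x \in X -> e a.1 b.1 -> sh a x \in X ->
  sh a (perm b x) \in X /\ perm b (sh a x) = sh a (perm b x).
Proof.
move=> xX ab ax; rewrite /perm sh_sq //; case: ifP => // bx; last exact: iter_sh.
by rewrite shC // sh_sq.
Qed.

Let perm_sh_out a b x : x \in X -> e a.1 b.1 -> sh a x \notin X -> sh a (perm b x) \notin X.
Proof.
move=> xX ab; apply: contra => h; rewrite -(permK b xX).
by case: (@perm_sh a (neg b) (perm b x)) => //; exact: perm_in.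
Qed.

Let perm_step a b x : x \in X -> e a.1 b.1 -> step a (perm b x) = perm b (step a x).
Proof.
move=> xX ab; rewrite {2}/step; case: ifP => [h|/negbT h].
  by have [h1 h2] := perm_sh xX ab h; rewrite /step h1 h2.
by rewrite /step (negbTE (perm_sh_out xX ab h)).
Qed.

(** By [square], moving along a [b]-edge of [X] carries [a]-segments to parallel [a]-segments of the
    same shape, so closing them up preserves commutation. *)
Let permC a b x : x \in X -> e a.1 b.1 -> perm a (perm b x) = perm b (perm a x).
Proof.
move=> xX ab; rewrite {1}/perm {2}[in RHS]/perm; case: (boolP (sh a x \in X)) => h.
  by have [h1 h2] := perm_sh xX ab h; rewrite h1 h2.
rewrite (negbTE (perm_sh_out xX ab h)).
elim: (size X) => // n IH; rewrite !iterS IH perm_step //; exact: iter_in.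
Qed.

Let actw (w : word V) x := foldl (fun x c => perm c x) x w.

Let actw_in w x : x \in X -> actw w x \in X.
Proof. by elim: w x => //= c w IH x xX; apply: IH; exact: perm_in. Qed.

Let actw_pres u v : pres_eq (raag_rel e) u v -> forall x, x \in X -> actw u x = actw v x.
Proof.
elim=> {u v} [u|u v _ IH|u v w _ IH1 _ IH2|u u' v v' _ IH1 _ IH2|y b|u v] //.
- by move=> x xX; rewrite IH.
- by move=> x xX; rewrite IH1 // IH2.
- by move=> x xX; rewrite /actw !foldl_cat -!/(actw _ _) IH1 // IH2 //; exact: actw_in.
- by move=> x xX /=; exact: (permK (y, b)).
- case=> {}u {}v uv x xX /=; apply: permC => //=.
  by rewrite e_sym.
Qed.

(** [permK] and [permC] turn [perm] into an action of the whole group on the finite set [X], and [M]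
    is the stabilizer of [x0]. Along a word whose trajectory never leaves [X], this action agrees
    with [tr]. *)
Lemma completion x0 : x0 \in X -> exists M, [/\ is_subgroup M, finite_index M &
  forall w, (forall i, tr x0 (ev (take i w)) \in X) ->
    M (ev w) <-> tr x0 (ev w) = x0].
Proof.
move=> x0X; pose act (g : A) x := actw (repr (g : presented (raag_rel e))) x.
have actev w x : x \in X -> act (ev w) x = actw w x.
  by move=> xX; apply: actw_pres => //; exact: pres_repr.
have act1 x : x \in X -> act 1 x = x by move=> xX; rewrite -[1]/(ev [::]) actev.
have act_in g x : x \in X -> act g x \in X by exact: actw_in.
have actM g h x : x \in X -> act (g * h) x = act h (act g x).
  move=> xX; rewrite -[g * h]/(ev (_ ++ _)) actev // /actw foldl_cat.
  by [].
pose M := [set g | act g x0 = x0].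
have sM : is_subgroup M.
  apply: mk_subgroup => [|x y Ex Ey|x Ex]; rewrite /M /=.
  - exact: act1.
  - by rewrite actM // Ex.
  - by rewrite -{1}Ex -actM // gmulgV act1.
exists M; split=> //.
  (* The action is on the right, so left cosets [g M] correspond to the points [act g^-1 x0]. *)
  apply/finite_indexP => //; exists [seq xget 1 [set f | act f^-1 x0 = y] | y <- X] => g.
  exists (xget 1 [set f | act f^-1 x0 = act g^-1 x0]).
    by apply/mapP; exists (act g^-1 x0) => //; exact: act_in.
  case: xgetP => [f _ /= E|/(_ g)/(_ erefl)[]].
  by rewrite /M /= actM // E -actM // gmulVg act1.
move=> w hw; rewrite /M /= actev //.
suff -> : actw w x0 = tr x0 (ev w) by [].
elim/last_ind: w hw => [|w c IH] hw; first by rewrite ev_nil tr1.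
have hw' i : tr x0 (ev (take i w)) \in X.
  have [iw|iw] := leqP i (size w).
    by have := hw i; rewrite -cats1 takel_cat.
  by have := hw (size w); rewrite -cats1 takel_cat // take_size (take_oversize (ltnW iw)).
have := hw (size w).+1; rewrite take_oversize ?size_rcons // /actw foldl_rcons -/(actw w x0) IH //.
by rewrite -cats1 -evM -trM -/(letter c) /perm -/(sh c _) => ->.
Qed.

End Completion.

(** * Convex hulls and separability of quasiconvex subgroups *)

Section Hull.
Context (Gr : sgraph).
Local Notation V := (vert Gr).
Local Notation e := (edge Gr).
Local Notation A := (raag e).
Local Notation len := (@len Gr).
Local Notation letter := (@letter Gr).
Local Notation starts := (@starts Gr).
Local Notation rdc := (@rdc Gr).
Implicit Types (a b c d : V * bool) (g h k p q r u x y z : A) (s t : V).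


Lemma letter_inj a b : letter a = letter b -> a = b.
Proof.
move=> E; apply: (starts_letter); rewrite -E -[letter a]gmulg1.
exact: (rdc_starts (rdcg1 _)).
Qed.

(** A geodesic with ends on different sides of a wall has an edge that crosses it, and
    [starts_exchange] describes that edge as a left multiplication by [letter c] or its inverse. *)
Lemma starts_cross z p c : starts c z != starts c (z * p) -> exists u b v,
  [/\ p = u * letter b * v, len p = len u + 1%N + len v &
      z * u * letter b = (if starts c z then (letter c)^-1 else letter c) * (z * u)].
Proof.
elim/len_ind: p z => p IH z ne.
have [/len_eq0 p1|] := posnP (len p); first by rewrite p1 gmulg1 eqxx in ne.
case/starts_ex => b /(starts_split)[p' E r].
have lp : len p = (len p').+1 by rewrite E r len_letter.
have [same|diff] := eqVneq (starts c z) (starts c (z * letter b)).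
  have [|/=|u [d [v [E1 E2 E3]]]] := IH p' _ (z * letter b); first by rewrite lp.
    by rewrite -same -gmulA -E.
  exists (letter b * u), d, v; rewrite E E1 -same !gmulA in E3 *; split=> //.
  have := len_mul (letter b) u; have := len_mul (letter b * u * letter d) v.
  have := len_mul (letter b * u) (letter d).
  by move: lp; rewrite E E1 !gmulA !len_letter // => ->; rewrite -E1; lia.
exists 1, b, p'; rewrite E !gmul1g !gmulg1; split=> //; first by rewrite r len1 len_letter.
case: ifP diff => /= [sz|/negbT sz].
  case: (boolP (starts c (z * letter b))) => // nsz _.
  have := @starts_exchange Gr (neg b) c (z * letter b) nsz.
  by rewrite letterN gmulgK => /(_ sz) {2}->; rewrite gmulKg.
by case: (boolP (starts c (z * letter b))) => // sz' _; exact: starts_exchange.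
Qed.

(** Halfspaces are convex. Two crossings of the same wall are mutually inverse left multiplications,
    so deleting both edges would express [p * q] with two letters less. *)
Lemma starts_cross2 z p q c : rdc p q ->
  starts c z = starts c (z * p * q) -> starts c (z * p) = starts c z.
Proof.
move=> pq E; apply/eqP/negP => /negP ne.
have [|u [b [v [E1 L1 F1]]]] := @starts_cross z p c; first by rewrite eq_sym.
have [|u' [b' [v' [E2 L2 F2]]]] := @starts_cross (z * p) q c; first by rewrite -E.
set C1 := (if starts c z then _ else _) in F1; set C2 := (if _ then _ else _) in F2.
have K : C2 * C1 = 1.
  rewrite /C1 /C2; move: ne; case: (starts c z); case: (starts c (z * p)) => // _.
    by rewrite gmulgV.
  by rewrite gmulVg.
have P : z * p = C1 * (z * u) * v by rewrite E1 !gmulA F1 !gmulA.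
have G : p * q = u * v * u' * v'.
  apply: (@gmulI _ z); transitivity (C2 * (z * p * u') * v').
    by rewrite {1}E2 -F2 !gmulA.
  by rewrite P !gmulA K gmul1g.
have := len_mul (u * v * u') v'; have := len_mul (u * v) u'; have := len_mul u v.
by rewrite -G pq L1 L2; lia.
Qed.

Context (H : set A) (H_sub : is_subgroup H) (D : nat).
Hypothesis H_near : forall p q, H (p * q) -> rdc p q -> near D H p.

(** By Levi's lemma a prefix of an element of [H f] is a prefix of an element of [H] followed by a
    piece of [f]. *)
Lemma near_prefix_mul f p q : H (p * q * f^-1) -> rdc p q -> near (D + len f) H p.
Proof.
move=> Hpq pq.
have [h [r [f' [E1 E2 r1 r2 r3]]]] := cancel_ex (p * q * f^-1) f.
have E : h * f' = p * q.
  by rewrite -[RHS](gmulgVK f) E1 {1}E2 -!gmulA gmulVKg.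
have [x1 [x2 [y1 [y2 [[F1 F2 F3 F4] [R1 R2 R3 R4 _]]]]]] := levi r3 pq E.
have [k Hk l] : near D H x1.
  apply: (H_near (q := x2 * r)); first by rewrite gmulA -F1 -E1.
  by case: (@rdc3l Gr x1 x2 r); rewrite -?F1.
exists k => //; rewrite F3 gmulA; apply: leq_trans (len_mul _ _) _; apply: leq_add => //.
by rewrite E2 r2 F2 R2; lia.
Qed.

Context (f : A).
Definition hull_base z := H z \/ H (z * f^-1).

(* The convex hull of [hull_base]: [starts c (x^-1 * y)] says that [y] lies in
   the halfspace beyond the edge from [x] to [x * letter c]. *)
Definition hull : set A := [set y | forall x c, starts c (x^-1 * y) ->
  exists2 z, hull_base z & starts c (x^-1 * z)].

Lemma hull_baseM h z : H h -> hull_base z -> hull_base (h * z).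
Proof. by move=> Hh [?|?]; [left|right]; rewrite -?gmulA; exact: subgM. Qed.

Lemma hullM h y : H h -> hull y -> hull (h * y).
Proof.
move=> Hh Yy x c; have -> : x^-1 * (h * y) = (h^-1 * x)^-1 * y by rewrite ginvM ginvK gmulA.
case/Yy => z Zz sz; exists (h * z); first exact: hull_baseM.
by rewrite ginvM ginvK -gmulA in sz.
Qed.

Lemma hull_sub z : hull_base z -> hull z.
Proof. by move=> Zz x c sc; exists z. Qed.

Lemma hull_path z p q : hull_base z -> hull_base (z * p * q) -> rdc p q -> hull (z * p).
Proof.
move=> Z1 Z2 pq x c sc; case: (boolP (starts c (x^-1 * z))) => [|n1]; first by exists z.
case: (boolP (starts c (x^-1 * (z * p * q)))) => [|n2]; first by exists (z * p * q).
case/negP: (n1); rewrite -(@starts_cross2 _ p q c pq); first by rewrite -gmulA.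
by rewrite (negbTE n1) -!gmulA in n2 *; rewrite (negbTE n2).
Qed.

(** If a wall cut off only the fourth vertex of the square, both edges ending there would cross it,
    and the two exchange relations would give [a = b]. *)
Lemma hull_square y a b : e a.1 b.1 -> hull y -> hull (y * letter a) -> hull (y * letter b) ->
  hull (y * letter a * letter b).
Proof.
move=> ab Y1 Y2 Y3 x c sc.
case: (boolP (starts c (x^-1 * (y * letter a)))) => [/Y2 //|na].
case: (boolP (starts c (x^-1 * (y * letter b)))) => [/Y3 //|nb].
have E1 : x^-1 * (y * letter a) * letter b = letter c * (x^-1 * (y * letter a)).
  by apply: starts_exchange => //; rewrite -!gmulA in sc *.
have E2 : x^-1 * (y * letter b) * letter a = letter c * (x^-1 * (y * letter b)).
  by apply: starts_exchange => //; rewrite -!gmulA -(letterC ab) in sc *.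
have : letter a = letter b.
  apply: (@gmulI _ (letter c * x^-1 * y)); rewrite -!gmulA in E1 E2 *.
  by rewrite -E1 -E2 (letterC ab).
by move/letter_inj => F; rewrite F e_irrefl in ab.
Qed.


Lemma prefS c0 y i : i < len y -> pref y i.+1 = pref y i * letter (nth c0 (rep y) i).
Proof. by move=> il; rewrite /pref (take_nth c0) // -cats1 -evM. Qed.

Lemma prefS_rdc c0 y i : i < len y -> rdc (pref y i) (letter (nth c0 (rep y) i)).
Proof.
move=> il; have [l1 _] := len_pref_suf il; have [l2 _] := len_pref_suf (ltnW il).
by rewrite /rdc len_letter -prefS // l1 l2 addn1.
Qed.

(* The number of edges of a geodesic that are parallel to one crossed on the
   way from [1] to [g] is at most [len g]. *)
Lemma count_walls c0 y g :
  \sum_(i < len y) starts (nth c0 (rep y) i) ((pref y i)^-1 * g) <= len g.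
Proof.
(* Each edge of the path brings it one step closer to [g] if its wall is crossed towards [g], and
   one step farther otherwise. *)
have tele n : n <= len y ->
    len ((pref y n)^-1 * g) + (\sum_(i < n) starts (nth c0 (rep y) i) ((pref y i)^-1 * g)).*2 = len g + n.
  elim: n => [|n IH] nl; first by rewrite big_ord0 /pref take0 ev_nil ginv1 gmul1g.
  rewrite big_ord_recr /= (prefS c0) // ginvM -gmulA.
  have := IH (ltnW nl); set S := \sum_(i < n) _; rewrite -!mul2n.
  by case: (boolP (starts _ _)) => [/len_starts|/len_nstarts] -> /= E; lia.
have := tele _ (leqnn _); have := len_mul (pref y (len y)) ((pref y (len y))^-1 * g).
have := len_mul g ((pref y (len y))^-1 * g)^-1.
rewrite lenV ginvM ginvK gmulVKg gmulVKg.
have [-> _] := len_pref_suf (leqnn (len y)); rewrite -mul2n; lia.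
Qed.

Lemma near_min y : exists2 h, H h & forall k, H k -> len (h^-1 * y) <= len (k^-1 * y).
Proof.
have ex : exists n, `[< exists2 h, H h & len (h^-1 * y) = n >].
  by exists (len (1^-1 * y)); apply/asboolP; exists 1 => //; exact: subg1.
case: (ex_minnP ex) => n /asboolP[h Hh <-] mn; exists h => // k Hk.
by apply: mn; apply/asboolP; exists k.
Qed.

Lemma near_hull_base q z' : hull_base (q * z') -> rdc q z' -> near (D + len f) H q.
Proof.
case=> [Hz|Hz] r; last exact: near_prefix_mul Hz r.
by apply: (near_le (leq_addr _ _)); exact: H_near Hz r.
Qed.

(** Translate [y] to be shortest in its coset of [H]. Each of the [len y] walls between 1 and [y]
    has a point [z] of [hull_base] beyond it, hence also the meet [q] of [y] and [z]. As [q] is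
    [K]-near [H], minimality of [y] gives [len q <= K]. A ball of radius [K] has boundedly many such
    [q], and each lies beyond at most [K] of the walls. *)
Lemma hull_near : exists R, forall y, hull y -> near R H y.
Proof.
pose K := D + len f; exists (size (word_ball Gr K) * K)%N => y0 Yy0.
have [h Hh hmin] := near_min y0; exists h => //.
have Yy : hull (h^-1 * y0) by apply: hullM => //; exact: subgV.
have ymin k : H k -> len (h^-1 * y0) <= len (k^-1 * (h^-1 * y0)).
  move=> Hk; rewrite gmulA -ginvM; apply: hmin; exact: subgM.
move: (h^-1 * y0) Yy ymin => y Yy ymin.
have [->//|/starts_ex[c0 _]] := posnP (len y).
pose C i := nth c0 (rep y) i.
have wall i : i < len y -> exists q, len q <= K /\ starts (C i) ((pref y i)^-1 * q).
  move=> il; have sy : starts (C i) ((pref y i)^-1 * y).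
    have rd := prefS_rdc c0 il; have [_ l2] := len_pref_suf (ltnW il).
    have [_ l1] := len_pref_suf il.
    have E : (pref y i)^-1 * y = suf y i by rewrite -{2}(prefK y i) gmulKg.
    have F : suf y i = letter (C i) * suf y i.+1.
      by apply: (@gmulI _ (pref y i)); rewrite prefK gmulA -prefS // prefK.
    by rewrite E F; apply: rdc_starts; rewrite /rdc -F l1 l2 len_letter; lia.
  have [z Zz sz] := Yy _ _ sy.
  have [q [y' [z' [E1 E2 r1 r2 r3]]]] := meet_ex y z.
  exists q; split; last first.
    have E : (pref y i)^-1 * q = (pref y i)^-1 * y * y'^-1 by rewrite {3}E1 -!gmulA gmulgV gmulg1.
    rewrite E (@starts_cross2 _ _ z') //; first by rewrite /rdc r3 lenV.
    by rewrite -E -gmulA -E2 sy.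
  have [k Hk lk] : near K H q by apply: (@near_hull_base q z') => //; rewrite -E2.
  have := ymin k Hk; rewrite {2}E1 gmulA.
  have ly : len y = len q + len y' by rewrite {1}E1.
  have := len_mul (k^-1 * q) y'; lia.
pose B := [seq q <- word_ball Gr K | len q <= K].
have -> : len y = \sum_(i < len y) 1 by rewrite sum1_card card_ord.
apply: (@leq_trans (\sum_(i < len y) \sum_(q <- B) starts (C i) ((pref y i)^-1 * q))).
  apply: leq_sum => -[i il] _ /=; have [q [lq sq]] := wall i il.
  have qB : q \in B by rewrite mem_filter lq word_ball_mem.
  by rewrite (big_rem q) //= sq.
rewrite exchange_big /=; apply: (@leq_trans (\sum_(q <- B) K)).
  rewrite big_seq [X in _ <= X]big_seq; apply: leq_sum => q; rewrite mem_filter => /andP[lq _].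
  exact: leq_trans (count_walls c0 y q) lq.
by rewrite big_const_seq count_predT iter_addn_0 mulnC leq_mul // size_filter count_size.
Qed.

End Hull.

Section Separability.
Context (Gr : sgraph).
Local Notation V := (vert Gr).
Local Notation e := (edge Gr).
Local Notation A := (raag e).
Local Notation rdc := (@rdc Gr).
Implicit Types (a b c d : V * bool) (g h k p q r u x y z : A).

(** The points of [completion] are the right cosets of [H] inside the hull of [H] and [H f].
    Geodesics from 1 to [H] or [H f] stay in the hull, so there the stabilizer [M] agrees with [H].
    Hence [M] contains [H] but not [f], and [f M] misses [H]. *)
Lemma quasiconvex_separable (H : set A) D : is_subgroup H ->
  (forall p q, H (p * q) -> rdc p q -> near D H p) -> separable H.
Proof.
move=> sH nH; apply/separableP => f nHf.
pose rc y : set A := [set z | H (z * y^-1)].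
pose tr (C : set A) g : set A := [set z | C (z * g^-1)].
have rcP y z : rc y = rc z <-> H (y * z^-1).
  split=> [E|Hyz].
    by have : rc z y by rewrite -E /rc /= gmulgV; exact: subg1.
  apply/seteqP; split=> x; rewrite /rc /= => Hx.
    by have := subgM sH Hx Hyz; rewrite gmulA gmulgVK.
  by have := subgM sH Hx (subgV sH Hyz); rewrite ginvM ginvK gmulA gmulgVK.
have trrc y g : tr (rc y) g = rc (y * g).
  by apply/seteqP; split=> x; rewrite /tr /rc /= ginvM gmulA.
have [R hR] := hull_near sH nH f.
pose X := [seq rc y | y <- word_ball Gr R & `[< hull H f y >]].
have inX y : rc y \in X <-> hull H f y.
  split=> [/mapP[z]|Yy].
    rewrite mem_filter => /andP[/asboolP Yz _] /rcP Hyz.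
    by rewrite -(gmulgVK z y); exact: hullM.
  have [k Hk lk] := hR y Yy; apply/mapP; exists (k^-1 * y).
    rewrite mem_filter word_ball_mem // andbT; apply/asboolP; apply: hullM => //; exact: subgV.
  by apply/rcP; rewrite ginvM ginvK gmulA gmulgV gmul1g.
have Xex C : C \in X -> exists2 y, C = rc y & hull H f y.
  by case/mapP => y; rewrite mem_filter => /andP[/asboolP Yy _] ->; exists y.
have [||||M [sM fM hM]] := @completion Gr _ tr X _ _ _ (rc 1).
- by move=> C; apply/seteqP; split=> x; rewrite /tr /= ginv1 gmulg1.
- by move=> C g h; apply/seteqP; split=> x; rewrite /tr /= ginvM gmulA.
- move=> C a b /Xex[y -> Yy] ab; rewrite !trrc => /inX Ya /inX Yb.
  by apply/inX; exact: hull_square.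
- by apply/inX; apply: hull_sub; left; exact: subg1.
have path z : hull_base H f z -> M z <-> H z.
  move=> Zz; rewrite -{1}(ev_rep z) hM => [|i].
    by rewrite trrc ev_rep gmul1g; rewrite rcP ginv1 gmulg1.
  rewrite trrc; apply/inX; apply: (@hull_path _ _ _ 1 _ (suf z i)).
  - by left; exact: subg1.
  - by rewrite gmul1g -/(pref z i) prefK.
  - exact: pref_rdc.
exists (core M).
  by split; [exact: core_subgroup|exact: core_finite|move=> *; exact: core_conj].
move=> x /core_sub Mx Hx; apply: nHf; apply/path; first by right; rewrite gmulgV; exact: subg1.
have Mx' : M x by apply/path => //; left.
have -> : f = x * (f^-1 * x)^-1 by rewrite ginvM ginvK gmulA gmulgV gmul1g.
by apply: subgM => //; exact: subgV.
Qed.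

End Separability.

(** * Products with bounded cancellation *)

Section Blocks.
Context (Gr : sgraph).
Local Notation e := (edge Gr).
Local Notation A := (raag e).
Local Notation len := (@len Gr).
Local Notation supp := (@supp Gr).
Local Notation rdc := (@rdc Gr).
Local Notation orth := (@orth Gr).
Implicit Types (a b c d g h k m p q r u x y z : A) (s t : seq A).

Definition prodl s : A := foldr (fun x y => x * y) 1 s.

Lemma prodl_cat s t : prodl (s ++ t) = prodl s * prodl t.
Proof. by elim: s => [|a s IH] /=; rewrite ?gmul1g // IH gmulA. Qed.

(** At most [K] letters of [b] cancel in the product [a * b]. *)
Definition meets K a b := forall p u v,
  a^-1 = p * u -> b = p * v -> rdc p u -> rdc p v -> len p <= K.

(** Only inner factors are required to be long; the first and the last may be short. *)
Fixpoint chain K C a s := match s with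
  | [::] => True
  | b :: s' => [/\ meets K a b, s' <> [::] -> C <= len b & chain K C b s']
  end.

Lemma orth_subl g h x : rdc g h -> orth (g * h) x -> orth g x /\ orth h x.
Proof.
by move=> gh O; split=> v w gv xw; apply: O => //; rewrite supp_rdc // gv ?orbT.
Qed.

Lemma orth_subr g h x : rdc g h -> orth x (g * h) -> orth x g /\ orth x h.
Proof.
by move=> gh /orth_sym/(orth_subl gh)[H1 H2]; split; exact: orth_sym.
Qed.

(** The parts of [a] that cancel on its left and on its right do not overlap: a letter common to [p]
    and [r] would commute with everything of [a] outside them, a piece of length at most [D]. *)
Lemma thin_overlap D K a p x y r : thin D a -> a = p * x -> a = y * r -> rdc p x -> rdc y r ->
  len p <= K -> len r <= K -> (2 * K + D < len a)%N ->
  exists m, [/\ x = m * r, y = p * m, rdc m r & rdc p m].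
Proof.
move=> T E1 E2 px yr lp lr la.
have [x1 [x2 [y1 [y2 [[F1 F2 F3 F4] [R1 R2 R3 R4 O]]]]]] := levi px yr (etrans (esym E1) E2).
have [x20|x2n] := pselect (x2 = 1).
  by exists y1; move: F1 F4; rewrite x20 gmulg1 gmul1g => -> ->.
have : len y1 <= D.
  apply: thin_orth O x2n; apply: (thin_l R2); rewrite -F2.
  by apply: (thin_r px); rewrite -E1.
by move: la lp lr; rewrite E1 px F4 R4 F2 R2; lia.
Qed.

(** A piece [u] commuting with [v] has parts [u1], [u3], [u4] in [m], [m1], [z]. If [u1] and [u4]
    are both nontrivial, the part of [m1] before [u3] commutes with [u1] and the part after it with
    [u4], so [m1] has length at most [3 * D]. Hence [u] meets at most one side of a longer [m1], and
    two bounds [D] add up. *)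
Lemma thin_cat D m m1 z : thin D m -> thin D m1 -> thin (2 * D)%N (m1 * z) -> rdc m1 z ->
  rdc m (m1 * z) -> z = 1 \/ (3 * D < len m1)%N -> thin (2 * D)%N (m * (m1 * z)).
Proof.
move=> Tm Tm1 Tz mz mmz big p u q v E pu puq su.
have [p1 [u1 [q1 [p2 [u2 [q2 [[E1 E2 E3 E4 E5] [R1 R2 R3 R4 [R5 R6 R7 [P1 P2 P3]]]]]]]]]] :=
  levi3 mmz pu puq E.
have su1 w : w \in supp u1 -> e v w by move=> h; apply: su; rewrite E4 supp_rdc // h.
have su2 w : w \in supp u2 -> e v w by move=> h; apply: su; rewrite E4 supp_rdc // h orbT.
have lu1 : len u1 <= D by apply: (Tm p1 u1 q1 v).
have [u10|u1n] := pselect (u1 = 1).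
  by rewrite E4 u10 gmul1g; apply: (Tz p2 u2 q2 v).
have [p3 [u3 [q3 [p4 [u4 [q4 [[F1 F2 F3 F4 F5] [S1 S2 S3 S4 [S5 S6 S7 [Q1 Q2 Q3]]]]]]]]]] :=
  levi3 mz R3 R4 E2.
have lu3 : len u3 <= D.
  by apply: (Tm1 p3 u3 q3 v) => // w h; apply: su2; rewrite F4 supp_rdc // h.
have [u40|u4n] := pselect (u4 = 1).
  by rewrite E4 R6 F4 u40 gmulg1; lia.
case: big => [z1|big].
  by case: u4n; apply: len_eq0; move: S4 S3; rewrite /rdc -F2 z1 len1; lia.
have lp3 : len p3 <= D.
  apply: (@thin_orth Gr D p3 u1) => //.
    by apply: (thin_l S1); apply: (thin_l S2); rewrite -F1.
  by move: P1; rewrite F3 => /(orth_subr S5)[].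
have lq3 : len q3 <= D.
  apply: (@thin_orth Gr D q3 u4) => //; last exact: orth_sym.
  by apply: (thin_r S2); rewrite -F1.
by move: big; rewrite F1 S2 S1; lia.
Qed.

(** [p] is what the preceding factor cancels from [a], [r] is what the next one cancels, and [m]
    survives. An inner factor keeps at least [C - 2 * K] letters, more than the [3 * D] that
    [thin_cat] asks for, so its two neighbours cannot interact across it. *)
Lemma blocks D K C a s p x : (2 * K + 3 * D < C)%N ->
  (forall b, b \in a :: s -> thin D b) -> chain K C a s ->
  a = p * x -> rdc p x -> len p <= K -> (s <> [::] -> p = 1 \/ C <= len a) ->
  exists m r z,
  [/\ x = m * r, rdc m r, len r <= K, s = [::] -> r = 1 /\ z = 1 & 
  [/\ m * z = p^-1 * prodl (a :: s), rdc m z, thin (2 * D)%N (m * z),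
      forall g h, m * z = g * h -> rdc g h -> exists s1 b s2 (t t' : A),
        [/\ a :: s = s1 ++ b :: s2, b = t * t', rdc t t' &
            len ((prodl s1 * t)^-1 * (p * g)) <= (2 * D)%N] &
      1 < size s -> exists m1 z1,
        [/\ z = m1 * z1, rdc m1 z1, thin D m1 & C <= len m1 + (2 * K)%N]]].
Proof.
move=> CK; elim: s a p x => [|b s IH] a p x Ts ch Ea px lp big.
  have Tx : thin D x by apply: (thin_r px); rewrite -Ea; apply: Ts; rewrite inE.
  exists x, 1, 1; rewrite gmulg1; split; rewrite ?len1 //; try exact: rdcg1.
  split=> //.
  - by rewrite /= gmulg1 Ea gmulKg.
  - exact: rdcg1.
  - by apply: thin_le Tx; lia.
  - move=> g h Eg gh; exists [::], a, [::], (p * g), h; split=> //.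
    + by rewrite Ea Eg gmulA.
    + by rewrite Eg in px; case: (rdc3r gh px).
    + by rewrite /= gmul1g gmulVg len1.
case: ch => mab lb chb.
have Ta : thin D a by apply: Ts; rewrite inE eqxx.
have Tb : thin D b by apply: Ts; rewrite !inE eqxx orbT.
have [q [u [v [F1 F2 r1 r2 r3]]]] := meet_ex a^-1 b.
have lq : len q <= K by exact: mab F1 F2 r1 r2.
have Ea' : a = u^-1 * q^-1 by rewrite -ginvM -F1 ginvK.
have r1' : rdc u^-1 q^-1 by exact: rdcV.
have [m [G1 G2 mr pm]] : exists m, [/\ x = m * q^-1, u^-1 = p * m, rdc m q^-1 & rdc p m].
  case: big => // [p1|big].
    exists u^-1; move: Ea; rewrite p1 !gmul1g => <-; split=> //; exact: rdc1g.
  by apply: (thin_overlap Ta Ea Ea' px r1' lp); rewrite ?lenV //; lia.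
have mv : rdc m v.
  have : rdc u^-1 v by rewrite /rdc r3 lenV.
  by rewrite G2 => /(rdc3l pm)[].
have [||m1 [r [z1 [H1 H2 H3 H4 [H5 H6 H7 H8 H9]]]]] := IH b q v _ chb F2 r2 lq.
- by move=> c cs; apply: Ts; rewrite inE cs orbT.
- by move=> sn; right; exact: lb.
have Tm : thin D m.
  apply: (@thin_factor Gr D p m q^-1) => //; first by rewrite -G2.
  by rewrite -G2 -Ea'.
have Tm1 : thin D m1.
  by apply: (thin_l H2); rewrite -H1; apply: (thin_r r2); rewrite -F2.
have mm1 : rdc m m1 by move: mv; rewrite H1 => /(rdc3r H2)[].
have lm1 : s <> [::] -> C <= len m1 + (2 * K)%N.
  by move=> /lb; rewrite F2 r2 H1 H2; lia.
have mz : rdc m (m1 * z1).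
  case: (pselect (s = [::])) => [/H4[_ ->]|/lm1 l1]; first by rewrite gmulg1.
  by apply: (thin_glue Tm1) => //; lia.
exists m, q^-1, (m1 * z1); rewrite lenV; split=> //; split=> //.
- by rewrite H5 /= [in RHS]Ea' G2 -!gmulA !gmulKg.
- apply: thin_cat => //; case: (pselect (s = [::])) => [/H4[_ ->]|/lm1 l1]; [by left|right; lia].
- move=> g h E gh.
  have [g1 [h1 [g2 [h2 [[E1 E2 E3 E4] [R1 R2 R3 R4 O]]]]]] := levi mz gh E.
  (* If [h1 = 1], the prefix contains all of [m] and the induction hypothesis applies. Otherwise
     [g2] commutes with [h1], hence is short, and the prefix stays close to the prefix [p * g1] of
     [a]. *)
  case: (pselect (h1 = 1)) => [h10|h1n].
    have [s1 [c [s2 [t [t' [Q1 Q2 Q3 Q4]]]]]] := H8 g2 h2 E2 R2.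
    exists (a :: s1), c, s2, t, t'; split=> //; first by rewrite Q1.
    have -> : (prodl (a :: s1) * t)^-1 * (p * g) = (prodl s1 * t)^-1 * (q * g2).
      rewrite /= Ea' G2 E3 E1 h10 gmulg1 !ginvM !ginvK -!gmulA.
      by congr (_ * (_ * (_ * _))); rewrite !gmulKg.
    exact: Q4.
  have lg2 : len g2 <= (2 * D)%N.
    by apply: thin_orth O h1n; apply: (thin_l R2); rewrite -E2.
  exists [::], a, (b :: s), (p * g1), (h1 * q^-1); split=> //.
  + by rewrite Ea' G2 E1 !gmulA.
  + move: r1' pm mr; rewrite G2 E1 => r1' pm mr.
    have [pg1 pgh] := rdc3r R1 pm; rewrite gmulA in r1'.
    by have [] := rdc3l pgh r1'.
  + by rewrite /= gmul1g E3 !ginvM -!gmulA gmulKg gmulKg.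
- by move=> ss; exists m1, z1; split=> //; apply: lm1 => s0; rewrite s0 in ss.
Qed.

End Blocks.

(** * Minimal factorizations *)

Section MinimalFactorizations.
Context (Gr : sgraph).
Local Notation e := (edge Gr).
Local Notation A := (raag e).
Local Notation len := (@len Gr).
Local Notation rdc := (@rdc Gr).
Implicit Types (a b c d g h k m p q r u x y z : A) (s t : seq A).
Context (D : nat).

Definition word_ball2 := [seq (x, y) | x <- word_ball Gr D, y <- word_ball Gr D].

(** Each prefix of [p] differs from [G1] and from [G2] by a pair of elements of a ball. Two prefixes
    with the same pair differ by an element [z] of both groups, and left multiplication by [z]
    shortens [x^-1] as well as [y]. *)
Lemma shift_shorter (G1 G2 : set A) x y p u v : is_subgroup G1 -> is_subgroup G2 ->
  good_with D G1 -> good_with D G2 -> G1 x -> G2 y ->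
  x^-1 = p * u -> y = p * v -> rdc p u -> rdc p v -> size word_ball2 < len p ->
  exists i, [/\ G1 i, G2 i & len (x * i^-1) + len (i * y) < len x + len y].
Proof.
move=> s1 s2 g1 g2 Gx Gy E1 E2 pu pv lp.
have ex j : exists f : A * A, j <= size word_ball2 ->
    [/\ f \in word_ball2, G1 (pref p j * f.1^-1) & G2 (pref p j * f.2^-1)].
  have [r1 F1 R1] := pref_factor j pu; have [r2 F2 R2] := pref_factor j pv.
  have [_ /(_ (pref p j) r1)[]] := g1 _ (subgV s1 Gx); rewrite ?F1 // => k1 K1 l1.
  have [_ /(_ (pref p j) r2)[]] := g2 _ Gy; rewrite ?F2 // => k2 K2 l2.
  exists (k1^-1 * pref p j, k2^-1 * pref p j) => _; split=> /=.
  - by apply/allpairsP; exists (k1^-1 * pref p j, k2^-1 * pref p j); split=> //=; exact: word_ball_mem.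
  - by rewrite ginvM ginvK gmulA gmulgV gmul1g.
  - by rewrite ginvM ginvK gmulA gmulgV gmul1g.
have [f hf] := choice ex.
have [i [j [ij jl E]]] := pigeonhole (fun j jl => let: And3 h _ _ := hf j jl in h).
have [_ G1i G2i] := hf i (leq_trans (ltnW ij) jl); have [_ G1j G2j] := hf j jl.
rewrite E in G1i G2i; set z := pref p i * (pref p j)^-1.
have sh : len (z * p) < len p.
  have jp : j <= len p by apply: leq_trans jl (ltnW lp).
  have := pref_shorten (ltnW ij) jp; rewrite -/z; lia.
have zu w : rdc p w -> len (z * (p * w)) < len (p * w).
  by move=> pw; have := len_mul (z * p) w; rewrite gmulA pw; lia.
exists z; split.
- have -> : z = (pref p i * (f j).1^-1) * (pref p j * (f j).1^-1)^-1.
    by rewrite ginvM ginvK gmulA gmulgVK.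
  by apply: subgM => //; exact: subgV.
- have -> : z = (pref p i * (f j).2^-1) * (pref p j * (f j).2^-1)^-1.
    by rewrite ginvM ginvK gmulA gmulgVK.
  by apply: subgM => //; exact: subgV.
- have := zu _ pv; rewrite -E2; have := zu _ pu; rewrite -E1 -(lenV (z * _)) ginvM ginvK lenV.
  by lia.
Qed.

Lemma chain_intro K C a s :
  (forall l1 x y l2, a :: s = l1 ++ x :: y :: l2 -> meets K x y) ->
  (forall l1 x y l2, s = l1 ++ x :: y :: l2 -> C <= len x) -> chain K C a s.
Proof.
elim: s a => //= b s IH a h1 h2; split.
- exact: (h1 [::] a b s).
- by case: s {IH h1} h2 => // c s h2 _; exact: (h2 [::] b c s).
- apply: IH => [l1 x y l2 E|l1 x y l2 E].
    by apply: (h1 (a :: l1) x y l2); rewrite E.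
  by apply: (h2 (b :: l1) x y l2); rewrite E.
Qed.

Context (G1 G2 M P1 P2 : set A) (C : nat).
Hypothesis sG1 : is_subgroup G1.
Hypothesis sG2 : is_subgroup G2.
Hypothesis sM : is_subgroup M.
Hypothesis sP1 : is_subgroup P1.
Hypothesis sP2 : is_subgroup P2.
Hypothesis gG1 : good_with D G1.
Hypothesis gG2 : good_with D G2.
Hypothesis P1G : P1 `<=` G1.
Hypothesis P2G : P2 `<=` G2.
Hypothesis GP1 : G1 `&` M `<=` P1.
Hypothesis GP2 : G2 `&` M `<=` P2.
Hypothesis IM : G1 `&` G2 `<=` M.
Hypothesis short : forall x, M x -> G1 x \/ G2 x -> len x < C -> G1 x /\ G2 x.

Definition mid c := M c /\ (G1 c \/ G2 c).

(** The successor makes merging two factors a strict decrease even when no letters cancel. *)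
Let mu a s b := sumn [seq (len x).+1 | x <- a :: s ++ [:: b]].

Let ok a s b := [/\ P1 a, forall c, c \in s -> mid c & P2 b].

(** Minimize [mu]. Neighbours in the same group would be merged, so the groups alternate; then
    [shift_shorter] bounds the cancellation between neighbours. The groups [P1], [P2] of the end
    factors are free because they are [G1], [G2] cut down to [M] in [good_gen] and the full [G1],
    [G2] in [avoid]. *)
Lemma minimal_factorization a0 s0 b0 : P1 a0 -> (forall c, c \in s0 -> mid c) -> P2 b0 ->
  exists a s b, [/\ P1 a, forall c, c \in s -> mid c, P2 b,
    a * prodl s * b = a0 * prodl s0 * b0 & chain (size word_ball2) C a (s ++ [:: b])].
Proof.
move=> Pa0 ms0 Pb0; set x0 := a0 * prodl s0 * b0.
pose Q n := `[< exists a s b, [/\ ok a s b, a * prodl s * b = x0 & mu a s b = n] >].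
have exQ : exists n, Q n by exists (mu a0 s0 b0); apply/asboolP; exists a0, s0, b0.
case: (ex_minnP exQ) => n /asboolP[a [s [b [[Pa ms Pb] E En]]]] minn.
have {En}mn a' s' b' : ok a' s' b' -> a' * prodl s' * b' = x0 -> mu a s b <= mu a' s' b'.
  by move=> o' E'; rewrite En; apply: minn; apply/asboolP; exists a', s', b'.
have muE a' s' b' : mu a' s' b' = ((len a').+1 + sumn [seq (len x).+1 | x <- s'] + (len b').+1)%N.
  by rewrite /mu /= map_cat sumn_cat /= addn0 addnA.
have Ia i : G1 i -> G2 i -> M i by move=> ? ?; exact: IM.
have shmid i c : G1 i -> G2 i -> mid c -> mid (i * c).
  by move=> i1 i2 [Mc [c1|c2]]; (split; first by apply: subgM => //; exact: Ia);
    [left|right]; exact: subgM.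
have shmidV i c : G1 i -> G2 i -> mid c -> mid (c * i^-1).
  by move=> i1 i2 [Mc [c1|c2]]; (split; first by apply: subgM => //; apply: subgV => //; exact: Ia);
    [left|right]; apply: subgM => //; exact: subgV.
have shP1 i c : G1 i -> G2 i -> P1 c -> P1 (c * i^-1).
  by move=> i1 i2 Pc; apply: subgM => //; apply: subgV => //; apply: GP1; split=> //; exact: Ia.
have shP2 i c : G1 i -> G2 i -> P2 c -> P2 (i * c).
  by move=> i1 i2 Pc; apply: subgM => //; apply: GP2; split=> //; exact: Ia.
have meetsI x y : (G1 x /\ G2 y) \/ (G2 x /\ G1 y) ->
    (forall i, G1 i -> G2 i -> len x + len y <= len (x * i^-1) + len (i * y)) ->
    meets (size word_ball2) x y.
  move=> Gxy no p u v E1 E2 pu pv; rewrite leqNgt; apply/negP => lp.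
  have [[x1 y2]|[x2 y1]] := Gxy.
    have [i [i1 i2]] := shift_shorter sG1 sG2 gG1 gG2 x1 y2 E1 E2 pu pv lp.
    by rewrite ltnNge no.
  have [i [i2 i1]] := shift_shorter sG2 sG1 gG2 gG1 x2 y1 E1 E2 pu pv lp.
  by rewrite ltnNge no.
have first_not_G1 c s' : s = c :: s' -> ~ G1 c.
  move=> Es c1; have [Mc _] : mid c by apply: ms; rewrite Es inE eqxx.
  have := mn (a * c) s' b; rewrite !muE Es /= => h.
  have := len_mul a c; suff : ok (a * c) s' b /\ a * c * prodl s' * b = x0 by case=> o /(h o); lia.
  split; last by rewrite -E Es /= !gmulA.
  split=> //; first by apply: subgM => //; exact: GP1.
  by move=> d ds; apply: ms; rewrite Es inE ds orbT.
have last_not_G2 c s' : s = s' ++ [:: c] -> ~ G2 c.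
  move=> Es c2; have [Mc _] : mid c by apply: ms; rewrite Es mem_cat inE eqxx orbT.
  have := mn a s' (c * b); rewrite !muE Es map_cat sumn_cat /= => h.
  have := len_mul c b; suff : ok a s' (c * b) /\ a * prodl s' * (c * b) = x0 by case=> o /(h o); lia.
  split; last by rewrite -E Es prodl_cat /= gmulg1 !gmulA.
  split=> //; last by apply: subgM => //; exact: GP2.
  by move=> d ds; apply: ms; rewrite Es mem_cat ds.
have mid_alt x y s1 s2 : s = s1 ++ x :: y :: s2 ->
    (G1 x /\ G2 y /\ ~ (G1 y) /\ ~ (G2 x)) \/ (G2 x /\ G1 y /\ ~ (G2 y) /\ ~ (G1 x)).
  move=> Es.
  have [Mx Gx] : mid x by apply: ms; rewrite Es mem_cat inE eqxx orbT.
  have [My Gy] : mid y by apply: ms; rewrite Es mem_cat !inE eqxx !orbT.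
  have no : ~ ((G1 x /\ G1 y) \/ (G2 x /\ G2 y)).
    move=> same; have := mn a (s1 ++ (x * y) :: s2) b.
    rewrite !muE Es !map_cat !sumn_cat /= => h; have := len_mul x y.
    suff : ok a (s1 ++ x * y :: s2) b /\ a * prodl (s1 ++ x * y :: s2) * b = x0 by case=> o /(h o); lia.
    split; last by rewrite -E Es !prodl_cat /= !gmulA.
    split=> // d; rewrite mem_cat inE => /or3P[ds|/eqP ->|ds].
    - by apply: ms; rewrite Es mem_cat ds.
    - split; first exact: subgM.
      by case: same => -[? ?]; [left|right]; exact: subgM.
    - by apply: ms; rewrite Es mem_cat !inE ds !orbT.
  case: Gx Gy => [x1|x2] [y1|y2]; first by case: no; left.
  - by left; do 2![split=> //]; split=> ?; apply: no; [left|right].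
  - by right; do 2![split=> //]; split=> ?; apply: no; [right|left].
  - by case: no; right.
exists a, s, b; split=> //; apply: chain_intro => l1 x y l2.
  case: l1 => [|a' l1] /= [Ea]; subst.
    case: s => [|c s] in ms E mn first_not_G1 last_not_G2 mid_alt *.
      case=> <- _; apply: meetsI => [|i i1 i2]; first by left; split; [exact: P1G|exact: P2G].
      have := mn (x * i^-1) [::] (i * b); rewrite !muE /= => h.
      suff : ok (x * i^-1) [::] (i * b) /\ x * i^-1 * 1 * (i * b) = x0 by case=> o /(h o); lia.
      split; last by rewrite -E /= !gmulg1 gmulA gmulgVK.
      by split=> //; [exact: shP1|exact: shP2].
    case=> Ec _; subst c; have [My Gy] : mid y by apply: ms; rewrite inE eqxx.
    apply: meetsI => [|i i1 i2].
      by left; split; [exact: P1G|case: Gy => // /(first_not_G1 _ _ erefl)].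
    have := mn (x * i^-1) (i * y :: s) b; rewrite !muE /= => h.
    suff : ok (x * i^-1) (i * y :: s) b /\ x * i^-1 * prodl (i * y :: s) * b = x0 by case=> o /(h o); lia.
    split; last by rewrite -E /= !gmulA gmulgVK.
    split=> //; first exact: shP1.
    move=> d; rewrite inE => /orP[/eqP ->|ds]; first by apply: shmid.
    by apply: ms; rewrite inE ds orbT.
  case/lastP: l2 => [|l2 b'].
    rewrite -[_ ++ [:: x; y]]/(l1 ++ ([:: x] ++ [:: y])) catA !cats1 => /rcons_inj[Es Eb].
    subst y; have {}Es : s = l1 ++ [:: x] by rewrite Es cats1.
    have [Mx Gx] : mid x by apply: ms; rewrite Es mem_cat inE eqxx orbT.
    apply: meetsI => [|i i1 i2].
      by left; split; [case: Gx => // /(last_not_G2 _ _ Es)|exact: P2G].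
    have := mn a' (l1 ++ [:: x * i^-1]) (i * b); rewrite !muE Es !map_cat !sumn_cat /= => h.
    suff : ok a' (l1 ++ [:: x * i^-1]) (i * b) /\ a' * prodl (l1 ++ [:: x * i^-1]) * (i * b) = x0.
      by case=> o /(h o); lia.
    split; last by rewrite -E Es !prodl_cat /= !gmulg1 !gmulA gmulgVK.
    split=> //; last exact: shP2.
    move=> d; rewrite mem_cat inE => /orP[ds|/eqP ->]; first by apply: ms; rewrite Es mem_cat ds.
    exact: shmidV.
  rewrite -!rcons_cons -rcons_cat cats1 => /rcons_inj[Es _].
  have Gxy := mid_alt _ _ _ _ Es.
  apply: meetsI => [|i i1 i2]; first by tauto.
  have := mn a' (l1 ++ [:: x * i^-1, i * y & l2]) b; rewrite !muE Es !map_cat !sumn_cat /= => h.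
  have [mx my] : mid x /\ mid y.
    by split; apply: ms; rewrite Es mem_cat !inE eqxx !orbT.
  suff : ok a' (l1 ++ [:: x * i^-1, i * y & l2]) b /\
      a' * prodl (l1 ++ [:: x * i^-1, i * y & l2]) * b = x0 by case=> o /(h o); lia.
  split; last by rewrite -E Es !prodl_cat /= !gmulA gmulgVK.
  split=> // d; rewrite mem_cat !inE => /or4P[ds|/eqP ->|/eqP ->|ds].
  - by apply: ms; rewrite Es mem_cat ds.
  - exact: shmidV.
  - exact: shmid.
  - by apply: ms; rewrite Es mem_cat !inE ds !orbT.
(* By [short], an inner factor of length less than [C] lies in both groups and could be merged with
   a neighbour. *)
move=> Es; rewrite leqNgt; apply/negP => lx.
have xs : exists s2, s = l1 ++ x :: s2.
  case/lastP: l2 Es => [|l2 b'].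
    rewrite -[_ ++ [:: x; y]]/(l1 ++ ([:: x] ++ [:: y])) catA !cats1 => /rcons_inj[Es _].
    by exists [::]; rewrite Es cats1.
  by rewrite -!rcons_cons -rcons_cat cats1 => /rcons_inj[-> _]; exists (y :: l2).
have [s2 Es2] := xs.
have [Mx Gx] : mid x by apply: ms; rewrite Es2 mem_cat inE eqxx orbT.
have [x1 x2] := short Mx Gx lx.
case/lastP: l1 Es2 {Es xs} => [|l1 z]; first by move/first_not_G1; apply.
by rewrite cat_rcons => /mid_alt; tauto.
Qed.

End MinimalFactorizations.

(** * Combination and avoidance *)

Section Products.
Context (Gr : sgraph).
Local Notation e := (edge Gr).
Local Notation A := (raag e).
Local Notation len := (@len Gr).
Local Notation rdc := (@rdc Gr).
Implicit Types (a b c d g h k m p q r u x y z : A) (s t : seq A) (G H M N X : set A)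
  (l : seq (set A)).

Fixpoint members s l : Prop := match s, l with
  | [::], [::] => True
  | b :: s', H :: l' => H b /\ members s' l'
  | _, _ => False
  end.

Definition pset l : set A := [set x | exists2 s, members s l & x = prodl s].

Lemma members_cat s t l l' : members s l -> members t l' -> members (s ++ t) (l ++ l').
Proof. by elim: s l => [|b s IH] [|H l] //= [Hb /IH h] /h. Qed.

Lemma members_catl s1 s2 l : members (s1 ++ s2) l ->
  exists l1 l2, [/\ l = l1 ++ l2, members s1 l1 & members s2 l2].
Proof.
elim: s1 l => [|b s1 IH] l /=; first by exists [::], l.
case: l => [//|H l] [Hb /IH[l1 [l2 [-> h1 h2]]]]; exists (H :: l1), l2; split=> //.
Qed.

Lemma members_catr s l1 l2 : members s (l1 ++ l2) ->
  exists s1 s2, [/\ s = s1 ++ s2, members s1 l1 & members s2 l2].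
Proof.
elim: l1 s => [|H l1 IH] s /=; first by exists [::], s.
case: s => [//|b s] [Hb /IH[s1 [s2 [-> h1 h2]]]]; exists (b :: s1), s2; split=> //.
Qed.

Lemma members_size s l : members s l -> size s = size l.
Proof. by elim: s l => [|b s IH] [|H l] //= [_ /IH ->]. Qed.

Lemma subgroup_reps G M : is_subgroup G -> is_subgroup M -> finite_index M ->
  exists s, (forall y, y \in s -> G y) /\ forall k, G k -> exists2 y, y \in s & M (k * y).
Proof.
move=> sG sM fM; have [l hl] := (finite_indexP sM).1 fM.
(* A coset that misses [G] contributes the default value 1, which still lies in [G]. *)
exists [seq xget 1 [set y | G y /\ M (f^-1 * y)] | f <- l]; split=> [_ /mapP[f _ ->]|k Gk].
  by case: xgetP => [y _ [] //|_]; exact: subg1.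
have [f fl Mf] := hl k^-1; exists (xget 1 [set y | G y /\ M (f^-1 * y)]).
  by apply/mapP; exists f.
case: xgetP => [y _ [Gy My]|/(_ k^-1)[]]; last by split=> //; exact: subgV.
have -> : k * y = (f^-1 * k^-1)^-1 * (f^-1 * y) by rewrite ginvM !ginvK -gmulA gmulVKg.
by apply: subgM => //; exact: subgV.
Qed.

Lemma subgroup_reps_near G M : is_subgroup G -> is_subgroup M -> finite_index M ->
  exists R, forall k, G k -> exists k', [/\ G k', M k' & len (k'^-1 * k) <= R].
Proof.
move=> sG sM fM; have [s [h1 h2]] := subgroup_reps sG sM fM.
exists (\max_(y <- s) len y) => k Gk; have [y ys My] := h2 k Gk.
exists (k * y); split=> //; first by apply: subgM => //; exact: h1.
by rewrite ginvM gmulgVK lenV; apply: leq_bigmax_seq.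
Qed.

(** The subgroup [K] of the overview, generated by the intersections of [M] with [G1] and with
    [G2]. *)
Definition gen G1 G2 M : set A :=
  [set x | exists2 s, forall c, c \in s -> mid G1 G2 M c & x = prodl s].

Lemma mid_gen G1 G2 M c : mid G1 G2 M c -> gen G1 G2 M c.
Proof.
by move=> mc; exists [:: c]; rewrite /= ?gmulg1 // => d; rewrite inE => /eqP ->.
Qed.

Lemma gen_subgroup G1 G2 M : is_subgroup G1 -> is_subgroup G2 -> is_subgroup M ->
  is_subgroup (gen G1 G2 M).
Proof.
move=> s1 s2 sM; apply: mk_subgroup => [|x y [s hs ->] [t ht ->]|x [s hs ->]].
- by exists [::].
- by exists (s ++ t); rewrite ?prodl_cat // => c; rewrite mem_cat => /orP[/hs|/ht].
- elim: s hs => [|b s IH] hs; first by exists [::] => //=; rewrite ginv1.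
  have [|t ht Et] := IH; first by move=> c cs; apply: hs; rewrite inE cs orbT.
  exists (t ++ [:: b^-1]); last by rewrite prodl_cat -Et /= ginvM gmulg1.
  move=> c; rewrite mem_cat inE => /orP[/ht //|/eqP ->].
  have [Mb Gb] := hs b (mem_head _ _); split; first exact: subgV.
  by case: Gb => ?; [left|right]; exact: subgV.
Qed.

Lemma thin_mul D h g : thin D h -> thin (D + len g) (h * g).
Proof.
move=> T; have [h' [r [g' [E1 E2 r1 r2 r3]]]] := cancel_ex h g.
have -> : h * g = h' * g' by rewrite E1 E2 gmulA gmulgK.
move=> p u q s E pu puq su.
have [p1 [u1 [q1 [p2 [u2 [q2 [[F1 F2 F3 F4 F5] [R1 R2 R3 R4 [R5 R6 R7 _]]]]]]]]] :=
  levi3 r3 pu puq E.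
have l1 : len u1 <= D.
  apply: (thin_l r1 _ (p := p1) (q := q1) (s := s)) => //; first by rewrite -E1.
  by move=> w wu; apply: su; rewrite F4 supp_rdc // wu.
by move: l1; rewrite F4 R6 [in len g]E2 r2 F2 R4 R3; lia.
Qed.

Definition conj_set H g := [set x | H (g * x * g^-1)].

Lemma conj_subgroup H g : is_subgroup H -> is_subgroup (conj_set H g).
Proof.
move=> sH; apply: mk_subgroup => [|x y Hx Hy|x Hx]; rewrite /conj_set /=.
- by rewrite gmulg1 gmulgV; exact: subg1.
- by have := subgM sH Hx Hy; rewrite !gmulA gmulgVK.
- by have := subgV sH Hx; rewrite !ginvM ginvK gmulA.
Qed.

(** Thinness costs [len g] on either side. For nearness, [near_prefix_mul] gives [D + len g], and
    two more [len g] come from the conjugating [g^-1] and from the part [x2] of [g^-1] that commutes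
    past [y1]. *)
Lemma good_conj H g : good H -> good (conj_set H g).
Proof.
move=> [sH [D gH]]; split; first exact: conj_subgroup.
exists (D + 3 * len g)%N => x Hx; have [T _] := gH _ Hx; split.
  have := thin_mul (g := g) T; rewrite gmulgVK => /thinV T1.
  have := thin_mul (g := g) T1; rewrite ginvM gmulgVK => /thinV; rewrite ginvK.
  by apply: thin_le; lia.
move=> p q Ex pq.
have [f1 [r [w' [E1 E2 r1 r2 r3]]]] := cancel_ex g^-1 (g * x).
have Ew : f1 * w' = p * q.
  by rewrite -Ex -[x](gmulKg g) E1 E2 gmulA gmulgK.
have [x1 [x2 [y1 [y2 [[F1 F2 F3 F4] [R1 R2 R3 R4 O]]]]]] := levi r3 pq Ew.
have [k Hk lk] : near (D + len g) H (r^-1 * y1).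
  have := r2; rewrite F2 => /(rdc3r R2)[rr1 rr2].
  apply: (@near_prefix_mul _ H D _ g (r^-1 * y1) y2) => // [p' q' Hpq r'|].
    by have [_] := gH _ Hpq; apply.
  by rewrite -[_ * y1 * y2]gmulA -F2 -E2; exact: Hx.
exists (g^-1 * k * g); first by rewrite /conj_set /= !gmulA gmulgV gmul1g gmulgK.
have -> : (g^-1 * k * g)^-1 * p = g^-1 * (k^-1 * (r^-1 * y1)) * x2^-1.
  have C := commute_orth O.
  have Ep : g * p = r^-1 * y1 * x2^-1.
    have -> : g = r^-1 * f1^-1 by rewrite -ginvM -E1 ginvK.
    have -> : p = f1 * y1 * x2^-1 by rewrite F3 F1 -[x1 * x2 * y1]gmulA C !gmulA gmulgK.
    by rewrite -!gmulA gmulKg.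
  by rewrite !ginvM ginvK -!gmulA Ep !gmulA.
have lx2 : len x2 <= len g by rewrite -(lenV g) E1 r1 F1 R1; lia.
have := len_mul (g^-1 * (k^-1 * (r^-1 * y1))) x2^-1; have := len_mul g^-1 (k^-1 * (r^-1 * y1)).
by rewrite !lenV; lia.
Qed.

(* A walk that leaves the thin geodesic [y] between [q] and its endpoint has to
   cross [y] within one of its steps, as soon as this step skips more than [D]
   letters of [y]. *)
Lemma polygon D B y (bs : seq A) q u v c : thin D y -> y = u * v -> rdc u v ->
  q = u * c -> rdc u c -> (D * size bs + B < len u)%N ->
  (forall a1 a2 c', y = a1 * a2 -> rdc a1 a2 -> q * prodl bs = a1 * c' -> rdc a1 c' ->
    len a1 <= B) ->
  exists bs1 b bs2 (b1 b2 a1 a2 : A), [/\ bs = bs1 ++ b :: bs2, b = b1 * b2 & rdc b1 b2] /\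
    [/\ q * prodl bs1 * b1 = a1, y = a1 * a2 & rdc a1 a2].
Proof.
move=> Ty; elim: bs q u v c => [|b bs IH] q u v c Ey uv Eq uc lu hend.
  have := hend u v c Ey uv; rewrite /= gmulg1 => /(_ Eq uc); lia.
have [a' [r [b' [E1 E2 r1 r2 r3]]]] := cancel_ex (q * b) b^-1.
have Eab : a' * b' = u * c.
  by rewrite -Eq -[q](gmulgK b) E2 E1 gmulA gmulgK.
have [a1 [a2 [b1 [b2 [[F1 F2 F3 F4] [R1 R2 R3 R4 O]]]]]] := levi r3 uc Eab.
move: (uv); rewrite F3 => /(rdc3l R3)[b1v a1b1v].
have Ey' : y = a1 * (b1 * v) by rewrite Ey F3 !gmulA.
have [lb1|lb1] := leqP (len b1) D; last first.
  have a21 : a2 = 1.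
    apply: contrapT => a2n; move: lb1; rewrite ltnNge => /negP; apply.
    apply: thin_orth O a2n; apply: (@thin_factor _ _ a1 b1 v) => //; rewrite -F3 -?Ey //.
  exists [::], b, bs, b'^-1, r, a1, (b1 * v); split; split=> //.
  - by rewrite -[b]ginvK E2 ginvM ginvK.
  - by rewrite -[r]ginvK; exact: rdcV.
  - by rewrite /= gmulg1 Eq -Eab gmulgK F1 a21 gmulg1.
move: r1; rewrite F1 => /(rdc3l R1)[a2r a1a2r].
have [||x y' z Ey2 xy E|bs1 [d [bs2 [d1 [d2 [x1 [x2 [[G1 G2 G3] [H1 H2 H3]]]]]]]]] :=
  IH (q * b) a1 (b1 * v) (a2 * r) Ey' a1b1v _ a1a2r.
- by rewrite E1 F1 gmulA.
- by move: lu; rewrite F3 R3 /=; lia.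
- by apply: (hend x y' z) => //; rewrite /= gmulA.
exists (b :: bs1), d, bs2, d1, d2, x1, x2; split; split=> //; first by rewrite G1.
by rewrite /= gmulA.
Qed.

Section Avoid.
Context (D C K E T : nat) (G1 G2 M : set A) (l : seq (set A)) (g : A).
Hypothesis sG1 : is_subgroup G1.
Hypothesis sG2 : is_subgroup G2.
Hypothesis sM : is_subgroup M.
Hypothesis sl : forall H, H \in l -> is_subgroup H.
Hypothesis gG1 : good_with D G1.
Hypothesis gG2 : good_with D G2.
Hypothesis gl : forall H, H \in l -> good_with D H.
Hypothesis IM : G1 `&` G2 `<=` M.
Hypothesis short : forall x, M x -> G1 x \/ G2 x -> len x < C -> G1 x /\ G2 x.
(** [T] exceeds what [polygon] can lose along a side: [D] letters for each factor in [l], and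
    [D + len g] at the end point. [C] leaves more than [3 * D + T] letters of an inner factor after
    a loss of [K] at both ends. [E] bounds the element [y0] of [avoid]. *)
Hypothesis KE : K = size (word_ball2 Gr D).
Hypothesis TE : T = (D * size l + D + len g).+1.
Hypothesis CE : (2 * K + 3 * D + T < C)%N.
Hypothesis EE : (K + T + D <= E)%N.

(** By [blocks], a prefix is within [2 * D] of a partial product ending in a prefix of one factor;
    that prefix is [D]-near the group of its factor, and this group is within [R1] or [R2] of its
    intersection with [M]. *)
Lemma good_gen : finite_index M -> good (gen G1 G2 M).
Proof.
move=> fM; split; first exact: gen_subgroup.
have [R1 hR1] := subgroup_reps_near sG1 sM fM; have [R2 hR2] := subgroup_reps_near sG2 sM fM.
exists (3 * D + R1 + R2)%N => x [s0 ms0 Ex].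
have [||a [s [b [[Ga Ma] ms [Gb Mb] E1]]]] := minimal_factorization sG1 sG2 sM
  (is_subgroupI sG1 sM) (is_subgroupI sG2 sM) gG1 gG2 (@subIsetl _ _ _) (@subIsetl _ _ _)
  (@subset_refl _ _) (@subset_refl _ _) IM short (a0 := 1) (b0 := 1) _ ms0 _.
- by split; exact: subg1.
- by split; exact: subg1.
rewrite -KE -Ex gmul1g gmulg1 in E1 * => ch.
have mL c : c \in a :: s ++ [:: b] -> mid G1 G2 M c.
  rewrite inE mem_cat inE => /or3P[/eqP ->|/ms //|/eqP ->].
    by split=> //; left.
  by split=> //; right.
have TL c : c \in a :: s ++ [:: b] -> thin D c.
  by move=> /mL[_ [/gG1|/gG2] []].
have [|||||m [r [z [_ _ _ _ [F1 F2 F3 F4 _]]]]] := blocks (p := 1) (x := a) _ TL ch.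
- by lia.
- by rewrite gmul1g.
- exact: rdc1g.
- by rewrite len1.
- by left.
rewrite ginv1 gmul1g /= prodl_cat /= gmulg1 gmulA E1 in F1.
split; first by rewrite -F1; apply: thin_le F3; lia.
move=> p q Epq pq; rewrite -F1 in Epq.
have [s1 [c [s2 [t [t' [H1 H2 H3 H4]]]]]] := F4 p q Epq pq.
rewrite gmul1g in H4.
have mc : mid G1 G2 M c by apply: mL; rewrite H1 mem_cat inE eqxx orbT.
have [k [k' [Gk' Mk' lk lk']]] : exists k k', [/\ G1 k' \/ G2 k', M k', len (k^-1 * t) <= D &
    len (k'^-1 * k) <= R1 + R2].
  have [_ [Gc|Gc]] := mc.
    have [_ /(_ _ _ H2 H3)[k Gk lk]] := gG1 Gc; have [k' [? ? ?]] := hR1 k Gk.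
    by exists k, k'; split=> //; [left|lia].
  have [_ /(_ _ _ H2 H3)[k Gk lk]] := gG2 Gc; have [k' [? ? ?]] := hR2 k Gk.
  by exists k, k'; split=> //; [right|lia].
exists (prodl s1 * k').
  apply: subgM; first exact: gen_subgroup.
    by exists s1 => // d ds; apply: mL; rewrite H1 mem_cat ds.
  by apply: mid_gen; split.
have -> : (prodl s1 * k')^-1 * p = (k'^-1 * k) * ((k^-1 * t) * ((prodl s1 * t)^-1 * p)).
  by rewrite !ginvM -!gmulA !gmulVKg.
have := len_mul (k'^-1 * k) ((k^-1 * t) * ((prodl s1 * t)^-1 * p)).
have := len_mul (k^-1 * t) ((prodl s1 * t)^-1 * p); lia.
Qed.

Hypothesis sep : forall l1 H l2 x y, l = l1 ++ H :: l2 -> M x -> len y <= E ->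
  pset (G2 :: l1 ++ [:: H]) (x^-1 * y) -> pset (G2 :: l1 ++ [:: H]) y.

(** In a minimal factorization of [g] some inner factor survives, since otherwise [g] lies in the
    product. It provides a thin side [y] of length [T]. By [polygon] a factor [d] in some [H] of [l]
    passes through [y], close to the end of [a1]. Going from there to a nearby corner of [H] yields
    the short element [y0] to which [sep] applies, and the inner factors can be discarded. *)
Lemma avoid a k w : ~ pset [:: G1, G2 & l] g -> G1 a -> gen G1 G2 M k -> pset (G2 :: l) w ->
  g <> a * k * w.
Proof.
move=> ng Ga0 [s0 ms0 ->] [[|b0 bs]] // [Gb0 hbs] -> Eg.
have [a1 [s [b [Ga ms Gb E1]]]] := minimal_factorization sG1 sG2 sM
  sG1 sG2 gG1 gG2 (@subset_refl _ _) (@subset_refl _ _) (@subIsetl _ _ _) (@subIsetl _ _ _)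
  IM short Ga0 ms0 Gb0.
rewrite -KE => ch.
have {}Eg : g = a1 * prodl s * b * prodl bs by rewrite E1 Eg /= !gmulA.
have [s_nil|s_n] := eqVneq s [::].
  by apply: ng; exists [:: a1, b & bs] => //; rewrite Eg s_nil /= gmulg1 !gmulA.
have TL c : c \in a1 :: s ++ [:: b] -> thin D c.
  rewrite inE mem_cat inE => /or3P[/eqP ->|/ms[_ [/gG1|/gG2] []]|/eqP ->] //.
    by have [] := gG1 Ga.
  by have [] := gG2 Gb.
have [|||||m [r [z [F0 mr lr _ [F1 mz _ _]]]]] := blocks (p := 1) (x := a1) _ TL ch.
- by lia.
- by rewrite gmul1g.
- exact: rdc1g.
- by rewrite len1.
- by left.
case; first by rewrite size_cat addn1 ltnS lt0n size_eq0.
move=> m1 [z1 [Ez m1z Tm1 lm1]].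
rewrite ginv1 gmul1g /= prodl_cat /= gmulg1 !gmulA in F1.
have lT : T <= len m1 by lia.
have [lp _] := len_pref_suf lT; have pr := pref_rdc m1 T.
set y := pref m1 T in lp pr.
have Em1 : m1 = y * suf m1 T by rewrite prefK.
have Ty : thin D y by apply: (thin_l pr); rewrite -Em1.
have [_ yz] : [/\ rdc (suf m1 T) z1 & rdc y (suf m1 T * z1)] by apply: rdc3l; rewrite // -Em1.
have Ez' : z = y * (suf m1 T * z1) by rewrite Ez {1}Em1 gmulA.
have [my _] : [/\ rdc m y & rdc (m * y) (suf m1 T * z1)] by apply: rdc3r; rewrite // -Ez'.
have zbs : m * (z * prodl bs) = g by rewrite gmulA F1 Eg.
have [|||bs1 [d [bs2 [d1 [d2 [a' [a2 [[H1 H2 H3] [H4 H5 H6]]]]]]]]] :=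
  @polygon D (D + len g)%N y bs z y 1 (suf m1 T * z1) Ty _ (rdcg1 y) Ez' yz.
- by rewrite gmulg1.
- by rewrite lp TE (members_size hbs); lia.
(* If [x] is longer than [D], then [m * (x * c')] is reduced by [thin_glue]; as this product is [g],
   [x] has length at most [len g]. *)
- move=> x x' c' Ex rx E2 rc; have [lx|lx] := leqP (len x) D; first by lia.
  have mx : rdc m x by move: my; rewrite Ex => /(rdc3r rx)[].
  have Tx : thin D x by apply: (thin_l rx); rewrite -Ex.
  have := thin_glue Tx lx mx rc; rewrite /rdc -E2 zbs E2 rc; lia.
move: hbs; rewrite H1 => /members_catl[l1 [[|H l2] [El hb1]]] //= [Hd hb2].
have Hl : H \in l by rewrite El mem_cat inE eqxx orbT.
have [_ nd] := gl Hl Hd; have [h Hh lh] := nd _ _ H2 H3.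
have rE : m^-1 * a1 = r by rewrite -[a1]gmul1g F0 gmul1g gmulKg.
(* [r^-1] leads from the end of [a1] back to [m], [a'] runs along [y] to the crossing, and
   [d1^-1 * h] jumps to a point of the coset of [H] carrying the side [d]. *)
pose y0 := r^-1 * a' * (d1^-1 * h).
have ly0 : len y0 <= E.
  have la' : len a' <= T by rewrite -lp H5 H6; lia.
  have lh' : len (d1^-1 * h) <= D by rewrite -lenV ginvM ginvK.
  have := len_mul (r^-1 * a') (d1^-1 * h); have := len_mul r^-1 a'.
  by rewrite lenV -/y0; lia.
have Ey0 : a1 * y0 = m * z * prodl bs1 * h.
  by rewrite /y0 -rE -H4 ginvM ginvK !gmulA gmulgV gmul1g gmulgK.
have Ey1 : (prodl s)^-1 * y0 = prodl (b :: bs1 ++ [:: h]).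
  apply: (@gmulI _ (a1 * prodl s)); rewrite -gmulA gmulVKg Ey0 F1 /= prodl_cat /= gmulg1.
  by rewrite !gmulA.
have Ms : M (prodl s).
  elim: (s) ms => [|c s' IH] ms' /=; first exact: subg1.
  apply: subgM => //; first by have [] := ms' c (mem_head _ _).
  by apply: IH => d' ds; apply: ms'; rewrite inE ds orbT.
have [] := sep El Ms ly0.
  by exists (b :: bs1 ++ [:: h]) => //; split=> //; apply: members_cat.
case=> [|c cs] //= [Gc /members_catr[cs1 [[|h' [|? ?]] [Ecs hcs1]]]] //= [Hh' hn] Ey2 //.
apply: ng; exists ([:: a1, c & cs1 ++ (h' * (h^-1 * d)) :: bs2]).
  split=> //; split=> //; rewrite El; apply: members_cat => //; split=> //.
  have sH := sl Hl; apply: subgM => //; apply: subgM => //; exact: subgV.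
have -> : g = a1 * y0 * h^-1 * d * prodl bs2.
  by rewrite Ey0 gmulgK Eg H1 prodl_cat /= -F1 !gmulA.
by rewrite Ey2 Ecs /= !prodl_cat /= gmulg1 !gmulA.
Qed.

End Avoid.

End Products.

(** * Products of good subgroups *)

Section NormalFinite.
Context (G : groupType).
Implicit Types (M N X : set G) (x y g : G).

Lemma normal_finiteT : normal_finite [set: G].
Proof. by split=> //; [exact: is_subgroupT|exact: finite_indexT]. Qed.

Lemma normal_finiteI M N : normal_finite M -> normal_finite N -> normal_finite (M `&` N).
Proof.
move=> [sM fM nM] [sN fN nN]; split; [exact: is_subgroupI|exact: finite_indexI|].
by move=> x g [Mx Nx]; split; [exact: nM|exact: nN].
Qed.

Lemma finite_index_sub M N : is_subgroup M -> is_subgroup N -> N `<=` M ->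
  finite_index N -> finite_index M.
Proof.
move=> sM sN NM /(finite_indexP sN)[l hl]; apply/finite_indexP => //; exists l => g.
by have [f fl /NM Mf] := hl g; exists f.
Qed.

Lemma normal_finite_all (T : eqType) (l : seq T) (P : T -> set G -> Prop) :
  (forall t M N, P t N -> M `<=` N -> P t M) ->
  (forall t, t \in l -> exists2 N, normal_finite N & P t N) ->
  exists2 N, normal_finite N & forall t, t \in l -> P t N.
Proof.
move=> mono; elim: l => [|t l IH] h; first by exists setT => //; exact: normal_finiteT.
have [N nN PN] := h t (mem_head _ _).
have [|M nM PM] := IH; first by move=> u ul; apply: h; rewrite inE ul orbT.
exists (N `&` M); first exact: normal_finiteI.
move=> u; rewrite inE => /orP[/eqP ->|/PM PuM].
  by apply: mono PN _ => x [].
by apply: mono PuM _ => x [].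
Qed.

Lemma separated_by_sub X g M N : separated_by N X g -> M `<=` N -> separated_by M X g.
Proof. by move=> sep MN x /MN; exact: sep. Qed.

Lemma separableI X Y : separable X -> separable Y -> separable (X `&` Y).
Proof. exact: closedI. Qed.

End NormalFinite.

Section GoodProducts.
Context (Gr : sgraph).
Local Notation e := (edge Gr).
Local Notation A := (raag e).
Local Notation len := (@len Gr).
Local Notation rdc := (@rdc Gr).
Implicit Types (a b c d g h k m p q r u x y z : A) (s t : seq A) (G H M N X : set A)
  (l : seq (set A)).

Lemma good_common l : (forall H, H \in l -> good H) ->
  exists D, forall H, H \in l -> good_with D H.
Proof.
elim: l => [|H l IH] h; first by exists 0.
have [_ [D1 g1]] := h H (mem_head _ _).
have [|D2 g2] := IH; first by move=> K Kl; apply: h; rewrite inE Kl orbT.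
exists (D1 + D2) => K; rewrite inE => /orP[/eqP ->|/g2 gK].
  exact: good_with_le (leq_addr _ _) g1.
exact: good_with_le (leq_addl _ _) gK.
Qed.

Lemma good_separable H : good H -> separable H.
Proof.
move=> [sH [D gH]]; apply: (quasiconvex_separable (D := D)) => // p q Hpq pq.
by have [_ nd] := gH _ Hpq; exact: nd.
Qed.

Lemma pset0 : pset [::] = [set 1 : A].
Proof.
apply/seteqP; split=> x /=; first by case=> -[].
by move=> ->; exists [::].
Qed.

Lemma pset1 H : pset [:: H] = H.
Proof.
apply/seteqP; split=> x /=.
  by case=> -[|b [|? ?]] //= [Hb hn] -> //=; rewrite /prodl /= gmulg1.
by move=> Hx; exists [:: x] => //=; rewrite gmulg1.
Qed.

Lemma pset_cons H l x : pset (H :: l) x <-> exists h y, [/\ H h, pset l y & x = h * y].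
Proof.
split=> [[[|h s] //= [Hh hs] ->]|[h [y [Hh [s hs ->] ->]]]].
  by exists h, (prodl s); split=> //; exists s.
by exists (h :: s).
Qed.

(* The witness is [I N] with [I] the intersection of [G1] and [G2] and [N] a
   deep normal subgroup of finite index. *)
Lemma deep_subgroup (C E : nat) G1 G2 l : is_subgroup G1 -> is_subgroup G2 ->
  separable (G1 `&` G2) ->
  (forall l1 H l2, l = l1 ++ H :: l2 -> separable (pset (G2 :: l1 ++ [:: H]))) ->
  exists M, [/\ is_subgroup M, finite_index M, G1 `&` G2 `<=` M,
    forall x, M x -> G1 x \/ G2 x -> len x < C -> G1 x /\ G2 x &
    forall l1 H l2 x y, l = l1 ++ H :: l2 -> M x -> len y <= E ->
      pset (G2 :: l1 ++ [:: H]) (x^-1 * y) -> pset (G2 :: l1 ++ [:: H]) y].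
Proof.
move=> s1 s2 sepI sepX; set I := G1 `&` G2 in sepI *.
have sI : is_subgroup I by exact: is_subgroupI.
(* [N1] separates [I] from the elements of length at most [C] outside it, which rules out short
   elements of [M] outside [I]. *)
have [||N1 nN1 P1] := @normal_finite_all A _ (word_ball Gr C) (fun y N => ~ I y -> separated_by N I y).
- by move=> y M N P MN /P h; exact: separated_by_sub h MN.
- move=> y _; case: (pselect (I y)) => [It|/((separableP I).1 sepI)[N nN sep]].
    by exists setT => //; exact: normal_finiteT.
  by exists N.
pose X j := pset (G2 :: take j.+1 l).
have XE l1 H l2 : l = l1 ++ H :: l2 -> X (size l1) = pset (G2 :: l1 ++ [:: H]).
  by move=> El; rewrite /X El take_cat ltnNge leqnSn /= subSn // subnn /= take0.
have sX j : j < size l -> separable (X j).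
  move=> jl; have El : l = take j l ++ nth set0 l j :: drop j.+1 l.
    by rewrite -cat_rcons -take_nth // cat_take_drop.
  have := sepX _ _ _ El; rewrite -(XE _ _ _ El) size_takel //; exact: ltnW.
(* [N2] does the same for the finitely many prefix products [X j] and all elements of length at most
   [E]. *)
have [||N2 nN2 P2] := @normal_finite_all A _ [seq (j, y) | j <- iota 0 (size l), y <- word_ball Gr E]
    (fun jt N => ~ X jt.1 jt.2 -> separated_by N (X jt.1) jt.2).
- by move=> y M N P MN /P h; exact: separated_by_sub h MN.
- move=> _ /allpairsP[[j y] /= [jl _ ->]] /=; rewrite mem_iota in jl.
  case: (pselect (X j y)) => [It|/((separableP _).1 (sX j jl))[N nN sep]].
    by exists setT => //; exact: normal_finiteT.
  by exists N.
have [sN fN nN] := normal_finiteI nN1 nN2; set N := N1 `&` N2 in sN fN nN.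
pose M := [set x | exists2 i, I i & N (i^-1 * x)].
have sM : is_subgroup M.
  apply: mk_subgroup => [|x y [i Ii Nx] [j Ij Ny]|x [i Ii Nx]].
  - by exists 1; [exact: subg1|rewrite gmulg1 ginv1; exact: subg1].
  - exists (i * j); first exact: subgM.
    have -> : (i * j)^-1 * (x * y) = (j^-1 * (i^-1 * x) * j) * (j^-1 * y).
      by rewrite ginvM !gmulA gmulgK.
    by apply: subgM => //; exact: nN.
  - exists i^-1; first exact: subgV.
    have -> : i^-1^-1 * x^-1 = (i^-1)^-1 * (i^-1 * x)^-1 * i^-1.
      by rewrite !ginvK ginvM ginvK !gmulA gmulgK.
    by apply: nN; exact: subgV.
exists M; split=> //.
- apply: (finite_index_sub sM sN _ fN) => x Nx; exists 1; first exact: subg1.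
  by rewrite ginv1 gmul1g.
- by move=> i Ii; exists i => //; rewrite gmulVg; exact: subg1.
- move=> x [i Ii [N1x _]] _ lx; apply: contrapT => nI.
  have := P1 x (word_ball_mem (ltnW lx)) nI i; apply=> //.
  have [sN1 _ _] := nN1; have := subgV sN1 N1x; by rewrite ginvM ginvK.
- move=> l1 H l2 x y El [i Ii [_ N2x]] ly; rewrite -(XE _ _ _ El) => Xxy.
  apply: contrapT => nX.
  have jt : (size l1, y) \in [seq (j, y) | j <- iota 0 (size l), y <- word_ball Gr E].
    apply/allpairsP; exists (size l1, y); split=> //=; last exact: word_ball_mem.
    by rewrite mem_iota El size_cat /= addnS ltnS leq_addr.
  apply: (P2 _ jt nX (i * (x^-1 * y))) => /=.
    have -> : y^-1 * (i * (x^-1 * y)) = (x^-1 * y)^-1 * (i^-1 * x)^-1 * (x^-1 * y).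
      by rewrite !ginvM !ginvK !gmulA gmulgK.
    by have [sN2 _ nrm] := nN2; apply: nrm; exact: (subgV sN2 N2x).
  have /pset_cons[h [w [Gh Pw ->]]] := Xxy; apply/pset_cons; exists (i * h), w.
  by rewrite gmulA; split=> //; apply: subgM => //; case: Ii.
Qed.

Lemma good_product_separable l : (forall H, H \in l -> good H) -> separable (pset l).
Proof.
have [n] := ubnP (size l); elim: n l => // n IH [|G1 [|G2 l]] ln gl.
- rewrite pset0; apply: (quasiconvex_separable (D := 0)).
    by apply: mk_subgroup => [|x y -> ->|x ->] //=; rewrite ?gmulg1 ?ginv1.
  move=> p q /= E pq; exists 1 => //; rewrite ginv1 gmul1g.
  by move: pq; rewrite /rdc E len1; lia.
- by rewrite pset1; apply: good_separable; apply: gl; rewrite mem_head.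
apply/separableP => g ng.
have [D gD] := good_common gl.
have [g1 g2] : good_with D G1 /\ good_with D G2 by split; apply: gD; rewrite !inE eqxx ?orbT.
have [s1 s2] : is_subgroup G1 /\ is_subgroup G2.
  by split; apply: (gl _ _).1; rewrite !inE eqxx ?orbT.
have lG H : H \in l -> H \in [:: G1, G2 & l] by rewrite !inE => ->; rewrite !orbT.
pose K := size (word_ball2 Gr D); pose T := (D * size l + D + len g).+1.
pose C := (2 * K + 3 * D + T).+1; pose E := (K + T + D)%N.
have [||M [sM fM IM short sep]] := @deep_subgroup C E G1 G2 l s1 s2.
- by apply: separableI; apply: good_separable; apply: gl; rewrite !inE eqxx ?orbT.
- move=> l1 H l2 El; apply: IH.
    by move: ln; rewrite El /= !size_cat /=; lia.
  move=> H'; rewrite inE mem_cat inE => HH; apply: gl; rewrite El !inE mem_cat inE.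
  by case/or3P: HH => ->; rewrite ?orbT.
have sl H (Hl : H \in l) : is_subgroup H := (gl _ (lG H Hl)).1.
have gDl H (Hl : H \in l) : good_with D H := gD _ (lG H Hl).
have av := @avoid Gr D C K E T G1 G2 M l g s1 s2 sM sl g1 g2 gDl IM short erefl erefl
  (ltnSn _) (leqnn _) sep.
have gg : good (gen G1 G2 M).
  by apply: (@good_gen Gr D C K E T G1 G2 M l g).
have [r1 [hr1 cov1]] := subgroup_reps s1 sM fM.
have [r2 [hr2 cov2]] := subgroup_reps s2 sM fM.
have sep2 y2 : separable (pset (conj_set (gen G1 G2 M) y2 :: l)).
  apply: IH; first by move: ln => /=; lia.
  move=> H; rewrite inE => /orP[/eqP ->|Hl]; first exact: good_conj.
  exact: gl (lG _ Hl).
(* With [K] for [gen G1 G2 M], elements of [G1] and [G2] have the form [y1 * k1] and [k2 * y2^-1]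
   with [k1], [k2] in [K]. So the product lies in the union of the translates by [y1 * y2^-1] of
   [(y2 K y2^-1) l], which has one factor less. *)
have [||N nN PN] := @normal_finite_all A _ [seq (y1, y2) | y1 <- r1, y2 <- r2]
    (fun yy N => separated_by N (pset (conj_set (gen G1 G2 M) yy.2^-1 :: l)) (yy.2 * yy.1^-1 * g)).
- by move=> t M' N' sp MN; exact: separated_by_sub sp MN.
- move=> _ /allpairsP[[y1 y2] /= [y1r y2r ->]] /=.
  have [|N nN sepN] := (separableP _).1 (sep2 y2^-1) (y2 * y1^-1 * g); last by exists N.
  move/pset_cons => [h [w [Hh Pw E1]]].
  move: Hh; rewrite /conj_set /= ginvK => Hh.
  have E2 : g = y1 * (y2^-1 * h * y2) * (y2^-1 * w).
    rewrite !gmulA gmulgK -[_ * h * w]gmulA -E1 !gmulA gmulgVK gmulgV gmul1g.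
    by [].
  apply: (av _ _ _ ng _ _ _ E2) => //; first exact: hr1.
  by apply/pset_cons; exists y2^-1, w; split=> //; apply: subgV => //; exact: hr2.
exists N => // x Nx /pset_cons[a [w' [Ga /pset_cons[b [w [Gb Pw ->]]] Ex]]].
have [y1 y1r M1] := cov1 _ (subgV s1 Ga); have [y2 y2r M2] := cov2 _ Gb.
have yy : (y1, y2) \in [seq (y1, y2) | y1 <- r1, y2 <- r2].
  by apply/allpairsP; exists (y1, y2).
apply: (PN _ yy (y2 * y1^-1 * x)) => /=.
  by rewrite !ginvM !ginvK !gmulA gmulgVK gmulgK.
apply/pset_cons; exists (y2 * ((a^-1 * y1)^-1 * (b * y2)) * y2^-1), w; split=> //.
  rewrite /conj_set /= !ginvK !gmulA gmulVg gmul1g gmulgVK -gmulA.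
  apply: subgM; first exact: gen_subgroup.
    apply: mid_gen; split; first exact: subgV.
    by left; apply: subgV => //; apply: subgM; [|exact: subgV|exact: hr1].
  by apply: mid_gen; split=> //; right; apply: subgM => //; exact: hr2.
by rewrite Ex !ginvM !ginvK !gmulA gmulgK.
Qed.

End GoodProducts.

(** * The Cayley graph *)

Section CayleyDistance.
Context (R : realType) (Gr : sgraph).
Local Notation V := (vert Gr).
Local Notation e := (edge Gr).
Local Notation A := (raag e).
Local Notation len := (@len Gr).
Local Notation letter := (@letter Gr).
Context (S : fin_gen_set A).
Implicit Types (g h k : A) (w : word V).
Import Order.TTheory GRing.Theory Num.Theory.
Local Open Scope ring_scope.

Local Notation dist := (@cayley_dist R A S).
Local Notation vx := (vertex R S).

Lemma vertexE g k : vx g k = (k == g)%:R.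
Proof. by rewrite /= /edge_point subr0 mul1r mul0r addr0. Qed.

Lemma dist_letter_bound k : exists c : nat, forall g, dist (vx g) (vx (g * k)%g) <= c%:R.
Proof.
pose M := [set k | exists c : nat, forall g, dist (vx g) (vx (g * k)%g) <= c%:R].
suff : [set: A] `<=` M by move=> /(_ k I).
rewrite -(gens_spec S) => x; apply; split.
  apply: mk_subgroup => [|y z [c hc] [d hd]|y [c hc]].
  - by exists 0%N => g; rewrite gmulg1 cayley_distxx.
  - exists (c + d)%N => g; rewrite natrD gmulA.
    exact: le_trans (cayley_dist_triangle _ _ _) (lerD (hc _) (hd _)).
  - by exists c => g; rewrite cayley_dist_sym; have := hc (g * y^-1)%g; rewrite gmulgVK.
move=> s Ss; exists 1%N => g; 
have ad : cayley_adj S g (g * s)%g by left; rewrite mulKg.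
have := chain_cons ad (vertex_edgel R S g (g * s)%g) (vertex_edger R S g (g * s)%g)
  (chain_nil (vx (g * s)%g)).
rewrite !vertexE eqxx addr0 => /cayley_dist_le/le_trans; apply.
by case: eqP => _; rewrite ?subrr ?subr0 ?normr0 ?normr1 ?ler01.
Qed.

Lemma edge_supp g h (x : cayley R S) k : closed_edge g h x -> 0 < x k -> k = g \/ k = h.
Proof.
move=> [t _ <-]; rewrite /edge_point; have [->|_] := eqVneq k g; first by left.
by have [->|_] := eqVneq k h; [right|rewrite !mulr0 addr0 ltxx].
Qed.

Lemma bary_ge0 (x : cayley R S) k : 0 <= x k.
Proof.
have [g [h [_ [t /=]]]] := baryP x; rewrite in_itv /= => /andP[t0 t1] <-.
by rewrite /edge_point addr_ge0 // mulr_ge0 ?ler0n // subr_ge0.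
Qed.

Lemma edge_other g h (x : cayley R S) : closed_edge g h x -> x g <= 0 -> x h = 1.
Proof.
move=> [t /=]; rewrite in_itv /= => /andP[t0 t1] <-; rewrite /edge_point !eqxx.
have [_|_] := eqVneq g h; first by rewrite !mulr1 subrK => F; have := lt_le_trans ltr01 F; rewrite ltxx.
rewrite !mulr1 !mulr0 add0r addr0 subr_le0 => h1.
by apply/eqP; rewrite eq_le t1 h1.
Qed.

(** Chains pass through interior points of edges, so the bound is stated for every vertex [k] in the
    support of [x]; [1 - x k] is the distance from [x] to [k] along its edge. Where the coordinate
    at [k] drops to 0, the segment has length at least [x k], which pays for the change of
    vertex. *)
Lemma chain_len (C : nat) : (forall s, gens S s -> (len s <= C)%N) ->
  forall x z l, chain_length x z l -> forall h, z = vx h -> forall k, 0 < x k ->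
  (len (k^-1 * h)%g)%:R <= C%:R * (l + (1 - x k)).
Proof.
move=> hC x z l; elim=> [{}x h -> k|{}x y {}z g h {}l ad xe ye _ IH z0 Ez k xk].
  rewrite vertexE; have [->|_] := eqVneq k h; last by rewrite ltxx.
  by rewrite gmulVg len1 subrr add0r mulr0.
have C0 : 0 <= C%:R :> R by rewrite ler0n.
have lip := segment_lip k xe ye.
have lad : (len (g^-1 * h)%g <= C)%N /\ (len (h^-1 * g)%g <= C)%N.
  have E : len (h^-1 * g)%g = len (g^-1 * h)%g by rewrite -lenV ginvM ginvK.
  by case: ad => /hC; rewrite E.
have [yk|yk] := ltP 0 (y k).
  apply: le_trans (IH z0 Ez k yk) _; apply: ler_wpM2l => //.
  have := ler_norm (x k - y k); lra.
have other k2 : y k2 = 1 -> (len (k^-1 * k2)%g <= C)%N ->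
    (len (k^-1 * z0)%g)%:R <= C%:R * (`|x g - y g| + l + (1 - x k)).
  move=> y1 lk; have := IH z0 Ez k2; rewrite y1 ltr01 subrr addr0 => /(_ isT) h1.
  have : (len (k^-1 * z0)%g <= len (k^-1 * k2)%g + len (k2^-1 * z0)%g)%N.
    by have := len_mul (k^-1 * k2)%g (k2^-1 * z0)%g; rewrite -gmulA gmulVKg.
  rewrite -(ler_nat R) natrD => h2.
  have h3 : (len (k^-1 * k2)%g)%:R <= C%:R :> R by rewrite ler_nat.
  have yk0 := bary_ge0 y k.
  have h4 : x k <= `|x g - y g| by have := ler_norm (x k - y k); lra.
  apply: le_trans h2 _; apply: le_trans (lerD h3 h1) _.
  rewrite -{1}[C%:R]mulr1 -mulrDr; apply: ler_wpM2l => //; lra.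
case: (edge_supp xe xk) => E; subst k.
  by apply: (other h); [exact: edge_other ye yk|case: lad].
by apply: (other g); [apply: (@edge_other h g) => //; rewrite closed_edgeC|case: lad].
Qed.

Lemma len_le_dist : exists C : nat, forall g h,
  (len (g^-1 * h)%g)%:R <= C%:R * dist (vx g) (vx h).
Proof.
have /finite_seqP[s Es] := gens_finite S.
pose C := (\max_(k <- s) len k).+1; exists C => g h.
have C0 : 0 < C%:R :> R by rewrite ltr0n.
rewrite mulrC -ler_pdivrMr //; apply: cayley_dist_ge => l ch.
rewrite ler_pdivrMr // mulrC.
have := @chain_len C _ _ _ _ ch h erefl g; rewrite vertexE eqxx subrr addr0; apply; last exact: ltr01.
move=> k; rewrite Es => /= ks; apply: leqW; exact: leq_bigmax_seq.
Qed.

Lemma dist_le_len : exists C : nat, forall g h,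
  dist (vx g) (vx h) <= C%:R * (len (g^-1 * h)%g)%:R.
Proof.
have [c hc] := choice dist_letter_bound.
pose C := (\max_(a : V * bool) c (letter a))%N; exists C.
have main n : forall g k, len k = n -> dist (vx g) (vx (g * k)%g) <= C%:R * n%:R.
  elim: n => [|n IH] g k lk; first by rewrite (len_eq0 lk) gmulg1 cayley_distxx mulr0.
  have [|a /starts_split[k' Ek r]] := @starts_ex Gr k; first by rewrite lk.
  rewrite Ek gmulA; apply: le_trans (cayley_dist_triangle (vx (g * letter a)%g) _ _) _.
  rewrite -addn1 addnC natrD mulrDr mulr1; apply: lerD; last first.
    by apply: IH; move: lk; rewrite Ek r len_letter => -[].
  by apply: le_trans (hc (letter a) g) _; rewrite ler_nat; exact: (leq_bigmax (F := fun a => c (letter a))).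
by move=> g h; have := main _ g (g^-1 * h)%g erefl; rewrite gmulVKg.
Qed.

End CayleyDistance.

(** * The Morse property in terms of words *)

Section MorseWords.
Context (R : realType) (Gr : sgraph).
Local Notation V := (vert Gr).
Local Notation e := (edge Gr).
Local Notation A := (raag e).
Local Notation len := (@len Gr).
Context (S : fin_gen_set A).
Implicit Types (g h k : A) (w : word V).

Definition qg_word (lam c : nat) w := forall x y z, w = x ++ y ++ z ->
  (size y <= lam * len (ev y) + c)%N.

Import Order.TTheory GRing.Theory Num.Theory.
Local Open Scope ring_scope.

(** A word becomes the path that jumps to its next prefix at each integer time; quasigeodesics may
    be discontinuous. Rounding changes time differences by at most 1, whence the constant [c.+1],
    while [L] combines [lam] with the comparison between [len] and the metric of [S]. *)
Lemma morse_words (H : set A) : is_subgroup H -> strongly_quasiconvex R S H ->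
  forall lam c : nat, exists m : nat, forall w, H (ev w) -> qg_word lam c w ->
  forall x z, w = x ++ z -> near m H (ev x).
Proof.
move=> sH mH lam c.
have [C1 hC1] := dist_le_len R S; have [C2 hC2] := len_le_dist R S.
pose L : R := (C1 + lam * C2).+1%:R.
have L1 : 1 <= L by rewrite ler1n.
have L0 : 0 < L by apply: lt_le_trans L1.
have c0 : 0 <= c.+1%:R :> R by rewrite ler0n.
have [m m0 hm] := mH L c.+1%:R L1 c0.
exists (Num.truncn (C2%:R * m)).+1 => w Hw qw x z Ew.
pose p i : A := ev (take i w).
pose f (t : R^o) : cayley R S := vertex R S (p (Num.truncn t)).
have pd i j : (i <= j)%N -> (j <= size w)%N ->
    (len ((p i)^-1 * p j)%g <= j - i)%N /\ (j - i <= lam * len ((p i)^-1 * p j)%g + c)%N.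
  move=> ij jw; pose y := drop i (take j w).
  have Ey : take j w = take i w ++ y by rewrite -{1}(cat_take_drop i (take j w)) take_takel.
  have sy : size y = (j - i)%N by rewrite size_drop size_takel.
  have -> : ((p i)^-1 * p j)%g = ev y by rewrite /p Ey -evM gmulKg.
  rewrite -sy; split; first exact: len_ev_le.
  by apply: (qw (take i w) y (drop j w)); rewrite catA -Ey cat_take_drop.
have pdist i j : (i <= size w)%N -> (j <= size w)%N ->
    (len ((p i)^-1 * p j)%g)%:R <= `|i%:R - j%:R| :> R /\
    `|i%:R - j%:R| <= lam%:R * (len ((p i)^-1 * p j)%g)%:R + c%:R :> R.
  move=> iw jw; wlog ij : i j iw jw / (i <= j)%N.
    move=> main; case/orP: (leq_total i j) => ij; first exact: main.
    by rewrite distrC -(lenV (_ * _)%g) ginvM ginvK; exact: main.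
  have [h1 h2] := pd i j ij jw.
  rewrite distrC ger0_norm ?subr_ge0 ?ler_nat // -natrB //.
  by rewrite -natrM -natrD !ler_nat.
have tr t : 0 <= t -> t <= (size w)%:R -> (Num.truncn t <= size w)%N /\ 
    (Num.truncn t)%:R <= t :> R /\ t < (Num.truncn t)%:R + 1 :> R.
  move=> t0 t1; have /andP[h1 h2] := truncn_itv t0.
  split; last by rewrite -natr1 in h2.
  by rewrite -(ler_nat R); exact: le_trans h1 t1.
have qf : quasigeodesic L c.+1%:R `[(0 : R), (size w)%:R] f.
  move=> s t /=; rewrite !in_itv /= => /andP[s0 s1] /andP[t0 t1].
  have [sw [si1 si2]] := tr s s0 s1; have [tw [ti1 ti2]] := tr t t0 t1.
  have [h1 h2] := pdist _ _ sw tw; have h3 := hC1 (p (Num.truncn s)) (p (Num.truncn t)).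
  have h4 := hC2 (p (Num.truncn s)) (p (Num.truncn t)).
  change (L^-1 * cayley_dist (f s) (f t) - c.+1%:R <= `|t - s| <= L * cayley_dist (f s) (f t) + c.+1%:R).
  rewrite -/(f s) -/(f t) in h3 h4.
  set d := cayley_dist _ _ in h3 h4 *; set N := (len _)%:R in h1 h2 h3 h4.
  have N0 : 0 <= N by rewrite ler0n.
  have e1 : `|(Num.truncn s)%:R - (Num.truncn t)%:R| <= `|t - s| + 1 :> R.
    by have := ler_norm (t - s); have := ler_norm (s - t); rewrite distrC => *;
      rewrite ler_norml; apply/andP; split; lra.
  have e2 : `|t - s| <= `|(Num.truncn s)%:R - (Num.truncn t)%:R| + 1 :> R.
    by have := ler_norm ((Num.truncn s)%:R - (Num.truncn t)%:R : R);
      have := ler_norm ((Num.truncn t)%:R - (Num.truncn s)%:R : R); rewrite distrC => *;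
      rewrite ler_norml; apply/andP; split; lra.
  have LE : L = C1%:R + lam%:R * C2%:R + 1 by rewrite /L -natr1 natrD natrM.
  have C10 : 0 <= C1%:R :> R by rewrite ler0n.
  have C20 : 0 <= C2%:R :> R by rewrite ler0n.
  have l0 : 0 <= lam%:R :> R by rewrite ler0n.
  have d0 : 0 <= d by apply: cayley_dist_ge => l; exact: chain_ge0.
  apply/andP; split.
    rewrite lerBlDr mulrC ler_pdivrMr //.
    apply: le_trans h3 _; rewrite mulrC; apply: ler_pM => //.
      by rewrite -natr1; have : 0 <= c%:R :> R by []; lra.
    by rewrite LE; have := mulr_ge0 l0 C20; lra.
  have h5 : lam%:R * N <= lam%:R * (C2%:R * d) by apply: ler_wpM2l.
  have h6 : lam%:R * (C2%:R * d) <= L * d.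
    by rewrite mulrA; apply: ler_wpM2r => //; rewrite LE; lra.
  by rewrite -natr1; lra.
have n0 : 0 <= (size w)%:R :> R by [].
have fa : [set vertex R S h | h in H] (f 0).
  by exists 1%g; [exact: subg1|rewrite /f truncn0 /p take0 ev_nil].
have fb : [set vertex R S h | h in H] (f (size w)%:R).
  by exists (ev w) => //; rewrite /f natrK /p take_size.
have xt : (size x)%:R \in `[(0 : R), (size w)%:R].
  by rewrite in_itv /= ler0n ler_nat Ew size_cat leq_addr.
have [h Hh lh] := hm 0 (size w)%:R f n0 qf fa fb (size x)%:R xt.
exists h => //; rewrite -lenV ginvM ginvK.
have Ex : p (size x) = ev x by rewrite /p Ew take_size_cat.
have := hC2 (ev x) h; move: lh; rewrite /f natrK Ex => lh /le_trans h1.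
have {}h1 : (len ((ev x)^-1 * h)%g)%:R <= C2%:R * m.
  by apply: h1; apply: ler_wpM2l => //; exact: lh.
by rewrite leqW // truncn_ge_nat // mulr_ge0.
Qed.

End MorseWords.

(** * Strongly quasiconvex subgroups *)

Section Factors.

Lemma cat_split (T : Type) (w1 w2 x y : seq T) : w1 ++ w2 = x ++ y ->
  (exists2 d, w1 = x ++ d & y = d ++ w2) \/ (exists2 d, x = w1 ++ d & w2 = d ++ y).
Proof.
elim: w1 x => [|a w1 IH] [|b x] /= E.
- by left; exists [::].
- by right; exists (b :: x).
- by left; exists (a :: w1).
- case: E => -> /IH[[d -> ->]|[d -> ->]]; first by left; exists d.
  by right; exists d.
Qed.

Lemma cat_factor (T : Type) (w1 w2 x y z : seq T) : w1 ++ w2 = x ++ y ++ z ->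
  [\/ exists z', w1 = x ++ y ++ z', exists x', w2 = x' ++ y ++ z |
      exists y1 y2, [/\ y = y1 ++ y2, w1 = x ++ y1 & w2 = y2 ++ z]].
Proof.
case/cat_split => [[d E1 /esym E2]|[d E1 E2]]; last by constructor 2; exists d.
case/cat_split: E2 => [[f F1 F2]|[f F1 F2]].
  by constructor 1; exists f; rewrite E1 F1.
by constructor 3; exists d, f.
Qed.

Lemma cat_factor3 (T : Type) (w1 w2 w3 x y z : seq T) : w1 ++ w2 ++ w3 = x ++ y ++ z ->
  exists y1 y2 y3, [/\ y = y1 ++ y2 ++ y3, size y1 <= size w1, size y3 <= size w3 &
    exists x' z', w2 = x' ++ y2 ++ z'].
Proof.
have two w y' z' : w ++ w3 = y' ++ z' -> exists y2 y3, [/\ y' = y2 ++ y3, size y3 <= size w3 &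
    exists z2, w = y2 ++ z2].
  case/cat_split => [[d -> _]|[d -> ->]].
    by exists y', [::]; rewrite cats0; split=> //; exists d.
  by exists w, d; rewrite size_cat leq_addr; split=> //; exists [::]; rewrite cats0.
case/cat_factor => [[z' ->]|[x' E]|[y1 [y2 [-> -> /two[y3 [y4 [-> l4 [z2 ->]]]]]]]].
- exists y, [::], [::]; rewrite !cats0 !size_cat; split=> //; first by lia.
  by exists w2, [::]; rewrite /= !cats0.
- case/cat_factor: E => [[z' ->]|[x2 ->]|[y1 [y2 [-> -> ->]]]].
  + by exists [::], y, [::]; rewrite cats0; split=> //; exists x', z'.
  + exists [::], [::], y; rewrite !size_cat; split=> //; first by lia.
    by exists w2, [::]; rewrite /= !cats0.
  + exists [::], y1, y2; rewrite size_cat leq_addr; split=> //.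
    by exists x', [::]; rewrite cats0.
- exists y1, y3, y4; rewrite size_cat leq_addl; split=> //.
  by exists [::], z2.
Qed.

End Factors.

(** * Quasigeodesic detours in the direction of a vertex *)

Section Detours.
Context (Gr : sgraph).
Local Notation V := (vert Gr).
Local Notation e := (edge Gr).
Local Notation A := (raag e).
Local Notation len := (@len Gr).
Local Notation letter := (@letter Gr).
Local Notation starts := (@starts Gr).
Local Notation supp := (@supp Gr).
Local Notation rdc := (@rdc Gr).
Local Notation orth := (@orth Gr).
Implicit Types (a b c d : V * bool) (g h k p q r u x y z : A) (s t v : V).

Lemma red_factor (x y z : word V) : red (x ++ y ++ z) -> red y.
Proof.
move=> /len_ev_red E; apply: red_len; move: E; rewrite -!evM !size_cat => E.
have := len_mul (ev x) (ev y * ev z); have := len_mul (ev y) (ev z).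
have := len_ev_le x; have := len_ev_le y; have := len_ev_le z; lia.
Qed.

Lemma red_rdc (x y : word V) : red x -> red y -> rdc (ev x) (ev y) -> red (x ++ y).
Proof. by move=> rx ry E; apply: red_len; rewrite -evM E size_cat !len_ev_red. Qed.

Lemma supp_sub g h s : s \in supp (g * h) -> (s \in supp g) || (s \in supp h).
Proof.
have [g' [r [h' [E1 E2 r1 r2 r3]]]] := cancel_ex g h.
rewrite {1}E1 {1}E2 gmulA gmulgK supp_rdc // E1 E2 !supp_rdc // => /orP[->|->] //.
by rewrite !orbT.
Qed.

Lemma starts_supp c g : starts c g -> c.1 \in supp g.
Proof. by case/starts_split => g' -> r; rewrite supp_rdc // supp_letter inE eqxx. Qed.

Lemma orth_rdc g h : orth g h -> rdc g h.
Proof.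
move=> O; have := @rdc_crit Gr g^-1 h; rewrite ginvK lenV; apply => c sg sh.
have := O c.1 c.1; rewrite e_irrefl -suppV (starts_supp sg) (starts_supp sh) => F.
by have := F isT isT.
Qed.

Definition pow c n : A := ev (nseq n c).

Lemma red_nseq c n : red (nseq n c).
Proof.
elim: n => //= n ->; rewrite andbT; case: n => //= n.
by rewrite eq_sym neg_neq e_irrefl.
Qed.

Lemma len_pow c n : len (pow c n) = n.
Proof. by rewrite /pow len_ev_red ?size_nseq // red_nseq. Qed.

Lemma supp_pow c n s : s \in supp (pow c n) -> s = c.1.
Proof.
rewrite (perm_mem (supp_red (red_nseq c n))) => /mapP[d].
by rewrite mem_nseq => /andP[_ /eqP ->].
Qed.

Lemma powD c m n : pow c (m + n) = pow c m * pow c n.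
Proof. by rewrite /pow nseqD evM. Qed.

Lemma pow1 c : pow c 1%N = letter c. Proof. by []. Qed.

Lemma powS c n : pow c n.+1 = pow c n * letter c.
Proof. by rewrite -addn1 powD. Qed.

Lemma powV c n : (pow c n)^-1 = pow (neg c) n.
Proof.
rewrite /pow evV; congr ev; rewrite /winv map_nseq.
by elim: n => //= n IH; rewrite rev_cons IH -cats1 -[[:: _]]/(nseq 1 _) -nseqD addn1.
Qed.

Lemma pow_comm c n : gcomm (letter c) (pow c n).
Proof. by rewrite /gcomm -powS -pow1 -powD. Qed.

Lemma qg_red (w : word V) : red w -> qg_word 1 0 w.
Proof.
by move=> rw x y z E; rewrite mul1n addn0 len_ev_red //; apply: (@red_factor x y z); rewrite -E.
Qed.

Lemma qg_le (lam c lam' c' : nat) (w : word V) : lam <= lam' -> c <= c' ->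
  qg_word lam c w -> qg_word lam' c' w.
Proof.
move=> l1 l2 qw x y z E; apply: leq_trans (qw x y z E) _.
by apply: leq_add => //; apply: leq_mul.
Qed.

(** Letters of the outer words count once in the size of a subword and three times when they are
    removed from its value, hence the factor 4. *)
Lemma qg_ends (w1 w2 w3 : word V) : qg_word 3 0 w2 ->
  qg_word 3 (4 * (size w1 + size w3)) (w1 ++ w2 ++ w3).
Proof.
move=> qw x y z /cat_factor3[y1 [y2 [y3 [-> l1 l3 [x' [z' E]]]]]].
have := qw _ _ _ E; rewrite addn0 !size_cat => l2.
have : len (ev y2) <= size y1 + len (ev (y1 ++ y2 ++ y3)) + size y3.
  have -> : ev y2 = (ev y1)^-1 * ev (y1 ++ y2 ++ y3) * (ev y3)^-1.
    by rewrite -!evM gmulKg gmulgK.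
  apply: leq_trans (len_mul _ _) _; rewrite lenV; apply: leq_add; last exact: len_ev_le.
  by apply: leq_trans (len_mul _ _) _; rewrite lenV leq_add2r; exact: len_ev_le.
by lia.
Qed.

(** A subword that contains all of [rep u] has at most [n + len u + n] letters, while its value is
    [u] times a power of [v] and has length at least [len u]. Other subwords are reduced. *)
Lemma qg_detour v u n : (forall s, s \in supp u -> e v s) -> n <= len u ->
  qg_word 3 0 (nseq n (v, true) ++ rep u ++ nseq n (v, false)).
Proof.
move=> su nu; set c := (v, true).
have O i (b : bool) : orth (pow (v, b) i) (ev (rep u)).
  by move=> s t /supp_pow -> /=; rewrite ev_rep; exact: su.
have r1 : red (nseq n c ++ rep u).
  by apply: red_rdc; [exact: red_nseq|exact: rep_red|apply: orth_rdc; exact: O].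
have r2 : red (rep u ++ nseq n (neg c)).
  by apply: red_rdc; [exact: rep_red|exact: red_nseq|apply: orth_rdc; apply: orth_sym; exact: O].
have q1 (w x y z : word V) : red w -> w = x ++ y ++ z -> size y <= 3 * len (ev y) + 0.
  by move=> rw E; apply: leq_trans (qg_red rw E) _; lia.
move=> x y z; rewrite catA => /cat_factor[[z' E]|[x' E]|[y1 [y2 [-> E1 E2]]]].
- exact: q1 E.
- exact: q1 (red_nseq _ _) E.
case/cat_split: E1 => [[d F1 ->]|[d F1 F2]]; last first.
  by apply: (@q1 (rep u ++ nseq n (neg c)) d (y1 ++ y2) z) => //; rewrite E2 F2 !catA.
have pieceP (b : bool) (k : nat) (w' w'' : word V) : nseq k (v, b) = w' ++ w'' ->
    w' = nseq (size w') (v, b) /\ w'' = nseq (size w'') (v, b).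
  move=> E; have al : all (pred1 (v, b)) (w' ++ w'') by rewrite -E all_pred1_nseq.
  by move: al; rewrite all_cat => /andP[/all_pred1P -> /all_pred1P ->]; rewrite !size_nseq.
have [_ Ed] := pieceP _ _ _ _ F1; have [Ey2 _] := pieceP _ _ _ _ E2.
have ld : size d <= n by rewrite -(size_nseq n c) F1 size_cat leq_addl.
have ly2 : size y2 <= n by rewrite -(size_nseq n (v, false)) E2 size_cat leq_addr.
have Cy : ev (d ++ rep u ++ y2) = ev (rep u) * (ev d * ev y2).
  have C : gcomm (ev d) (ev (rep u)) by rewrite Ed; apply: commute_orth; exact: O.
  by rewrite -!evM !gmulA C.
have Oy : orth (ev (rep u)) (ev d * ev y2).
  apply: orth_sym => s t /supp_sub; rewrite Ed Ey2 => /orP[] /supp_pow -> /=; rewrite ev_rep; exact: su.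
rewrite -catA Cy (orth_rdc Oy) ev_rep !size_cat -/(len u); lia.
Qed.

Context (R : realType) (S : fin_gen_set A) (H : set A).
Hypothesis sH : is_subgroup H.
Hypothesis mH : strongly_quasiconvex R S H.

(** Join [x] and [x * u] to [H] at both ends of the detour. The result is a quasigeodesic with
    constants depending only on [m0], and it passes through [x * pow (v, true) n]. *)
Lemma detour m0 : exists m, forall x u v n, near m0 H x -> near m0 H (x * u) ->
  (forall s, s \in supp u -> e v s) -> n <= len u -> near m H (x * pow (v, true) n).
Proof.
have [m hm] := morse_words sH mH 3 (8 * m0); exists m => x u v n [h1 H1 l1] [h2 H2 l2] su nu.
set s := h1^-1 * x in l1; set t := h2^-1 * (x * u) in l2.
pose w1 := rep s; pose w3 := rep t^-1.
have E : ev (w1 ++ (nseq n (v, true) ++ rep u ++ nseq n (v, false)) ++ w3) = h1^-1 * h2.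
  have C : gcomm (pow (v, true) n) u.
    by apply: commute_orth => s' t' /supp_pow -> /=; exact: su.
  rewrite /w1 /w3 -!evM !ev_rep -/(pow _ _) -/(pow (neg (v, true)) _) -powV !gmulA.
  rewrite -[s * _ * u]gmulA C gmulA gmulgK.
  by rewrite /s /t !ginvM !ginvK !gmulA !gmulgK.
set W := w1 ++ _ ++ w3 in E.
have HW : H (ev W) by rewrite E; apply: subgM => //; exact: subgV.
have qW : qg_word 3 (8 * m0) W.
  apply: qg_le (leqnn _) _ (qg_ends (w1 := w1) (w3 := w3) (qg_detour su nu)).
  by rewrite -!/(len _) lenV; lia.
have EW : W = (w1 ++ nseq n (v, true)) ++ (rep u ++ nseq n (v, false) ++ w3).
  by rewrite /W -!catA.
have [k Hk lk] := hm W HW qW _ _ EW.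
exists (h1 * k); first exact: subgM.
by move: lk; rewrite -evM ev_rep -/(pow _ _) ginvM !gmulA.
Qed.

(** Two of the powers have the same error in the ball, and the quotient of the corresponding
    elements of [H] is a conjugate of a power of [v]. *)
Lemma near_pow_mem m x v :
  (forall n, n <= size (word_ball Gr m) -> near m H (x * pow (v, true) n)) ->
  exists2 n, 0 < n & H (x * pow (v, true) n * x^-1).
Proof.
move=> nr; have ex n : exists k : A, n <= size (word_ball Gr m) ->
    k \in word_ball Gr m /\ H (x * pow (v, true) n * k^-1).
  have [n0|n0] := leqP n (size (word_ball Gr m)); last by exists 1.
  have [h Hh l] := nr n n0; exists (h^-1 * (x * pow (v, true) n)) => _; split.
    exact: word_ball_mem.
  by rewrite ginvM ginvK gmulA gmulgV gmul1g.
have [f hf] := choice ex.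
have [i [j [ij jl E]]] := pigeonhole (fun n (nl : n <= size (word_ball Gr m)) => (hf n nl).1).
exists (j - i); first by rewrite subn_gt0.
have [_ Hi] := hf i (leq_trans (ltnW ij) jl); have [_ Hj] := hf j jl.
have := subgM sH Hj (subgV sH Hi); rewrite -E ginvM ginvK gmulA gmulgVK ginvM.
by rewrite -{1}(subnK (ltnW ij)) powD !gmulA gmulgK.
Qed.

Lemma morse_near : exists m, forall p q, H (p * q) -> rdc p q -> near m H p.
Proof.
have [m hm] := morse_words sH mH 1 0; exists m => p q Hpq pq.
have rw : red (rep p ++ rep q) by apply: red_rdc; rewrite ?ev_rep //; exact: rep_red.
have := hm (rep p ++ rep q) _ (qg_red rw) (rep p) (rep q) erefl.
by rewrite -evM !ev_rep; apply.
Qed.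

(** A piece [u] of an element of [H] that commutes with [v] and is longer than a ball allows enough
    detours for [near_pow_mem] to find a forbidden power. *)
Lemma morse_good : ~ (exists x v, exists2 n, 0 < n & H (x * pow (v, true) n * x^-1)) -> good H.
Proof.
move=> no; split=> //; have [m0 hm0] := morse_near; have [m hm] := detour m0.
exists (m0 + size (word_ball Gr m)) => h Hh; split; last first.
  move=> p q E pq; apply: near_le (leq_addr _ _) _; apply: hm0 pq; by rewrite -E.
move=> p u q v E pu puq su; rewrite leqNgt; apply/negP => lu; apply: no.
exists p, v; apply: (@near_pow_mem m) => n nl.
have [_ puq'] := rdc3l pu puq.
apply: (hm p u v n) => //.
- by apply: (hm0 p (u * q)) => //; rewrite gmulA -E.
- by apply: (hm0 (p * u) q) => //; rewrite -E.
- by apply: leq_trans nl _; apply: ltnW; apply: leq_ltn_trans lu; exact: leq_addl.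
Qed.

End Detours.

(** * Either finite index or good *)

Section Dichotomy.
Context (R : realType) (Gr : sgraph).
Local Notation V := (vert Gr).
Local Notation e := (edge Gr).
Local Notation A := (raag e).
Local Notation len := (@len Gr).
Local Notation letter := (@letter Gr).
Local Notation starts := (@starts Gr).
Local Notation rdc := (@rdc Gr).
Implicit Types (a b c d : V * bool) (g h k p q r u x y z : A) (s t v : V).
Context (S : fin_gen_set A) (H : set A).
Hypothesis e_conn : connected_graph e.
Hypothesis sH : is_subgroup H.
Hypothesis mH : strongly_quasiconvex R S H.

Definition has_power x v := exists2 n, 0 < n & H (x * pow (v, true) n * x^-1).

Lemma power_mul x v n m : H (x * pow (v, true) n * x^-1) ->
  H (x * pow (v, true) (n * m)%N * x^-1).
Proof.
move=> Hn; elim: m => [|m IH]; first by rewrite muln0 gmulg1 gmulgV; exact: subg1.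
by have := subgM sH Hn IH; rewrite !gmulA gmulgVK -[_ * pow _ n * _]gmulA -powD mulnS.
Qed.

(** Powers of [v] commute with [w], stay within [len x] of [H] after translation by [x], and are
    arbitrarily long, so they carry detours of every length in direction [w]. *)
Lemma has_power_edge x v w : e v w -> has_power x v -> has_power x w.
Proof.
move=> vw [n n0 Hn]; have [m hm] := detour sH mH (len x).
apply: (near_pow_mem (m := m) sH) => k _.
apply: (hm x (pow (v, true) (n * k)%N)).
- by exists 1; [exact: subg1|rewrite ginv1 gmul1g].
- exists (x * pow (v, true) (n * k)%N * x^-1); first exact: power_mul.
  by rewrite ginvM ginvK gmulgVK.
- by move=> s /supp_pow ->; rewrite e_sym.
- by rewrite len_pow leq_pmull.
Qed.

Lemma has_power_all x v w : has_power x v -> has_power x w.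
Proof.
have /connectP[p pth ->] := e_conn v w; elim: p v pth => //= s p IH v /andP[vs pth] hv.
by apply: IH => //; exact: has_power_edge vs hv.
Qed.

(** Pass to the vertex of [c]: its powers commute with [letter c], so [x] and [x * letter c] give
    the same conjugates. Then return to [v]. *)
Lemma has_power_letter x v c : has_power x v -> has_power (x * letter c) v.
Proof.
move=> /(@has_power_all _ _ c.1)[n n0 Hn]; apply: (@has_power_all _ c.1); exists n => //.
have C : gcomm (letter c) (pow (c.1, true) n).
  case: c {Hn} => s [] /=; first exact: pow_comm.
  rewrite -[(s, false)]/(neg (s, true)) letterN; apply/esym/gcommV/esym; exact: pow_comm.
by rewrite -[x * _ * _]gmulA C ginvM !gmulA gmulgK.
Qed.

Lemma has_power_every x v y w : has_power x v -> has_power y w.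
Proof.
move=> hx; apply: (@has_power_all _ v).
rewrite -(gmulVKg x y); elim/len_ind: (x^-1 * y) => z IH.
rewrite -[z]ginvK; have [/len_eq0 ->|] := posnP (len z^-1); first by rewrite ginv1 gmulg1.
case/starts_ex => c /starts_split[z' E r]; rewrite E ginvM gmulA -letterN; apply: has_power_letter.
by apply: IH; rewrite lenV -(lenV z) E r len_letter.
Qed.

Lemma strip_power x v : exists x' (k : nat) (b : bool), x = x' * pow (v, b) k /\
  forall b' : bool, ~~ starts (v, b') x'^-1.
Proof.
elim/len_ind: x => x IH.
have [[b sb]|no] := pselect (exists b : bool, starts (v, b) x^-1); last first.
  exists x, 0, true; rewrite gmulg1; split=> // b; apply/negP => sb; apply: no.
  by exists b.
have [y E r] := starts_split sb.
have Ex : x = y^-1 * letter (neg (v, b)) by rewrite -[x]ginvK E ginvM letterN.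
have [|x' [k [b' [E2 no]]]] := IH y^-1.
  by rewrite lenV -(lenV x) E r len_letter.
rewrite Ex E2; case: k {E2} => [|k].
  by exists x', 1%N, (~~ b); rewrite gmulg1 pow1.
have [bb|bb] := eqVneq b' (~~ b).
  by exists x', k.+2, b'; rewrite -gmulA /neg /= -bb -powS.
have {bb}-> : b' = b by move: bb; case: (b); case: (b').
exists x', k, b; rewrite letterN powS !gmulA gmulgK; split=> //.
Qed.

(** Every [y] has the form [y' * pow c k] with no further power of [v] at the end of [y']. The path
    spelling [y'], a long power of [c] and [y'^-1] ends in [H], is uniformly quasigeodesic and
    passes through [y]. *)
Lemma has_power_finite_index x v : has_power x v -> finite_index H.
Proof.
move=> hx; have [m hm] := morse_words sH mH 3 0.
have near_all y : near m H y.
  have [y' [k [b [E no]]]] := strip_power y v; set c := (v, b) in E.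
  have [n n0 Hn] := has_power_every y' v hx.
  (* A subword spanning the power, with outer parts [f] and [d] of length at most [len y'], has at
     most [N] plus their lengths letters and value of length at least [N] minus their lengths. The
     ratio is at most 3 once [N] is at least [4 * len y']; [k <= N] makes the path reach [y]. *)
  pose N := (n * (4 * len y' + k))%N.
  have HN : H (y' * pow c N * y'^-1).
    have HN := power_mul (4 * len y' + k) Hn; rewrite -/N in HN.
    rewrite /c; case: (b) => //; rewrite -[(v, false)]/(neg (v, true)) -powV.
    by have := subgV sH HN; rewrite !ginvM ginvK !gmulA.
  have kN : k <= N by rewrite /N; nia.
  have lN : 4 * len y' <= N by rewrite /N; nia.
  have nos d : starts d y'^-1 -> d.1 <> v.
    by case: d => s b' /= sd Es; subst s; rewrite (negbTE (no b')) in sd.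
  have r1 : rdc y' (pow c N).
    rewrite /rdc -{1}[y']ginvK rdc_crit ?lenV // => d /nos dv /starts_supp/supp_pow.
    exact: dv.
  have r2 : rdc (pow c N) y'^-1.
    rewrite /rdc -{1}[pow c N]ginvK rdc_crit ?lenV // => d sd /nos; apply.
    by move: (starts_supp sd); rewrite powV => /supp_pow.
  pose w3 := winv (rep y').
  have Ew3 : ev w3 = y'^-1 by rewrite /w3 -evV ev_rep.
  have sw3 : size w3 = len y' by rewrite winv_size.
  have rw3 : red w3 by apply: red_len; rewrite Ew3 lenV sw3.
  pose W := rep y' ++ nseq N c ++ w3.
  have r1' : red (rep y' ++ nseq N c).
    by apply: red_rdc; rewrite ?ev_rep //; [exact: rep_red|exact: red_nseq].
  have r2' : red (nseq N c ++ w3).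
    by apply: red_rdc; rewrite ?Ew3 //; exact: red_nseq.
  have q1 (w x' y2 z : word V) : red w -> w = x' ++ y2 ++ z -> size y2 <= 3 * len (ev y2) + 0.
    by move=> rw F; apply: leq_trans (qg_red rw F) _; lia.
  have qW : qg_word 3 0 W.
    move=> x1 y1 z1; rewrite /W catA => /cat_factor[[z' F]|[x' F]|[a [d [-> F1 F2]]]].
    - exact: q1 r1' F.
    - apply: (@q1 _ (nseq N c ++ x') y1 z1) r2' _; by rewrite F !catA.
    case/cat_split: F1 => [[f G1 ->]|[f G1 G2]]; last first.
      by apply: (@q1 (nseq N c ++ w3) f (a ++ d) z1) => //; rewrite G2 F2 !catA.
    have lf : size f <= len y' by rewrite /len G1 size_cat leq_addl.
    have ld : size d <= len y' by rewrite -sw3 F2 size_cat leq_addr.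
    have : N <= size f + len (ev ((f ++ nseq N c) ++ d)) + size d.
      rewrite -{1}(len_pow c N).
      have -> : pow c N = (ev f)^-1 * ev ((f ++ nseq N c) ++ d) * (ev d)^-1.
        by rewrite -!evM !gmulA gmulgK gmulVg gmul1g.
      apply: leq_trans (len_mul _ _) _; rewrite lenV; apply: leq_add; last exact: len_ev_le.
      by apply: leq_trans (len_mul _ _) _; rewrite lenV leq_add2r; exact: len_ev_le.
    rewrite !size_cat size_nseq; lia.
  have HW : H (ev W) by rewrite /W -!evM ev_rep Ew3 gmulA.
  have EW : W = (rep y' ++ nseq k c) ++ (nseq (N - k) c ++ w3).
    by rewrite /W -{1}(subnKC kN) nseqD !catA.
  by have := hm W HW qW _ _ EW; rewrite -evM ev_rep E.
(* Being near [H] controls right cosets, so it is applied to [g^-1]. *)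
apply/finite_indexP => //; exists [seq z^-1 | z <- word_ball Gr m] => g.
have [h Hh l] := near_all g^-1; exists (h^-1 * g^-1)^-1.
  by apply/mapP; exists (h^-1 * g^-1) => //; exact: word_ball_mem.
by rewrite ginvK gmulgVK; exact: subgV.
Qed.

Lemma morse_dichotomy : finite_index H \/ good H.
Proof.
have [[x [v hx]]|no] := pselect (exists x v, has_power x v).
  by left; exact: has_power_finite_index hx.
by right; exact: (morse_good sH mH no).
Qed.

End Dichotomy.

(** * Products with a factor of finite index *)

Section SetProducts.
Context (Gr : sgraph).
Local Notation A := (raag (edge Gr)).
Implicit Types (g h k x y z : A) (H N : set A) (l : seq (set A)).

(** Moving an element of [N] leftwards past the factors after [H] only conjugates it, so it stays in
    [N] and is absorbed by [H]. *)
Lemma pset_normal H N l : H \in l -> (forall x g, N x -> N (g^-1 * x * g)) ->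
  is_subgroup H -> N `<=` H -> forall x y, pset l x -> N y -> pset l (x * y).
Proof.
move=> Hl nN sH NH; elim: l Hl => //= K l IH; rewrite inE => /orP[/eqP <-|Hl] x y.
  case/pset_cons=> [h [z [Hh Pz ->]]] Ny; apply/pset_cons.
  exists (h * (z^-1^-1 * y * z^-1)), z; split=> //.
    by apply: subgM => //; apply: NH; exact: nN.
  by rewrite ginvK !gmulA gmulgVK.
case/pset_cons=> [h [z [Hh Pz ->]]] Ny; apply/pset_cons; exists h, (z * y).
by rewrite gmulA; split=> //; exact: IH.
Qed.

Lemma finite_index_product_separable H l : H \in l -> is_subgroup H -> finite_index H ->
  separable (pset l).
Proof.
move=> Hl sH fH; apply/separableP => g ng; exists (core H).
  by split; [exact: core_subgroup|exact: core_finite|move=> *; exact: core_conj].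
move=> x Nx Px; apply: ng; rewrite -(gmulVKg x g).
apply: (@pset_normal H (core H)) => //.
- by move=> y z; exact: core_conj.
- by move=> y; exact: core_sub.
- by have := subgV (core_subgroup sH) Nx; rewrite ginvM ginvK.
Qed.

Lemma set_prod_pset (n : nat) (H : 'I_n -> set A) :
  set_prod H = pset [seq H i | i <- enum 'I_n].
Proof.
have prodE (h : 'I_n -> A) : (\prod_(i < n) h i = \prod_(i <- enum 'I_n) h i)%g.
  by rewrite [index_enum _]unlock -enumT.
apply/seteqP; split=> x.
  case=> h hH <-; exists [seq h i | i <- enum 'I_n].
    by elim: (enum 'I_n).
  rewrite prodE; elim: (enum 'I_n) => [|i s IH]; first by rewrite big_nil.
  by rewrite big_cons /= IH.
case=> s hs ->.
suff [h hH E] : exists2 h : 'I_n -> A, forall i, i \in enum 'I_n -> H i (h i) &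
    \prod_(i <- enum 'I_n) h i = prodl s.
  by exists h; [move=> i; apply: hH; rewrite mem_enum|rewrite -E prodE].
elim: (enum 'I_n) (enum_uniq 'I_n) s hs => [|i r IH] /=.
  by move=> _ [|? ?] //= _; exists (fun=> 1) => //; rewrite big_nil.
case/andP=> ir ur [|b s] //= [Hb /(IH ur)[h hH E]].
exists (fun j => if j == i then b else h j).
  by move=> j; rewrite inE; case: eqP => [->|_] //=; exact: hH.
rewrite big_cons eqxx -E; congr (_ * _); apply: eq_big_seq => j jr.
by case: eqP ir => // <-; rewrite jr.
Qed.

End SetProducts.

Theorem corollary1p4 (R : realType) (V : finType) (e : rel V)
    (e_sym : symmetric e) (e_irrefl : irreflexive e)
    (e_conn : connected_graph e) (S : fin_gen_set (raag e))
    (n : nat) (n_gt0 : (0 < n)%N) (H : 'I_n -> set (raag e))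
    (H_sub : forall i, is_subgroup (H i))
    (H_qc : forall i, strongly_quasiconvex R S (H i)) :
  separable (set_prod H).
Proof.
pose Gr := SGraph e_sym e_irrefl.
have dich i : finite_index (H i) \/ @good Gr (H i).
  exact: (@morse_dichotomy R Gr S (H i) e_conn (H_sub i) (H_qc i)).
rewrite (@set_prod_pset Gr n H).
case: (pselect (exists i, finite_index (H i))) => [[i fi]|no].
  apply: (@finite_index_product_separable Gr (H i)) => //.
  by apply/mapP; exists i; rewrite ?mem_enum.
apply: (@good_product_separable Gr) => K /mapP[i _ ->].
by case: (dich i) => // fi; case: no; exists i.
Qed.
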